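(* Let $d\ge2$ and let $\mu$ be a non-trivial probability nc measure on $\mathscr{A}_d$, with absolutely continuous part $\mu_{\mathrm{ac}}$ and nc Radon–Nikodym derivative $T$, Verblunsky coefficients $(\gamma_\sigma)$, monic orthogonal polynomials $(\Phi_\sigma)$, orthonormal polynomials $(\varphi_\sigma)$ with leading coefficients $a_{\sigma,\sigma}$, reverse polynomials $(\varphi_\sigma^{\#})$ and multi-Toeplitz determinants $(D_\sigma)$ ($\sigma\in\mathbb{F}_d^+$). Write $0=0^{(d)}_{1\times1}=(0,\dots,0)\in\mathbb{C}^d$. The following quantities are equal: (i) $\kappa:=\lim_{n\to\infty}\|\Phi_{\sigma(n)}\|_\mu^2$; (ii) $\lim_{n\to\infty}a_{\sigma(n),\sigma(n)}^{-2}$; (iii) $\prod_{n=0}^\infty(1-|\gamma_{\sigma(n)}|^2)$; (iv) $\lim_{n\to\infty}\dfrac{D_{\sigma(n)}}{D_{\sigma(n)-1}}$. Moreover, the following quantities are equal: (v) $\tilde\kappa:=\prod_{\sigma\in\mathbb{F}_d^+}(1-|\gamma_\sigma|^2)$; (vi) $\Lambda_\infty(0;\mu)$; (vi)$'$ $\Lambda_\infty(0;\mu_{\mathrm{ac}})$; (vii) $\lim_{n\to\infty}|\varphi^{\#}_{\sigma(n)}(0)|^{-2}$; (viii) $\lim_{n\to\infty}\Big(\sum_{\emptyset\preceq\sigma\preceq\sigma(n)}|\varphi_\sigma(0)|^2\Big)^{-1}$; (ix) $\lim_{n\to\infty}\langle TQ_n,Q_n\rangle_{\mathbb{H}^2_d}$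 for some $Q_n\in\mathbb{C}\langle Z\rangle_{\sigma(n)}$, $n\in\mathbb{N}$, namely the minimisers $Q_n$ defined in the context; (x) $\mathbb{E}(\tilde\mu)=\int_0^\infty t\,\mathrm{d}\tilde\mu(t)$ for some positive Borel measure $\tilde\mu$ on $[0,\infty)$. Finally, $$\tilde\kappa=\kappa\cdot\prod_{\sigma\in\mathbb{F}_d^+\setminus\{\sigma(n):n\in\mathbb{N}\}}(1-|\gamma_\sigma|^2).$$
   Context: Words. $\mathbb{N}=\{0,1,2,\dots\}$. $\mathbb{F}_d^+$ is the free monoid on the generators $1,\dots,d$, with identity $\emptyset$ and product given by concatenation; $|\sigma|$ is the length of $\sigma$. Shortlex ordering: $\sigma\prec\tau$ if $|\sigma|<|\tau|$, or if $|\sigma|=|\tau|$ and $\sigma$ precedes $\tau$ lexicographically (with $1\prec\cdots\prec d$). $\sigma-1$ is the immediate predecessor of $\sigma\neq\emptyset$. $\sigma(n)=d\cdots d$ ($n$ copies) is the last word of length $n$; $\sigma(0)=\emptyset$. For a $d$-tuple $Z$ and $\sigma=\sigma_1\cdots\sigma_n$, $Z^\sigma:=Z_{\sigma_1}\cdots Z_{\sigma_n}$, $Z^\emptyset:=1$. $\mathbb{C}\langle Z\rangle$ is the algebra of polynomials in noncommuting variables $Z_1,\dots,Z_d$ with complex coefficients, and $\mathbb{C}\langle Z\rangle_\sigma=\mathrm{span}\{Z^\tau:\tau\preceq\sigma\}$. For a polynomial $P$, $P(0)$ is its constant coefficient. nc measures. The nc Hardy space $\mathbb{H}^2_d$ is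 the Hilbert space of formal power series $\sum_\sigma c_\sigma Z^\sigma$ with $\sum_\sigma|c_\sigma|^2<\infty$ and orthonormal basis $\{Z^\sigma\}$; $L=(L_1,\dots,L_d)$, $(L_jf)(Z)=Z_jf(Z)$, so $L_j^*L_k=\delta_{jk}I$. $\mathcal{A}_d$ is the operator-norm closure of $\{p(L):p\in\mathbb{C}\langle Z\rangle\}$; its elements $a$ are also regarded as elements $a1$ of $\mathbb{H}^2_d$. $\mathscr{A}_d:=\overline{\mathcal{A}_d+\mathcal{A}_d^*}$ (operator-norm closure). An nc measure is a linear functional $\mu:\mathscr{A}_d\to\mathbb{C}$ with $\mu(f)\ge0$ for all positive operators $f\in\mathscr{A}_d$. For nc polynomials $P,Q$, $\mu(Q^*P)$ means $\mu(Q(L)^*P(L))$. Put $K_\mu(\sigma,\tau):=\mu((L^\tau)^*L^\sigma)$. $\mu$ is a probability nc measure if $\mu(I)=1$, and non-trivial if $[K_\mu(\sigma,\tau)]_{\sigma,\tau\preceq\sigma_0}$ is invertible for every $\sigma_0$. The multi-Toeplitz determinants are $D_{\sigma_0}:=\det[K_\mu(\sigma,\tau)]_{\sigma,\tau\preceq\sigma_0}$. Lebesgue decomposition. For an nc measure $\nu$ let $q_\nu(a_1,a_2):=\nu(a_1^*a_2)$, a positive quadratic form in $\mathbb{H}^2_d$ with dense domain $\mathcal{A}_d$. $\nu$ is absolutely continuous if $q_\nu$ is absolutely continuous in the sense of Simon, i.e. closable, and singular if $q_\nu$ is singular in the sense of Simon, i.e. the largest closable positive form bounded above by $q_\nu$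 is $0$. Every nc measure has a unique decomposition $\mu=\mu_{\mathrm{ac}}+\mu_{\mathrm{s}}$ into nc measures with $\mu_{\mathrm{ac}}$ the maximal absolutely continuous nc measure bounded above by $\mu$ and $\mu_{\mathrm{s}}$ singular (a theorem of Jury and Martin). A closed, positive, densely defined operator $T$ in $\mathbb{H}^2_d$ is $L$-Toeplitz if $L_j\mathcal{D}(\sqrt T)\subseteq\mathcal{D}(\sqrt T)$ for all $j$ and $\langle\sqrt TL_jg,\sqrt TL_kh\rangle=\delta_{jk}\langle\sqrt Tg,\sqrt Th\rangle$ for $g,h\in\mathcal{D}(\sqrt T)$. The nc Radon–Nikodym derivative of $\mu$ is the unique closed, densely defined, positive $L$-Toeplitz operator $T$ with $\mathcal{A}_d\subseteq\mathcal{D}(\sqrt T)$ and $\mu_{\mathrm{ac}}(a_2^*a_1)=\langle\sqrt Ta_1,\sqrt Ta_2\rangle_{\mathbb{H}^2_d}$ for $a_1,a_2\in\mathcal{A}_d$. For a polynomial $Q$, $\langle TQ,Q\rangle_{\mathbb{H}^2_d}$ is understood as the associated form $\langle\sqrt TQ,\sqrt TQ\rangle_{\mathbb{H}^2_d}$. Orthogonal polynomials. For $\mu$ a non-trivial probability nc measure, $\langle P,Q\rangle_\mu:=\mu(Q^*P)$ is an inner product on $\mathbb{C}\langle Z\rangle$ with norm $\|\cdot\|_\mu$. Gram–Schmidt applied to $\{Z^\sigma\}$ in shortlex order gives the monic orthogonal polynomials $\Phi_\sigma$ and, after normalisation, the orthonormal polynomials $\varphi_\sigma=\Phi_\sigma/\|\Phi_\sigma\|_\mu$;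 $a_{\sigma,\sigma}>0$ is the coefficient of $Z^\sigma$ in $\varphi_\sigma$. Verblunsky coefficients $(\gamma_\sigma)_{\sigma\in\mathbb{F}_d^+}\subseteq\mathbb{D}$ (the open unit disc): $\gamma_\emptyset=0$ and for $\sigma\ne\emptyset$, $\gamma_\sigma$ is the Schur parameter $\gamma_{\emptyset,\sigma}$ (in the sense of Constantinescu) of $K_\mu$ viewed as a kernel on $\mathbb{N}$ via the shortlex order; explicitly $$\gamma_\sigma=\frac{\langle (I-P_\sigma)Z^\sigma,(I-P_\sigma)1\rangle_\mu}{\|(I-P_\sigma)Z^\sigma\|_\mu\,\|(I-P_\sigma)1\|_\mu},$$ where $P_\sigma$ is the $\langle\cdot,\cdot\rangle_\mu$-orthogonal projection onto $\mathrm{span}\{Z^\tau:\emptyset\prec\tau\prec\sigma\}$. The reverse polynomials $\varphi_\sigma^{\#}$ are the polynomials given by $\varphi_\emptyset^{\#}=1$ and the recurrences, for $\sigma\in\mathbb{F}_d^+$, $k\in\{1,\dots,d\}$, $$\varphi_{k\sigma}=\frac{1}{\sqrt{1-|\gamma_{k\sigma}|^2}}\big(Z_k\varphi_\sigma-\gamma_{k\sigma}\varphi_{k\sigma-1}^{\#}\big),\qquad \varphi^{\#}_{k\sigma}=\frac{1}{\sqrt{1-|\gamma_{k\sigma}|^2}}\big(-\overline{\gamma_{k\sigma}}Z_k\varphi_\sigma+\varphi^{\#}_{k\sigma-1}\big).$$ Christoffel function. For an nc measure $\nu$, $\Lambda_\infty(0;\nu):=\inf\{\nu(Q^*Q):Q\in\mathbb{C}\langle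 Z\rangle,\ Q(0)=1\}$; for a non-trivial probability nc measure this equals $\lim_n\Lambda_n(0;\nu)$, where $\Lambda_n(0;\mu)=\big(\sum_{\emptyset\preceq\sigma\preceq\sigma(n)}|\varphi_\sigma(0)|^2\big)^{-1}$. The minimisers are $$Q_n:=\Lambda_n(0;\mu)\sum_{\emptyset\preceq\sigma\preceq\sigma(n)}\overline{\varphi_\sigma(0)}\,\varphi_\sigma\in\mathbb{C}\langle Z\rangle_{\sigma(n)},$$ which attain $\min\{\mu(Q^*Q):Q\in\mathbb{C}\langle Z\rangle_{\sigma(n)},Q(0)=1\}=\Lambda_n(0;\mu)$. *)

(* Defs.v *)
From HB Require Import structures.
From mathcomp Require Import all_boot all_order all_algebra finmap.
From mathcomp Require Import all_classical all_reals all_analysis.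
From mathcomp Require Import complex ring.
From mathcomp.analysis.showcase Require Import summability.
(* The notations of monalg and of mathcomp-analysis cannot be imported
   together. *)
From mathcomp Require Export -(notations) monalg.

Set Implicit Arguments.
Unset Strict Implicit.
Unset Printing Implicit Defensive.
Import Order.TTheory GRing.Theory Num.Theory numFieldNormedType.Exports.
Local Open Scope classical_set_scope.
Local Open Scope ring_scope.
Local Open Scope complex_scope.

Notation modc := Normc.normc.

(* Words on d letters; the generators 1, ..., d are encoded as the elements
   0, ..., d-1 of 'I_d. *)
Notation word d := (fmonom (ordinal d)).

Section Words.
Variable d : nat.
Implicit Types s t : word d.

Definition emptyword : word d := FMonom [::].

Definition shortlex s t :=
  (size s < size t)%N ||
  ((size s == size t) && ((s : seqlexi 'I_d) < (t : seqlexi 'I_d))%O).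

Definition words_of_length (n : nat) : seq (word d) :=
  iter n (fun ws : seq (word d) =>
      [seq FMonom (k :: fmonom_val w) : word d | k <- enum 'I_d, w <- ws])
    [:: emptyword].

Definition words_upto (n : nat) : seq (word d) :=
  flatten [seq words_of_length m | m <- iota 0 n.+1].

(* [before] and [upto] list words in increasing shortlex order, see mem_before,
   mem_upto and upto_sorted. *)
Definition before s := [seq t <- words_upto (size s) | shortlex t s].
Definition upto s := rcons (before s) s.

(* The predecessor s - 1; by convention the empty word is its own
   predecessor. *)
Definition wpred s : word d := last emptyword (before s).

(* n copies of the last letter, which is d-1 in 'I_d; see lastwordE. *)
Definition lastword (n : nat) : word d := FMonom (pmap insub (nseq n d.-1)).

Lemma shortlex_irr : irreflexive shortlex.
Proof. by move=> s; rewrite /shortlex ltnn eqxx ltxx. Qed.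

Lemma shortlex_trans : transitive shortlex.
Proof.
move=> t s u; rewrite /shortlex => /orP[st|/andP[/eqP st lst]].
  by move=> /orP[tu|/andP[/eqP <- _]]; rewrite ?st// (ltn_trans st tu).
rewrite st => /orP[->//|/andP[/eqP tu ltu]].
by rewrite tu ltnn eqxx /= (lt_trans lst ltu).
Qed.

Lemma shortlex_total s t : [|| shortlex s t, s == t | shortlex t s].
Proof.
rewrite /shortlex; case: (ltngtP (size s) (size t)) => //= st; rewrite ?orbT//.
rewrite -[s == t]/((s : seqlexi 'I_d) == (t : seqlexi 'I_d)).
by case: (ltgtP (s : seqlexi 'I_d) (t : seqlexi 'I_d)).
Qed.

Lemma mem_words_of_length n s : (s \in words_of_length n) = (size s == n).
Proof.
elim: n s => [|n IH] [s] /=; first by rewrite inE size_eq0.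
apply/allpairsP/idP => [[[k w] /= [_ wn [->]]]|]; first by rewrite /= eqSS -IH.
case: s => //= k w; rewrite eqSS => wn; exists (k, FMonom w).
by rewrite /= mem_enum IH.
Qed.

Lemma words_of_length_sorted n : sorted shortlex (words_of_length n).
Proof.
rewrite sorted_pairwise; last exact: shortlex_trans.
elim: n => [//|n IH]; set ws := words_of_length n in IH.
rewrite [words_of_length _]/= -/(words_of_length n) -/ws.
have sz (w : word d) : w \in ws -> size w = n.
  by rewrite mem_words_of_length => /eqP.
have : pairwise (fun k l : 'I_d => (k < l)%N) (enum 'I_d).
  rewrite -sorted_pairwise; last by move=> ? ? ?; apply: ltn_trans.
  by have := iota_ltn_sorted 0 d; rewrite -val_enum_ord sorted_map.
elim: (enum 'I_d) => //= k l IHl /andP[/allP kl /IHl pl].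
rewrite pairwise_cat pl andbT; apply/andP; split.
  apply/allrelP => s t /mapP[w wm ->] /allpairsP[[k' w'] /= [k'l w'm ->]].
  rewrite /shortlex /= (sz _ wm) (sz _ w'm) eqxx ltnn /=.
  rewrite Order.SeqLexiOrder.Exports.neqhead_ltxiE ?ltEord ?kl//.
  by rewrite -val_eqE /= ltn_eqF// kl.
rewrite pairwise_map; apply: sub_pairwise IH => s t /=.
by rewrite /shortlex /= ltnS eqSS ltxi_cons lexx.
Qed.

Lemma words_uptoS n : words_upto n.+1 = words_upto n ++ words_of_length n.+1.
Proof.
by rewrite /words_upto -(addn1 n.+1) iotaD map_cat flatten_cat /= cats0.
Qed.

Lemma mem_words_upto n s : (s \in words_upto n) = (size s <= n)%N.
Proof.
elim: n => [|n IH].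
  by rewrite [words_upto _]/= inE leqn0; case: s => s; rewrite size_eq0.
by rewrite words_uptoS mem_cat IH mem_words_of_length (leq_eqVlt _ n.+1) orbC ltnS.
Qed.

Lemma words_upto_sorted n : sorted shortlex (words_upto n).
Proof.
have tr := shortlex_trans; rewrite sorted_pairwise//.
elim: n => [//|n IH].
rewrite words_uptoS pairwise_cat IH -sorted_pairwise// words_of_length_sorted.
rewrite !andbT; apply/allrelP => s t.
rewrite mem_words_upto mem_words_of_length => sn /eqP tn.
by rewrite /shortlex tn ltnS sn.
Qed.

Lemma mem_before s t : (t \in before s) = shortlex t s.
Proof.
rewrite mem_filter mem_words_upto andb_idr// => /orP[/ltnW//|].
by case/andP => /eqP ->.
Qed.

Lemma mem_upto s t : (t \in upto s) = (t == s) || shortlex t s.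
Proof. by rewrite mem_rcons inE mem_before. Qed.

Lemma before_sorted s : sorted shortlex (before s).
Proof. exact/sorted_filter/words_upto_sorted/shortlex_trans. Qed.

Lemma upto_sorted s : sorted shortlex (upto s).
Proof.
have tr := shortlex_trans; rewrite sorted_pairwise//.
rewrite pairwise_rcons -sorted_pairwise// before_sorted andbT.
by apply/allP => t; rewrite mem_before.
Qed.

Lemma upto_wpred s : s != emptyword -> upto (wpred s) = before s.
Proof.
move=> s0; have [tr irr] := (shortlex_trans, shortlex_irr).
have eb : emptyword \in before s.
  by rewrite mem_before /shortlex /=; case: s s0 => -[].
have [l [p E]] : exists l p, before s = rcons l p.
  by case/lastP: (before s) eb => [//|l p] _; exists l, p.
have bp : wpred s = p by rewrite /wpred E last_rcons.
apply: (irr_sorted_eq tr irr) (upto_sorted _) (before_sorted _) _ => t.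
rewrite mem_upto mem_before bp.
have ps : shortlex p s by rewrite -mem_before E mem_rcons inE eqxx.
apply/orP/idP => [[/eqP ->//|/tr] | ]; first by apply.
rewrite -mem_before E mem_rcons inE => /orP[tp|tl]; [by left|right].
have := before_sorted s; rewrite E sorted_pairwise// pairwise_rcons.
by case/andP => /allP /(_ _ tl).
Qed.

Lemma lastwordE n (k : 'I_d) : k = d.-1 :> nat -> lastword n = FMonom (nseq n k).
Proof.
move=> kd; rewrite /lastword; congr FMonom.
by elim: n => //= n ->; rewrite -kd valK.
Qed.

End Words.

Section Hardy.
Variables (R : realType) (d : nat).

Definition sqnorm (f : word d -> R[i]) : \bar R :=
  \esum_(w in [set: word d]) ((modc (f w)) ^+ 2)%:E.

Definition square_summable : {pred word d -> R[i]} :=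
  fun f => (sqnorm f < +oo)%E.

Lemma sqnorm_ge0 f : (0 <= sqnorm f)%E.
Proof. by apply: esum_ge0 => w _; rewrite lee_fin sqr_ge0. Qed.

Lemma modc_ge0 (z : R[i]) : 0 <= modc z.
Proof. by case: z => a b; rewrite sqrtr_ge0. Qed.

Lemma modcZ (a z : R[i]) : modc (a *: z) = modc a * modc z.
Proof. exact: Normc.normcM. Qed.

Lemma le_sqnormZ a f : (sqnorm (a *: f)%R <= (modc a ^+ 2)%:E * sqnorm f)%E.
Proof.
apply: ge_ereal_sup => _ [X [finX _] <-].
rewrite (eq_fsbigr (fun w => (modc a ^+ 2)%:E * (modc (f w) ^+ 2)%:E)%E); last first.
  by move=> w _; rewrite [(a *: f) w]/= -EFinM -exprMn -modcZ.
rewrite -ge0_mule_fsumr; last by move=> w; rewrite lee_fin sqr_ge0.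
apply: lee_wpmul2l; first by rewrite lee_fin sqr_ge0.
by apply: ereal_sup_ubound; exists X.
Qed.

Lemma modc_sqD (t : R) (x y : R[i]) : 0 < t ->
  modc (x + y) ^+ 2 <= (1 + t) * modc x ^+ 2 + (1 + t^-1) * modc y ^+ 2.
Proof.
move=> t0; have := le_normcD x y; set a := modc x; set b := modc y.
have a0 : 0 <= a := modc_ge0 x. have b0 : 0 <= b := modc_ge0 y.
move=> /(lerXn2r 2 (modc_ge0 _) (addr_ge0 a0 b0)) h.
apply: le_trans h _.
have -> : (1 + t) * a ^+ 2 + (1 + t^-1) * b ^+ 2 =
   (a + b) ^+ 2 + t * (a - t^-1 * b) ^+ 2.
  by field; rewrite gt_eqF.
by rewrite lerDl mulr_ge0 ?sqr_ge0 ?ltW.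
Qed.

Lemma sqnormD (t : R) (f g : word d -> R[i]) : 0 < t ->
  (sqnorm (f + g)%R <= (1 + t)%:E * sqnorm f + (1 + t^-1)%:E * sqnorm g)%E.
Proof.
move=> t0; apply: ge_ereal_sup => _ [X [finX _] <-].
have t1 : 0 <= 1 + t by rewrite addr_ge0 ?ltW.
have t2 : 0 <= 1 + t^-1 by rewrite addr_ge0 ?invr_ge0 ?ltW.
apply: (@le_trans _ _ (\sum_(w \in X) ((1 + t)%:E * (modc (f w) ^+ 2)%:E
   + (1 + t^-1)%:E * (modc (g w) ^+ 2)%:E))%E).
  apply: lee_fsum => // w _.
  by rewrite -!EFinM -EFinD lee_fin [(f + g) w]/=; exact: modc_sqD.
rewrite fsbig_split//= -!ge0_mule_fsumr;
  try by move=> w; rewrite lee_fin sqr_ge0.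
by apply: leeD; (apply: lee_wpmul2l; first by rewrite lee_fin);
   apply: ereal_sup_ubound; exists X.
Qed.

Lemma square_summable_submod : submod_closed square_summable.
Proof.
split; first by rewrite unfold_in /sqnorm esum1 ?ltry// => w _;
  rewrite Normc.normc0 expr0n.
move=> a f g; rewrite !unfold_in => sf sg.
have [f0 g0] := (sqnorm_ge0 f, sqnorm_ge0 g).
apply: le_lt_trans (sqnormD _ _ ltr01) _.
have saf : (sqnorm (a *: f) < +oo)%E.
  apply: le_lt_trans (le_sqnormZ _ _) _.
  by rewrite lte_mul_pinfty// ?lee_fin ?sqr_ge0.
by rewrite lte_add_pinfty// lte_mul_pinfty// ?lee_fin ?addr_ge0 ?invr_ge0.
Qed.

HB.instance Definition _ := GRing.isSubmodClosed.Build _ _ square_summable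
  square_summable_submod.

(* The space H^2_d: [coef f w] is the coefficient of Z^w in f. *)
Record hardy := Hardy {
  coef :> word d -> R[i] ; _ : coef \in square_summable }.

HB.instance Definition _ := [isSub of hardy for coef].
HB.instance Definition _ := [Choice of hardy by <:].
HB.instance Definition _ := [SubChoice_isSubLmodule of hardy by <:].

Definition hnorm (f : hardy) : R[i] := (Num.sqrt (fine (sqnorm f)))%:C.

Lemma sqnorm_fin (f : hardy) : sqnorm f \is a fin_num.
Proof.
by rewrite ge0_fin_numE ?sqnorm_ge0//; have := valP f; rewrite unfold_in.
Qed.

Lemma le_sqnorm (f : word d -> R[i]) w :
  (((modc (f w)) ^+ 2)%:E <= sqnorm f)%E.
Proof.
apply: ereal_sup_ubound; exists [set w]; last by rewrite fsbig_set1.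
by split.
Qed.

Lemma hnorm0_eq0 (f : hardy) : hnorm f = 0 -> f = 0.
Proof.
move=> [] /eqP; rewrite sqrtr_eq0 => f0; apply/val_inj/funext => w.
apply: Normc.eq0_normc; apply/eqP; rewrite -sqrf_eq0 eq_le sqr_ge0 andbT.
rewrite -lee_fin; apply: le_trans (le_sqnorm f w) _.
by rewrite -(fineK (sqnorm_fin f)) lee_fin.
Qed.

Lemma hnormZ (a : R[i]) (f : hardy) : hnorm (a *: f) = `|a| * hnorm f.
Proof.
have E : sqnorm (a *: f : hardy) = ((modc a ^+ 2)%:E * sqnorm f)%E.
  apply/eqP; rewrite eq_le le_sqnormZ /=.
  have [->|a0] := eqVneq a 0.
    by rewrite Normc.normc0 expr0n mul0e sqnorm_ge0.
  have an0 : modc a != 0 by apply: contraNneq a0 => /Normc.eq0_normc ->.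
  have e : ((a *: f : hardy) : word d -> R[i]) = a *: (f : word d -> R[i]).
    by [].
  have := @le_sqnormZ a^-1 (a *: f : hardy).
  rewrite {1}e scalerA mulVf// scale1r Normc.normcV => h.
  apply: (@le_trans _ _ ((modc a ^+ 2)%:E *
     (((modc a)^-1 ^+ 2)%:E * sqnorm (a *: f : hardy)))%E).
    by apply: lee_wpmul2l; rewrite ?lee_fin ?sqr_ge0.
  by rewrite muleA -EFinM exprVn divff ?expf_neq0// mul1e.
have nE : `|a| = (modc a)%:C by case: a {E}.
rewrite /hnorm E fineM ?sqnorm_fin//= sqrtrM ?sqr_ge0// sqrtr_sqr.
by rewrite (ger0_norm (modc_ge0 _)) nE -rmorphM.
Qed.

Lemma hnormD (f g : hardy) : hnorm (f + g) <= hnorm f + hnorm g.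
Proof.
rewrite /hnorm -rmorphD /= lecR.
set A := Num.sqrt (fine (sqnorm f)); set B := Num.sqrt (fine (sqnorm g)).
have A0 : 0 <= A by exact: sqrtr_ge0.
have B0 : 0 <= B by exact: sqrtr_ge0.
have [/(congr1 (real_complex R)) /hnorm0_eq0 f0|An] := eqVneq A 0.
  by rewrite f0 add0r -/B lerDr.
have [/(congr1 (real_complex R)) /hnorm0_eq0 g0|Bn] := eqVneq B 0.
  by rewrite g0 addr0 -/A lerDl.
have Ap : 0 < A by rewrite lt_def An.
have Bp : 0 < B by rewrite lt_def Bn.
rewrite -(@ler_pXn2r _ 2) ?nnegrE ?sqrtr_ge0 ?addr_ge0//.
rewrite sqr_sqrtr ?fine_ge0 ?sqnorm_ge0//.
have := @sqnormD (B / A) f g (divr_gt0 Bp Ap).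
rewrite -(fineK (sqnorm_fin f)) -(fineK (sqnorm_fin g)).
have -> : sqnorm ((f : word d -> R[i]) + (g : word d -> R[i]))%R =
   sqnorm (f + g : hardy) by [].
rewrite -(fineK (sqnorm_fin (f + g))) -!EFinM -EFinD lee_fin => /le_trans; apply.
rewrite -(@sqr_sqrtr _ (fine (sqnorm f))) ?fine_ge0 ?sqnorm_ge0//.
rewrite -(@sqr_sqrtr _ (fine (sqnorm g))) ?fine_ge0 ?sqnorm_ge0//.
rewrite -/A -/B le_eqVlt; apply/orP; left; apply/eqP.
by field; rewrite An Bn.
Qed.

HB.instance Definition _ :=
  @Lmodule_isNormed.Build R[i] hardy hnorm hnormD hnormZ hnorm0_eq0.

(* The inner product of H^2_d, linear in the first variable; the sum is
   unconditional, i.e. along the finite sets of words. *)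
Definition hdot (f g : hardy) : R[i] := sum (fun w => f w * (g w)^* : R[i]^o).

Definition onefun : word d -> R[i] := fun w => (w == emptyword d)%:R.

Lemma onefun_l2 : onefun \in square_summable.
Proof.
rewrite unfold_in /sqnorm (esumID [set emptyword d]) /=; last first.
  by move=> w _; rewrite lee_fin sqr_ge0.
rewrite setTI esum_set1 ?lee_fin ?sqr_ge0// esum1 ?adde0 ?ltry// => w.
by rewrite setTI /onefun => /= /eqP/negbTE ->; rewrite mulr0n Normc.normc0 expr0n.
Qed.

Definition hone : hardy := Hardy onefun_l2.

(* Left multiplication by Z_j: the coefficient of Z^w in Z_j f is the
   coefficient of Z^t in f if w = j t, and 0 if w does not begin with j. *)
Definition lshift_fun (j : 'I_d) (f : word d -> R[i]) : word d -> R[i] :=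
  fun w => if (w : seq _) is k :: t then if k == j then f (FMonom t) else 0
           else 0.

Lemma lshift_l2 j (f : hardy) : lshift_fun j f \in square_summable.
Proof.
pose e (t : word d) : word d := FMonom (j :: t).
have ie : set_inj [set: word d] e by move=> [s] [t] _ _ [->].
have := valP f; rewrite !unfold_in; congr (_ < +oo)%E.
rewrite /sqnorm [RHS](esumID (range e)); last first.
  by move=> w _; rewrite lee_fin sqr_ge0.
rewrite setTI esum_image// [X in (_ + X)%E]esum1 ?adde0.
  by apply: eq_esum => -[w] _; rewrite /lshift_fun /= eqxx.
move=> w [_ nr]; suff -> : lshift_fun j f w = 0 by rewrite Normc.normc0 expr0n.
case: w nr => -[//|k t] nr; rewrite /lshift_fun /=.
case: eqP => // kj; case: nr; exists (FMonom t) => //.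
by rewrite /e kj.
Qed.

Definition lshiftL (j : 'I_d) : hardy -> hardy := fun f => Hardy (lshift_l2 j f).

End Hardy.

Arguments hone {R d}.
Arguments emptyword {d}.

Notation hop R d := (hardy R d -> hardy R d).
Notation ncpoly R d := (malg (fmonom (ordinal d)) (complex R)).

Section DiscSystem.
Variables (R : realType) (d : nat).
Implicit Types (A B : hop R d) (P Q : ncpoly R d) (s t : word d).

Definition lshiftw s : hop R d := foldr (fun j A => @lshiftL R d j \o A) idfun s.

(* P(L). *)
Definition polyL P : hop R d := \sum_(s <- msupp P) mcoeff s P *: lshiftw s.

Definition is_adjoint A B := forall f g, hdot (A f) g = hdot f (B g).

(* The adjoint A^*, which exists and is unique for bounded A. *)
Definition adj A : hop R d := xget 0 [set B | is_adjoint A B].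

Definition opnorm_closure (S : set (hop R d)) : set (hop R d) :=
  [set A | forall e : R, 0 < e ->
     exists2 B, S B & forall f, `|A f - B f| <= e%:C * `|f|].

Definition disc_algebra : set (hop R d) := opnorm_closure (range polyL).

Definition disc_system : set (hop R d) :=
  opnorm_closure [set A + adj B | A in disc_algebra & B in disc_algebra].

Definition positive_op A := forall f, 0 <= hdot (A f) f.

(* A functional on the disc system is encoded as a function on all maps
   H^2_d -> H^2_d, whose values outside the disc system are irrelevant. *)
Definition nc_measure (mu : hop R d -> R[i]) :=
  (forall (a : R[i]) A B, disc_system A -> disc_system B ->
     mu (a *: A + B) = a * mu A + mu B) /\
  (forall A, disc_system A -> positive_op A -> 0 <= mu A).

Definition nc_le (nu mu : hop R d -> R[i]) :=
  forall A, disc_system A -> positive_op A -> nu A <= mu A.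

Definition probability_nc (mu : hop R d -> R[i]) := mu idfun = 1.

Definition toeplitz_kernel (mu : hop R d -> R[i]) s t : R[i] :=
  mu (adj (lshiftw t) \o lshiftw s).

Definition toeplitz_matrix (mu : hop R d -> R[i]) s :
    'M[R[i]]_(size (upto s)) :=
  \matrix_(i, j) toeplitz_kernel mu (nth emptyword (upto s) i)
                                    (nth emptyword (upto s) j).

Definition nontrivial_nc (mu : hop R d -> R[i]) :=
  forall s, toeplitz_matrix mu s \in unitmx.

Definition toeplitz_det (mu : hop R d -> R[i]) s : R[i] :=
  \det (toeplitz_matrix mu s).

End DiscSystem.

Section Forms.
Variables (R : realType) (d : nat).
Notation H := (hardy R d).

(* A quadratic form in H^2_d through its sesquilinear form, conjugate-linear
   in the first variable; only the values on the domain are relevant. *)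
Record qform := QForm { fdom : set H ; fval : H -> H -> R[i] }.
Implicit Types p q r : qform.

Definition linear_subspace (D : set H) :=
  D 0 /\ forall (a : R[i]) x y, D x -> D y -> D (a *: x + y).

Definition positive_form q :=
  [/\ linear_subspace (fdom q), dense (fdom q),
      forall (a : R[i]) x y z, fdom q x -> fdom q y -> fdom q z ->
        fval q x (a *: y + z) = a * fval q x y + fval q x z,
      forall x y, fdom q x -> fdom q y -> fval q y x = (fval q x y)^* &
      forall x, fdom q x -> 0 <= fval q x x].

Definition closed_form q := forall (u : nat -> H) (x : H),
  (forall n, fdom q (u n)) -> u @ \oo --> x ->
  (forall e : R, 0 < e -> exists N, forall n m, (N <= n)%N -> (N <= m)%N ->
     fval q (u n - u m) (u n - u m) <= e%:C) ->
  fdom q x /\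
  (fun n => fval q (u n - x) (u n - x) : R[i]^o) @ \oo --> (0 : R[i]^o).

Definition extends_form p q := fdom q `<=` fdom p /\
  forall x y, fdom q x -> fdom q y -> fval p x y = fval q x y.

Definition closable_form q :=
  exists p, [/\ positive_form p, closed_form p & extends_form p q].

Definition form_le p q := fdom q `<=` fdom p /\
  forall x, fdom q x -> fval p x x <= fval q x x.

Definition largest_closable_below q r :=
  [/\ positive_form r, closable_form r, form_le r q &
      forall p, positive_form p -> closable_form p -> form_le p q ->
        form_le p r].

Definition singular_form q :=
  largest_closable_below q (QForm (fdom q) (fun _ _ => 0)).

(* An element a of the disc algebra is identified with the vector a 1, which
   determines it; [disc_op x] is the element a with a 1 = x. *)
Definition disc_vectors : set H := [set A hone | A in @disc_algebra R d].
Definition disc_op (x : H) : hop R d :=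
  xget 0 [set A | disc_algebra A /\ A hone = x].

(* q_nu(a_1, a_2) = nu(a_1^* a_2). *)
Definition measure_form (nu : hop R d -> R[i]) : qform :=
  QForm disc_vectors (fun x y => nu (adj (disc_op x) \o disc_op y)).

Definition nc_abs_continuous nu := closable_form (measure_form nu).
Definition nc_singular nu := singular_form (measure_form nu).

Definition lebesgue_decomposition (mu mu_ac mu_s : hop R d -> R[i]) :=
  [/\ nc_measure mu_ac, nc_measure mu_s,
      forall A, disc_system A -> mu A = mu_ac A + mu_s A,
      [/\ nc_abs_continuous mu_ac, nc_le mu_ac mu &
          forall nu, nc_measure nu -> nc_abs_continuous nu -> nc_le nu mu ->
            nc_le nu mu_ac] &
      nc_singular mu_s].

End Forms.

Section UnboundedOperators.
Variables (R : realType) (d : nat).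
Notation H := (hardy R d).

(* Only the values on the domain are relevant. *)
Record unbounded_op := UnboundedOp { dom : set H ; app :> H -> H }.
Implicit Types S T : unbounded_op.

Definition linear_unbounded T := linear_subspace (dom T) /\
  forall (a : R[i]) x y, dom T x -> dom T y -> T (a *: x + y) = a *: T x + T y.

Definition densely_defined T := dense (dom T).

Definition closed_unbounded T :=
  closed [set p : H * H | dom T p.1 /\ p.2 = T p.1].

(* T and its adjoint have the same graph. *)
Definition self_adjoint T := forall y z,
  (dom T y /\ T y = z) <-> (forall x, dom T x -> hdot (T x) y = hdot x z).

(* Positive operators are self-adjoint, as is needed for square roots. *)
Definition positive_unbounded T :=
  [/\ linear_unbounded T, self_adjoint T &
      forall x, dom T x -> 0 <= hdot (T x) x].

Definition is_sqrt S T :=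
  [/\ closed_unbounded S, densely_defined S, positive_unbounded S,
      forall x, dom T x <-> dom S x /\ dom S (S x) &
      forall x, dom T x -> T x = S (S x)].

Definition L_Toeplitz T S :=
  [/\ closed_unbounded T, densely_defined T, positive_unbounded T &
  [/\ is_sqrt S T,
      forall j x, dom S x -> dom S (lshiftL j x) &
      forall (j k : 'I_d) g h, dom S g -> dom S h ->
        hdot (S (lshiftL j g)) (S (lshiftL k h)) = (j == k)%:R * hdot (S g) (S h)]].

(* T, with square root S, is the nc Radon-Nikodym derivative of an nc measure
   with absolutely continuous part mu_ac. *)
Definition nc_Radon_Nikodym (mu_ac : hop R d -> R[i]) T S :=
  [/\ L_Toeplitz T S, @disc_vectors R d `<=` dom S &
      forall A B, disc_algebra A -> disc_algebra B ->
        mu_ac (adj B \o A) = hdot (S (A hone)) (S (B hone))].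

End UnboundedOperators.

Section OrthogonalPolynomials.
Variables (R : realType) (d : nat) (mu : hop R d -> R[i]).
Implicit Types (P Q : ncpoly R d) (s t : word d).

Definition Zpow s : ncpoly R d := mkmalgU s 1.

Definition const_coef P : R[i] := mcoeff emptyword P.

Definition pdot P Q : R[i] := mu (adj (polyL Q) \o polyL P).
Definition pnorm P : R := Num.sqrt (complex.Re (pdot P P)).

Definition gram_schmidt (l : seq (ncpoly R d)) : seq (ncpoly R d) :=
  foldl (fun acc P =>
    rcons acc (P - \sum_(U <- acc) (pdot P U / pdot U U) *: U)) [::] l.

Definition Phi s : ncpoly R d :=
  last 0 (gram_schmidt [seq Zpow t | t <- upto s]).

Definition phi s : ncpoly R d := (pnorm (Phi s))^-1%:C *: Phi s.

Definition leading_coef s : R[i] := mcoeff s (phi s).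

Definition in_span (l : seq (word d)) P :=
  exists c : word d -> R[i], P = \sum_(t <- l) c t *: Zpow t.

Definition orth_proj (l : seq (word d)) P : ncpoly R d :=
  xget 0 [set U | in_span l U /\
                  forall V, in_span l V -> pdot (P - U) V = 0].

Definition verblunsky s : R[i] :=
  if s == emptyword then 0 else
    let l := [seq t <- before s | t != emptyword] in
    let U := Zpow s - orth_proj l (Zpow s) in
    let V := Zpow emptyword - orth_proj l (Zpow emptyword) in
    pdot U V / (pnorm U * pnorm V)%:C.

Definition defect s : R := 1 - (modc (verblunsky s)) ^+ 2.

(* The fold runs along the shortlex order, so that its accumulator at w is the
   value at the predecessor of w; see phi_sharpE. *)
Definition phi_sharp s : ncpoly R d :=
  foldl (fun (acc : ncpoly R d) (w : word d) =>
    if (w : seq _) is k :: t then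
      (Num.sqrt (defect w))^-1%:C *:
        (- (verblunsky w)^* *: (Zpow (FMonom [:: k]) * phi (FMonom t)) + acc)
    else 1) 0 (upto s).

Lemma phi_sharp_empty : phi_sharp emptyword = 1.
Proof. by []. Qed.

Lemma phi_sharpE (k : 'I_d) s (ks := FMonom (k :: (s : seq 'I_d)) : word d) :
  phi_sharp ks = (Num.sqrt (defect ks))^-1%:C *:
    (- (verblunsky ks)^* *: (Zpow (FMonom [:: k]) * phi s)
     + phi_sharp (wpred ks)).
Proof.
have nk : ks != emptyword by [].
case: s @ks nk => s ks nk.
move: (wpred ks) (upto_wpred nk) => p E.
rewrite [phi_sharp p]/phi_sharp E [phi_sharp ks]/phi_sharp [upto ks]/upto.
rewrite foldl_rcons.
reflexivity.
Qed.

Definition Christoffel (n : nat) : R :=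
  (\sum_(s <- upto (lastword d n)) (modc (const_coef (phi s))) ^+ 2)^-1.

Definition minimiser (n : nat) : ncpoly R d :=
  (Christoffel n)%:C *:
    \sum_(s <- upto (lastword d n)) (const_coef (phi s))^* *: phi s.

Definition Christoffel_inf : R :=
  inf [set complex.Re (pdot Q Q) | Q in [set Q | const_coef Q = 1]].

End OrthogonalPolynomials.

(* Main.v *)
Require Import Defs.
From mathcomp Require Import all_boot all_order all_algebra finmap.
From mathcomp Require Import all_classical all_reals all_analysis.
From mathcomp Require Import complex ring lra.
From mathcomp.analysis.showcase Require Import summability.
Import Order.TTheory GRing.Theory Num.Theory numFieldNormedType.Exports.
Set Implicit Arguments.
Unset Strict Implicit.
Unset Printing Implicit Defensive.
Local Open Scope classical_set_scope.
Local Open Scope ring_scope.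
#[local] Existing Instance totally_filter.
Local Notation "x %:C" := (real_complex _ x) : ring_scope.

(** Multiplication by the variables is a row isometry for the inner product of
    an nc measure: [<Z_j P, Z_k Q> = delta_{jk} <P, Q>]. Let [e] be the unit vector
    proportional to the residual of 1 modulo the nonempty words before [k s]. Then
    [X = Z_k phi_s] and [e] are unit vectors orthogonal to these words, and the
    Verblunsky coefficient at [k s] is [g = <X, e>]. Removing from [X] its part
    along [e], and from [e] its part along [X], gives the next orthonormal and the
    next reverse polynomial, each time losing the factor [1 - |g|^2] in squared
    norm. Along the words [sigma(n)] the first recursion gives
    [||Phi_sigma(n)||^2 = \prod_(k <= n) (1 - |gamma_sigma(k)|^2)]
    (pnormPhiS); the leading coefficients are the inverses of these norms, and the
    determinants are products of the squared norms because the Gram matrix of the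
    monomials is congruent to that of the [Phi]'s through a unitriangular matrix
    (toeplitz_detE). Along all words the second recursion identifies the reverse
    polynomials with the vectors that represent evaluation at the origin
    (phi_sharp_ok, sharp_eval), so that [|phi^#_s(0)|^(-2)], the Christoffel
    function, and the product of the [1 - |gamma_t|^2] over the words up to [s]
    agree at each finite stage, and [Q_n] is a multiple of [phi^#_sigma(n)].

    The substance of the theorem is that passing to the absolutely continuous part
    does not lower the Christoffel function, which is a Szego theorem. Write
    [Lambda_n] for the Christoffel function at stage [n] and [kappat] for its limit.
    Expanding polynomials along the [Z^w Q_n] gives vectors [f_n] of the Hardy
    space with [||P(L) f_n||^2 = mu(P^* P)] for [P] of degree at most [n] and
    [f_n(0)^2 = Lambda_n] (Bernstein_Szego). They are unit vectors, so they have a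
    weak limit point [f], with [|f(0)|^2 = kappat], since coefficients pass to weak
    limits. The functional [A |-> <A f, f>] has two properties.
    - It is absolutely continuous: on the vectors [a 1] its form is
      [||(a 1) f||^2], and right multiplication by [f] on its maximal domain is a
      closed operator (vstate_abs_continuous).
    - It is bounded above by [mu]: quadratic forms of positive operators are weakly
      lower semicontinuous, and the vectors [f_n] reproduce [mu] in low degree
      (vstate_le).
    By maximality of [mu_ac] the functional lies below [mu_ac]. If [Q(0) = 1], then
    [kappat = |f(0)|^2 <= ||Q(L) f||^2 <= mu_ac(Q^* Q) <= mu(Q^* Q)], and at
    [Q = Q_n] the last term is [Lambda_n]. This squeeze yields both infima and the
    limit of the [<T Q_n, Q_n>], which are the values [mu_ac(Q_n^* Q_n)]. A Dirac
    mass at [kappat] has [kappat] as its mean. Finally, the partial products over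
    balls of words split into the factors at the words [sigma(n)] and the others. *)

(** * Complex numbers *)

Section ComplexModulus.
Variable R : realType.
Implicit Types z u : R[i].

Lemma conjcE z : conjc z = z^*.
Proof. by []. Qed.

Lemma modcN z : modc (- z) = modc z.
Proof. exact: normcN. Qed.

Lemma modcM z u : modc (z * u) = modc z * modc u.
Proof. exact: Normc.normcM. Qed.

Lemma conjM z u : (z * u)^* = z^* * u^*.
Proof. exact: rmorphM. Qed.

Lemma conjD z u : (z + u)^* = z^* + u^*.
Proof. exact: rmorphD. Qed.

Lemma conjR (a : R) : (a%:C)^* = a%:C.
Proof. by rewrite -conjcE /= oppr0. Qed.

Lemma conjK z : z^*^* = z.
Proof. exact: conjCK. Qed.

Lemma modcR (a : R) : modc a%:C = `|a|.
Proof. by rewrite /= expr0n addr0 sqrtr_sqr. Qed.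

Lemma modc2E z : modc z ^+ 2 = complex.Re z ^+ 2 + complex.Im z ^+ 2.
Proof. by case: z => a b /=; rewrite sqr_sqrtr// addr_ge0 ?sqr_ge0. Qed.

Lemma mulcJ z : z * z^* = (modc z ^+ 2)%:C.
Proof.
rewrite -conjcE modc2E; case: z => a b; apply/eqP; rewrite eq_complex /=.
by apply/andP; split; apply/eqP; ring.
Qed.

Lemma modc_Re z : `|complex.Re z| <= modc z.
Proof.
case: z => a b /=; rewrite -sqrtr_sqr ler_sqrt ?lerDl ?addr_ge0 ?sqr_ge0//.
Qed.

Lemma modc_Im z : `|complex.Im z| <= modc z.
Proof.
case: z => a b /=; rewrite -sqrtr_sqr ler_sqrt ?lerDr ?addr_ge0 ?sqr_ge0//.
Qed.

Lemma modc_ReIm z : modc z <= `|complex.Re z| + `|complex.Im z|.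
Proof.
rewrite -(@ler_pXn2r _ 2) ?nnegrE ?modc_ge0 ?addr_ge0// modc2E.
rewrite sqrrD !real_normK ?num_real//.
by rewrite -addrA lerD2l lerDr mulrn_wge0// mulr_ge0.
Qed.

Lemma cReD z u : complex.Re (z + u) = complex.Re z + complex.Re u.
Proof. by case: z u => [? ?] [? ?]. Qed.

Lemma cImD z u : complex.Im (z + u) = complex.Im z + complex.Im u.
Proof. by case: z u => [? ?] [? ?]. Qed.

Lemma cReN z : complex.Re (- z) = - complex.Re z.
Proof. by case: z. Qed.

Lemma cReJ z : complex.Re z^* = complex.Re z.
Proof. by rewrite -conjcE; case: z. Qed.

Lemma cReMr (a : R) z : complex.Re (a%:C * z) = a * complex.Re z.
Proof. by case: z => x y /=; ring. Qed.

Lemma cRe_sum (I : Type) (r : seq I) (P : pred I) (F : I -> R[i]) :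
  complex.Re (\sum_(i <- r | P i) F i) = \sum_(i <- r | P i) complex.Re (F i).
Proof. by elim/big_rec2: _ => [//|i x y _ <-]; rewrite cReD. Qed.

Lemma ge0_complexE z : 0 <= z -> z = (complex.Re z)%:C.
Proof. by case: z => a b; rewrite lecE /= => /andP[/eqP ->]. Qed.

Lemma ge0_Re z : 0 <= z -> 0 <= complex.Re z.
Proof. by rewrite lecE => /andP[]. Qed.

Lemma Re_le z u : z <= u -> complex.Re z <= complex.Re u.
Proof. by rewrite lecE => /andP[]. Qed.

Lemma normc_modc z : `|z| = (modc z)%:C.
Proof. by []. Qed.

End ComplexModulus.

(** * Positive sesquilinear forms *)

Section Sesquilinear.
Variables (R : realType) (V : lmodType R[i]).

Definition pos_sesqui (B : V -> V -> R[i]) :=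
  [/\ forall (a : R[i]) x y z, B (a *: x + y) z = a * B x z + B y z,
      forall (a : R[i]) x y z, B z (a *: x + y) = a^* * B z x + B z y &
      forall x, 0 <= B x x].

Variable B : V -> V -> R[i].
Hypothesis HB : pos_sesqui B.
Implicit Types x y z : V.

Lemma sesqDl x y z : B (x + y) z = B x z + B y z.
Proof. by have [h _ _] := HB; have := h 1 x y z; rewrite mul1r scale1r. Qed.

Lemma sesqDr x y z : B z (x + y) = B z x + B z y.
Proof. by have [_ h _] := HB; have := h 1 x y z; rewrite rmorph1 mul1r scale1r. Qed.

Lemma sesq0l z : B 0 z = 0.
Proof. by apply: (addrI (B 0 z)); rewrite -sesqDl !addr0. Qed.

Lemma sesq0r z : B z 0 = 0.
Proof. by apply: (addrI (B z 0)); rewrite -sesqDr !addr0. Qed.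

Lemma sesqZl (a : R[i]) x z : B (a *: x) z = a * B x z.
Proof. by have [h _ _] := HB; rewrite -[a *: x]addr0 h sesq0l addr0. Qed.

Lemma sesqZr (a : R[i]) x z : B z (a *: x) = a^* * B z x.
Proof. by have [_ h _] := HB; rewrite -[a *: x]addr0 h sesq0r addr0. Qed.

Lemma sesqNl x z : B (- x) z = - B x z.
Proof. by rewrite -scaleN1r sesqZl mulN1r. Qed.

Lemma sesqNr x z : B z (- x) = - B z x.
Proof. by rewrite -scaleN1r sesqZr rmorphN1 mulN1r. Qed.

Lemma sesqBl x y z : B (x - y) z = B x z - B y z.
Proof. by rewrite sesqDl sesqNl. Qed.

Lemma sesqBr x y z : B z (x - y) = B z x - B z y.
Proof. by rewrite sesqDr sesqNr. Qed.

Lemma sesq_suml (I : Type) (r : seq I) (P : pred I) (F : I -> V) z :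
  B (\sum_(i <- r | P i) F i) z = \sum_(i <- r | P i) B (F i) z.
Proof. by elim/big_rec2: _ => [|i x y _ <-]; rewrite ?sesq0l// sesqDl. Qed.

Lemma sesq_sumr (I : Type) (r : seq I) (P : pred I) (F : I -> V) z :
  B z (\sum_(i <- r | P i) F i) = \sum_(i <- r | P i) B z (F i).
Proof. by elim/big_rec2: _ => [|i x y _ <-]; rewrite ?sesq0r// sesqDr. Qed.

Lemma sesq_ge0 x : 0 <= B x x.
Proof. by have [_ _] := HB. Qed.

(** Hermitian symmetry comes from positivity, which makes the values of the
    form at [x + y] and at [x + 'i *: y] real. *)
Lemma sesqC x y : B y x = (B x y)^*.
Proof.
have im u : complex.Im (B u u) = 0 by apply/ger0_Im/sesq_ge0.
have := im (x + y); have := im (x + 'i *: y).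
rewrite !(sesqDl, sesqDr) !(sesqZl, sesqZr) !cImD !im.
have -> : complex.Im ('i * ('i^* * B y y)) = 0 :> R.
  by rewrite mulrA -normCK normCi expr1n mul1r im.
rewrite conjCi -complexiE -conjcE; case: (B x y) => a b; case: (B y x) => a' b' /= h1 h2.
apply/eqP; rewrite eq_complex /=; apply/andP; split; apply/eqP; lra.
Qed.

Definition snorm2 x : R := complex.Re (B x x).

Lemma snorm2E x : B x x = (snorm2 x)%:C.
Proof. exact/ge0_complexE/sesq_ge0. Qed.

Lemma snorm2_ge0 x : 0 <= snorm2 x.
Proof. exact/ge0_Re/sesq_ge0. Qed.

Lemma snorm2Z (a : R[i]) x : snorm2 (a *: x) = modc a ^+ 2 * snorm2 x.
Proof. by rewrite /snorm2 sesqZl sesqZr mulrA mulcJ cReMr. Qed.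

Lemma snorm2D x y :
  snorm2 (x + y) = snorm2 x + snorm2 y + 2 * complex.Re (B x y).
Proof.
rewrite /snorm2 sesqDl !sesqDr (sesqC x y) !cReD cReJ; ring.
Qed.

(** The squared norm of [x - s <x, y> y] is nonnegative for every real [s]; the
    optimal [s] is the inverse of the squared norm of [y], and when that norm
    vanishes a large [s] forces [<x, y>] to vanish too. *)
Lemma sesq_CS x y : modc (B x y) ^+ 2 <= snorm2 x * snorm2 y.
Proof.
set t := snorm2 y; set b := B x y.
have key (s : R) : 0 <= snorm2 x + s ^+ 2 * modc b ^+ 2 * t
    - 2 * s * modc b ^+ 2.
  have := snorm2_ge0 (x + ((- s)%:C * b) *: y).
  rewrite snorm2D snorm2Z modcM modcR exprMn real_normK ?num_real// sqrrN.
  rewrite sesqZr -/b conjM conjR -/t -mulrA (mulrC b^*) mulcJ.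
  by rewrite cReMr [complex.Re _]/=; congr (_ <= _); ring.
have t0 : 0 <= t := snorm2_ge0 y.
have [t_eq0|tn0] := eqVneq t 0.
  have := key ((snorm2 x + 1) / (modc b ^+ 2)).
  have [->|bn0] := eqVneq (modc b ^+ 2) 0; first by move=> _; rewrite t_eq0 mulr0.
  rewrite t_eq0 !mulr0 addr0.
  have -> : 2 * ((snorm2 x + 1) / modc b ^+ 2) * modc b ^+ 2 =
     2 * (snorm2 x + 1) by rewrite -mulrA divfK.
  have := snorm2_ge0 x; lra.
have tp : 0 < t by rewrite lt_def tn0.
have := key t^-1.
have -> : snorm2 x + t^-1 ^+ 2 * modc b ^+ 2 * t - 2 * t^-1 * modc b ^+ 2 =
  (snorm2 x * t - modc b ^+ 2) / t by field; rewrite tn0.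
by rewrite pmulr_lge0 ?invr_gt0// subr_ge0.
Qed.

Lemma snorm2_eq0 x : snorm2 x = 0 -> forall y, B x y = 0.
Proof.
move=> x0 y; have := sesq_CS x y; rewrite x0 mul0r => h.
apply: Normc.eq0_normc; apply/eqP; rewrite -sqrf_eq0 eq_le h sqr_ge0//.
Qed.

End Sesquilinear.

(** * Convergence of complex families *)

Section ComplexLimits.
Context {R : realType} {T : Type} {F : set_system T} {FF : Filter F}.
Implicit Types (f g : T -> R[i]) (l m : R[i]).

(** The distances of [R[i]] are themselves complex numbers, but a positive
    complex number is real. *)
Lemma cvgCP f l : (f : T -> R[i]^o) @ F --> (l : R[i]^o) <->
  forall e : R, 0 < e -> \forall t \near F, modc (l - f t) < e.
Proof.
split=> [/cvgrPdist_lt h e e0|h].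
  have := h e%:C; rewrite ltcR => /(_ e0); apply: filterS => t.
  by rewrite normc_modc ltcR.
apply/cvgrPdist_lt => e e0.
have eE : e = (complex.Re e)%:C by apply/ge0_complexE/ltW.
have e1 : 0 < complex.Re e by rewrite -ltcR -eE.
by apply: filterS (h _ e1) => t; rewrite eE normc_modc ltcR.
Qed.

Lemma cvgC_ReIm f l :
  (fun t => complex.Re (f t)) @ F --> complex.Re l ->
  (fun t => complex.Im (f t)) @ F --> complex.Im l ->
  (f : T -> R[i]^o) @ F --> (l : R[i]^o).
Proof.
move=> hr hi; apply/cvgCP => e e0.
have e2 : 0 < e / 2 by lra.
move/cvgrPdist_lt: hr => /(_ _ e2) hr; move/cvgrPdist_lt: hi => /(_ _ e2) hi.
near=> t; apply: le_lt_trans (modc_ReIm _) _.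
rewrite cReD cImD cReN.
have -> : complex.Im (- f t) = - complex.Im (f t) by case: (f t).
have -> : e = e / 2 + e / 2 by lra.
by apply: ltrD; near: t.
Unshelve. all: by end_near. Qed.

Lemma cvg_Re f l : (f : T -> R[i]^o) @ F --> (l : R[i]^o) ->
  (fun t => complex.Re (f t)) @ F --> complex.Re l.
Proof.
move=> /cvgCP h; apply/cvgrPdist_lt => e e0.
apply: filterS (h _ e0) => t; apply: le_lt_trans.
by rewrite -cReN -cReD modc_Re.
Qed.

Lemma cvg_realC (f : T -> R) (l : R) : f @ F --> l ->
  (fun t => (f t)%:C : R[i]^o) @ F --> (l%:C : R[i]^o).
Proof. by move=> h; apply: cvgC_ReIm => //=; apply: cvg_cst. Qed.

Lemma cvg_modc f l : (f : T -> R[i]^o) @ F --> (l : R[i]^o) ->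
  (fun t => modc (f t)) @ F --> modc l.
Proof.
move=> /cvgCP h; apply/cvgrPdist_lt => e e0; apply: filterS (h _ e0) => t.
apply: le_lt_trans; rewrite ler_norml; apply/andP; split.
  rewrite lerNl opprB lerBlDr -[X in X <= _]/(modc (f t)).
  by rewrite -(modcN (l - f t)) opprB; apply: le_trans (le_normcD _ _); rewrite subrK.
by rewrite lerBlDr; apply: le_trans (le_normcD _ _); rewrite subrK.
Qed.

Lemma cvgC_D f g l m : (f : T -> R[i]^o) @ F --> (l : R[i]^o) ->
  (g : T -> R[i]^o) @ F --> (m : R[i]^o) ->
  (fun t => f t + g t : R[i]^o) @ F --> (l + m : R[i]^o).
Proof. by move=> h1 h2; exact: (@cvgD R[i] R[i]^o T F FF f g l m h1 h2). Qed.

Lemma cvgC_B f g l m : (f : T -> R[i]^o) @ F --> (l : R[i]^o) ->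
  (g : T -> R[i]^o) @ F --> (m : R[i]^o) ->
  (fun t => f t - g t : R[i]^o) @ F --> (l - m : R[i]^o).
Proof. by move=> h1 h2; exact: (@cvgB R[i] R[i]^o T F FF f g l m h1 h2). Qed.

Lemma cvgC_M f g l m : (f : T -> R[i]^o) @ F --> (l : R[i]^o) ->
  (g : T -> R[i]^o) @ F --> (m : R[i]^o) ->
  (fun t => f t * g t : R[i]^o) @ F --> (l * m : R[i]^o).
Proof. by move=> h1 h2; exact: (@cvgM R[i] T F FF f g l m h1 h2). Qed.

Lemma cvgC_Z (a : R[i]) f l : (f : T -> R[i]^o) @ F --> (l : R[i]^o) ->
  (fun t => a * f t : R[i]^o) @ F --> (a * l : R[i]^o).
Proof.
move=> h; have c : (fun=> a : R[i]^o) @ F --> (a : R[i]^o) by exact: cvg_cst.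
exact: cvgC_M c h.
Qed.

Lemma cvgC_sum (I : Type) (r : seq I) (f : I -> T -> R[i]) (l : I -> R[i]) :
  (forall i, (f i : T -> R[i]^o) @ F --> (l i : R[i]^o)) ->
  (fun t => \sum_(i <- r) f i t : R[i]^o) @ F --> (\sum_(i <- r) l i : R[i]^o).
Proof.
move=> h; elim: r => [|i r IH].
  rewrite big_nil.
  by under eq_fun do rewrite big_nil; exact: cvg_cst.
rewrite big_cons; under eq_fun do rewrite big_cons.
exact: (@cvgC_D (f i) _ (l i) _ (h i) IH).
Qed.

End ComplexLimits.

Lemma cvg_le_bound (R : realType) (T : Type) (F : set_system T)
    {PF : ProperFilter F} (f : T -> R) (l c : R) :
  f @ F --> l -> (\forall t \near F, f t <= c) -> l <= c.
Proof.
move=> h; rewrite -(cvg_lim _ h)//; apply: limr_le.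
by apply/cvg_ex; exists l.
Qed.

Lemma cvg_ge_bound (R : realType) (T : Type) (F : set_system T)
    {PF : ProperFilter F} (f : T -> R) (l c : R) :
  f @ F --> l -> (\forall t \near F, c <= f t) -> c <= l.
Proof.
move=> h; rewrite -(cvg_lim _ h)//; apply: limr_ge.
by apply/cvg_ex; exists l.
Qed.

(** * The Hardy space as a Hilbert space *)

Section HardySpace.
Variables (R : realType) (d : nat).
Notation H := (hardy R d).
Notation W := (word d).
Implicit Types (f g h : H) (u v : W -> R[i]) (w : W) (F G : {fset W}).

Definition psum u F : R := \sum_(w <- F) modc (u w) ^+ 2.

Lemma le_psum u F G : (F `<=` G)%fset -> psum u F <= psum u G.
Proof.
move=> FG; rewrite /psum (big_fsetID _ (mem F) G) /=.
have -> : [fset x | x in G & x \in F]%fset = F.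
  apply/fsetP => x; rewrite !inE /= andbC.
  by apply: andb_idr => /(fsubsetP FG).
by rewrite lerDl sumr_ge0// => w _; rewrite sqr_ge0.
Qed.

(** Bounds on finite partial sums are what passes to coefficientwise limits. *)
Lemma sqnorm_leP u (c : R) :
  (sqnorm u <= c%:E)%E <-> forall F, psum u F <= c.
Proof.
split=> h.
  move=> F; rewrite -lee_fin; apply: le_trans h.
  apply: ereal_sup_ubound; exists [set` F]; first by split.
  by rewrite -fsbig_seq ?fset_uniq// sumEFin.
apply: ge_ereal_sup => _ [X [finX _] <-].
rewrite fsbig_finite//= sumEFin lee_fin; exact: h.
Qed.

Lemma psum_le f F : psum f F <= fine (sqnorm f).
Proof. by move: F; apply/sqnorm_leP; rewrite fineK// sqnorm_fin. Qed.

Lemma psum_cvg f : psum f @ totally --> fine (sqnorm f).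
Proof.
apply/cvgrPdist_lt => e e0.
have [F hF] : exists F, fine (sqnorm f) - e < psum f F.
  apply: contrapT => /forallNP h.
  have : (sqnorm f <= (fine (sqnorm f) - e)%:E)%E.
    by apply/sqnorm_leP => F; rewrite leNgt; apply/negP/h.
  by rewrite -(fineK (sqnorm_fin f)) lee_fin /=; lra.
exists F => // G /= FG; have h1 := le_psum f FG; have h2 := psum_le f G.
by rewrite ger0_norm; lra.
Qed.

Definition nrm f : R := Num.sqrt (fine (sqnorm f)).

Lemma normE f : `|f| = (nrm f)%:C.
Proof. by []. Qed.

Lemma nrm_ge0 f : 0 <= nrm f.
Proof. exact: sqrtr_ge0. Qed.

Lemma nrm2E f : nrm f ^+ 2 = fine (sqnorm f).
Proof. by rewrite sqr_sqrtr// fine_ge0// sqnorm_ge0. Qed.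

Lemma hdot_polar f g w : f w * (g w)^* =
  (1 / 4)%:C * ((modc ((f + g) w) ^+ 2)%:C - (modc ((f - g) w) ^+ 2)%:C +
    'i * ((modc ((f + 'i *: g) w) ^+ 2)%:C - (modc ((f - 'i *: g) w) ^+ 2)%:C)).
Proof.
have -> : (f + g) w = f w + g w by [].
have -> : (f - g) w = f w - g w by [].
have -> : (f + 'i *: g) w = f w + 'i * g w by [].
have -> : (f - 'i *: g) w = f w - 'i * g w by [].
rewrite -complexiE -conjcE !modc2E; case: (f w) => a b; case: (g w) => p q.
apply/eqP; rewrite eq_complex /=.
by apply/andP; split; apply/eqP; field.
Qed.

Definition hsum u v F : R[i] := \sum_(w <- F) u w * (v w)^*.

(** Polarisation reduces the unconditional convergence of the inner product to
    that of the four nonnegative series of squares. *)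
Lemma hsum_cvg f g : (hsum f g : _ -> R[i]^o) @ totally --> (hdot f g : R[i]^o).
Proof.
have E : partial_sum (fun w => f w * (g w)^* : R[i]^o) = hsum f g.
  apply/funext => F; rewrite /partial_sum /hsum.
  by rewrite (big_seq_fsetE _ _ xpredT (fun w => f w * (g w)^*)).
suff [l hl] : exists l : R[i]^o, (hsum f g : _ -> R[i]^o) @ totally --> l.
  by rewrite /hdot /sum E (cvg_lim _ hl).
pose q h := fine (sqnorm h).
exists ((1 / 4)%:C * ((q (f + g))%:C - (q (f - g))%:C +
  'i * ((q (f + 'i *: g))%:C - (q (f - 'i *: g))%:C))).
have -> : hsum f g = fun F => (1 / 4)%:C *
  ((psum (f + g) F)%:C - (psum (f - g) F)%:C +
  'i * ((psum (f + 'i *: g) F)%:C - (psum (f - 'i *: g) F)%:C)).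
  apply/funext => F; rewrite /hsum (eq_bigr _ (fun w _ => hdot_polar f g w)).
  rewrite -mulr_sumr big_split /= sumrB -mulr_sumr sumrB.
  by rewrite /psum !(rmorph_sum (real_complex R)).
have c h : (fun F => (psum h F)%:C : R[i]^o) @ totally --> ((q h)%:C : R[i]^o).
  exact/cvg_realC/psum_cvg.
apply: cvgC_Z; apply: cvgC_D; first by apply: cvgC_B; apply: c.
by apply: cvgC_Z; apply: cvgC_B; apply: c.
Qed.

Lemma hdot_unique f g (l : R[i]) :
  (hsum f g : _ -> R[i]^o) @ totally --> (l : R[i]^o) -> hdot f g = l.
Proof.
move=> h; rewrite -(cvg_lim _ (@hsum_cvg f g))//.
by rewrite (cvg_lim _ h).
Qed.

Lemma hdotff f : hdot f f = (nrm f ^+ 2)%:C.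
Proof.
apply: hdot_unique; rewrite nrm2E.
have -> : hsum f f = fun F => (psum f F)%:C.
  apply/funext => F; rewrite /hsum /psum (rmorph_sum (real_complex R)).
  by apply: eq_bigr => w _; rewrite mulcJ.
exact/cvg_realC/psum_cvg.
Qed.

Lemma hdot_sesqui : pos_sesqui (@hdot R d).
Proof.
split=> [a f g h|a f g h|f].
- apply: hdot_unique.
  have -> : hsum (a *: f + g) h = fun F => a * hsum f h F + hsum g h F.
    apply/funext => F; rewrite /hsum mulr_sumr -big_split; apply: eq_bigr => w _.
    by rewrite /= mulrDl -mulrA.
  by apply: cvgC_D; [apply: cvgC_Z|]; apply: hsum_cvg.
- apply: hdot_unique.
  have -> : hsum h (a *: f + g) = fun F => a^* * hsum h f F + hsum h g F.
    apply/funext => F; rewrite /hsum mulr_sumr -big_split; apply: eq_bigr => w _.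
    by rewrite /= conjD conjM mulrDr mulrCA.
  by apply: cvgC_D; [apply: cvgC_Z|]; apply: hsum_cvg.
- by rewrite hdotff ler0c sqr_ge0.
Qed.

Lemma nrm_snorm2 f : nrm f ^+ 2 = snorm2 (@hdot R d) f.
Proof. by rewrite /snorm2 hdotff. Qed.

Lemma hdot_CS f g : modc (hdot f g) <= nrm f * nrm g.
Proof.
rewrite -(@ler_pXn2r _ 2) ?nnegrE ?modc_ge0 ?mulr_ge0 ?nrm_ge0//.
rewrite exprMn !nrm_snorm2; exact: sesq_CS hdot_sesqui _ _.
Qed.

Lemma nrm_eq0 f : nrm f = 0 -> f = 0.
Proof. by move=> f0; apply: Defs.hnorm0_eq0; rewrite -[hnorm f]/((nrm f)%:C) f0. Qed.

Lemma hdot_inj f g : (forall h, hdot f h = hdot g h) -> f = g.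
Proof.
move=> h; apply/eqP; rewrite -subr_eq0; apply/eqP/nrm_eq0/eqP.
rewrite -sqrf_eq0; apply/eqP/complexI; rewrite -hdotff.
by rewrite (sesqBl hdot_sesqui) h subrr.
Qed.

Lemma nrmD f g : nrm (f + g) <= nrm f + nrm g.
Proof.
have := Defs.hnormD f g; rewrite -[hnorm f]/((nrm f)%:C) -[hnorm g]/((nrm g)%:C).
by rewrite -[hnorm _]/((nrm _)%:C) -rmorphD lecR.
Qed.

Lemma nrmZ (a : R[i]) f : nrm (a *: f) = modc a * nrm f.
Proof.
apply: complexI; rewrite rmorphM; exact: Defs.hnormZ a f.
Qed.

Lemma nrmN f : nrm (- f) = nrm f.
Proof. by rewrite -scaleN1r nrmZ modcN Normc.normc1 mul1r. Qed.

Lemma nrmB f g : nrm (f - g) = nrm (g - f).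
Proof. by rewrite -nrmN opprB. Qed.

Lemma nrm0 : nrm (0 : H) = 0.
Proof. by rewrite -(scale0r 0) nrmZ Normc.normc0 mul0r. Qed.

Lemma modc_coef f w : modc (f w) <= nrm f.
Proof.
rewrite -(@ler_pXn2r _ 2) ?nnegrE ?modc_ge0 ?nrm_ge0//.
rewrite nrm2E -lee_fin fineK ?sqnorm_fin//; exact: le_sqnorm.
Qed.

Lemma nrm_leP f (c : R) : 0 <= c ->
  (nrm f <= c) <-> (forall F, psum f F <= c ^+ 2).
Proof.
move=> c0; rewrite -sqnorm_leP -(fineK (sqnorm_fin f)) lee_fin -nrm2E.
by rewrite ler_pXn2r ?nnegrE ?nrm_ge0.
Qed.

(** Coefficientwise limits of bounded families stay in the space, with the
    same bound, because only finitely many coefficients are tested at a time. *)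
Lemma hardy_Fatou (T : Type) (U : set_system T) (PU : ProperFilter U)
    (u : T -> W -> R[i]) (v : W -> R[i]) (c : R) : 0 <= c ->
  (forall w, (fun t => u t w : R[i]^o) @ U --> (v w : R[i]^o)) ->
  (\forall t \near U, forall F, psum (u t) F <= c ^+ 2) ->
  exists2 f : H, f = v :> (W -> R[i]) & nrm f <= c.
Proof.
move=> c0 uv uc.
have b F : psum v F <= c ^+ 2.
  have h : (fun t => psum (u t) F) @ U --> psum v F.
    rewrite /psum; elim: (enum_fset F) => [|w r IH].
      by rewrite big_nil; under eq_fun do rewrite big_nil; exact: cvg_cst.
    rewrite big_cons; under eq_fun do rewrite big_cons.
    apply: cvgD; last exact: IH.
    rewrite expr2; under eq_fun do rewrite expr2.
    by apply: cvgM; apply: cvg_modc; apply: uv.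
  apply: (cvg_le_bound h); exact: filterS uc => t.
have vl : v \in @square_summable R d.
  rewrite unfold_in; apply: (@le_lt_trans _ _ (c ^+ 2)%:E); rewrite ?ltry//.
  exact/sqnorm_leP.
by exists (Hardy vl) => //; apply/nrm_leP.
Qed.

Lemma hcoef_sum (I : Type) (r : seq I) (f : I -> H) w :
  (\sum_(i <- r) f i) w = \sum_(i <- r) f i w.
Proof. by elim/big_rec2: _ => [//|i x y _ <-]. Qed.

End HardySpace.

Section Operators.
Variables (R : realType) (d : nat).
Notation H := (hardy R d).
Notation W := (word d).
Implicit Types (f g h : H) (w v s t : W) (F G : {fset W}).
Implicit Types (A B : hop R d).
Let hS := @hdot_sesqui R d.

Definition wcons (k : 'I_d) s : W := FMonom (k :: s).

Lemma wcons_inj k : injective (wcons k).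
Proof. by case=> s [t] [->]. Qed.

Lemma wordP (P : W -> Prop) :
  P emptyword -> (forall k s, P s -> P (wcons k s)) -> forall s, P s.
Proof. by move=> P0 PS [s]; elim: s => // k s IH; apply: (PS k (FMonom s)). Qed.

Lemma hardyP f g : (forall w, f w = g w) -> f = g.
Proof. by move=> h; apply/val_inj/funext. Qed.

Lemma hcoefD f g w : (f + g) w = f w + g w.
Proof. by []. Qed.

Lemma hcoefB f g w : (f - g) w = f w - g w.
Proof. by []. Qed.

Lemma hcoefZ (a : R[i]) f w : (a *: f) w = a * f w.
Proof. by []. Qed.

(** ** Truncation *)

(** The orthonormal basis vector [Z^w]. *)
Definition bvec w : H := lshiftw w hone.

Lemma lshiftw_cons k s : lshiftw (wcons k s) = @lshiftL R d k \o lshiftw s.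
Proof. by []. Qed.

Lemma lshiftw_empty : lshiftw emptyword = idfun :> hop R d.
Proof. by []. Qed.

Lemma bvecE w v : bvec w v = (v == w)%:R.
Proof.
elim/wordP: w v => [//|k s IH] [[|l v]].
  by rewrite /bvec lshiftw_cons.
rewrite /bvec lshiftw_cons /= /lshift_fun /=.
have -> : (FMonom (l :: v) == wcons k s) = (l == k) && (FMonom v == s).
  by rewrite -[LHS]/(l :: v == k :: s :> seq _) eqseq_cons.
by case: (l == k) => //=; rewrite -/(bvec s) IH.
Qed.

Lemma hsum_bvec f w F : w \in F -> hsum f (bvec w) F = f w.
Proof.
move=> wF; rewrite /hsum (big_fsetD1 w)//= bvecE eqxx conjC1 mulr1.
rewrite big1_fset ?addr0// => v; rewrite !inE => /andP[/negbTE vw _] _.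
by rewrite bvecE vw conjC0 mulr0.
Qed.

Lemma hdot_bvec f w : hdot f (bvec w) = f w.
Proof.
apply: hdot_unique; apply/cvgCP => e e0; exists [fset w]%fset => // F /= wF.
rewrite hsum_bvec; last by apply: (fsubsetP wF); rewrite inE.
by rewrite subrr Normc.normc0.
Qed.

Definition trunc F f : H := \sum_(w <- F) f w *: bvec w.

Lemma truncE F f w : trunc F f w = if w \in F then f w else 0.
Proof.
rewrite /trunc hcoef_sum.
case: ifPn => wF.
  rewrite (big_fsetD1 w)// big1_fset.
    by rewrite [LHS]addr0 hcoefZ bvecE eqxx mulr1.
  move=> v; rewrite !inE eq_sym => /andP[/negbTE vw _] _.
  by rewrite hcoefZ bvecE vw mulr0.
rewrite big1_fset// => v vF _; rewrite hcoefZ bvecE.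
by rewrite (negbTE (memPnC wF v vF)) ?mulr0//.
Qed.

Lemma nrm_trunc F f : nrm (f - trunc F f) ^+ 2 <= nrm f ^+ 2 - psum f F.
Proof.
have : forall w, (f - trunc F f) w = if w \in F then 0 else f w.
  by move=> w; rewrite hcoefB truncE; case: ifP; rewrite ?subrr ?subr0.
move: (f - trunc F f) => g gE.
rewrite [X in X <= _]nrm2E -lee_fin fineK ?sqnorm_fin//; apply/sqnorm_leP => G.
rewrite lerBrDr nrm2E; apply: le_trans (psum_le f (F `|` G)%fset).
rewrite /psum [X in _ <= X](big_fsetID _ (fun x => x \in F)) /= addrC lerD//; last first.
  have -> // : [fset x | x in F `|` G & x \in F]%fset = F.
  by apply/fsetP => x; rewrite !inE /=; case: (x \in F); rewrite ?andbF.
rewrite (big_fsetID _ (fun x => x \in F) G) /= big1_fset ?add0r; last first.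
  move=> w; rewrite gE !inE /= => /andP[_ wF] _.
  rewrite wF Normc.normc0.
  by rewrite expr0n.
have -> : [fset x | x in F `|` G & x \notin F]%fset
    = [fset x | x in G & x \notin F]%fset.
  by apply/fsetP => x; rewrite !inE /=; case: (x \in F); rewrite ?andbF.
rewrite !big_seq; apply: ler_sum => w; rewrite gE !inE /= => /andP[_ wF].
by rewrite (negbTE wF).
Qed.

Lemma trunc_approx f (e : R) : 0 < e -> exists F, nrm (f - trunc F f) < e.
Proof.
move=> e0; have e2 : 0 < e ^+ 2 by rewrite exprn_gt0.
have /cvgrPdist_lt/(_ _ e2) [F _ /(_ F (fsubset_refl F))] := @psum_cvg R d f.
move=> hF; exists F.
rewrite -(@ltr_pXn2r _ 2) ?nnegrE ?nrm_ge0 ?ltW//.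
apply: le_lt_trans (nrm_trunc F f) _; apply: le_lt_trans hF.
by rewrite nrm2E ler_norm.
Qed.

(** Coefficients are inner products with basis vectors, and the finite
    combinations of these are dense; boundedness controls the error. *)
Lemma weak_cvg (T : Type) (U : set_system T) {PU : ProperFilter U}
    (u : T -> H) f (c : R) g :
  (forall w, (fun x => u x w : R[i]^o) @ U --> (f w : R[i]^o)) ->
  (forall x, nrm (u x) <= c) ->
  (fun x => hdot (u x) g : R[i]^o) @ U --> (hdot f g : R[i]^o).
Proof.
move=> uf uc; apply/cvgCP => e e0.
have c0 : 0 <= c.
  by have [x _] := @filter_ex _ U _ _ filterT; exact: le_trans (nrm_ge0 _) (uc x).
pose C := c + nrm f + 1.
have C0 : 0 < C by have := nrm_ge0 f; rewrite /C; lra.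
have e1 : 0 < e / 2 / C by rewrite !divr_gt0.
have [F hF] := trunc_approx g e1.
have h : (fun x => hdot (u x) (trunc F g) : R[i]^o) @ U -->
    (hdot f (trunc F g) : R[i]^o).
  have E y : hdot y (trunc F g) = \sum_(w <- F) (g w)^* * y w.
    rewrite /trunc (sesq_sumr hS); apply: eq_bigr => w _.
    by rewrite (sesqZr hS) hdot_bvec.
  rewrite E; under eq_fun do rewrite E.
  by apply: cvgC_sum => w; apply: cvgC_Z; exact: uf.
have e2 : 0 < e / 2 by rewrite divr_gt0.
move/cvgCP: h => /(_ _ e2); apply: filterS => x ht.
rewrite -(sesqBl hS) -[g](subrK (trunc F g)) (sesqDr hS).
apply: le_lt_trans (le_normcD _ _) _.
have -> : e = e / 2 + e / 2 by lra.
apply: ler_ltD; last by rewrite (sesqBl hS).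
apply: le_trans (hdot_CS _ _) _.
have : nrm (f - u x) <= C.
  apply: le_trans (nrmD _ _) _; rewrite nrmN /C.
  by have := uc x; lra.
move=> /(ler_wpM2r (nrm_ge0 (g - trunc F g))) /le_trans; apply.
have := ler_wpM2l (ltW C0) (ltW hF) => /le_trans; apply.
by rewrite mulrC divfK// gt_eqF.
Qed.

End Operators.

(** * Adjoints *)

Section Adjoints.
Variables (R : realType) (d : nat).
Notation H := (hardy R d).
Notation W := (word d).
Implicit Types (f g h : H) (w v s t : W) (F G : {fset W}).
Implicit Types (A B C : hop R d).
Let hS := @hdot_sesqui R d.

Lemma nrm_lshiftL k f : nrm (lshiftL k f) = nrm f.
Proof.
rewrite /nrm; congr (Num.sqrt (fine _)); rewrite /sqnorm.
have ik : set_inj [set: W] (wcons k) by move=> s t _ _; apply: wcons_inj.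
rewrite (esumID (range (wcons k))); last by move=> w _; rewrite lee_fin sqr_ge0.
rewrite setTI esum_image// [X in (_ + X)%E]esum1 ?adde0.
  by apply: eq_esum => -[w] _; rewrite /lshiftL /= /lshift_fun /= eqxx.
move=> w [_ nr]; suff -> : lshiftL k f w = 0 by rewrite Normc.normc0 expr0n.
case: w nr => -[//|l t] nr; rewrite /= /lshift_fun /=.
by case: eqP => // lk; case: nr; exists (FMonom t) => //; rewrite lk.
Qed.

Lemma lshiftLE k f l w : lshiftL k f (wcons l w) = if l == k then f w else 0.
Proof. by case: w. Qed.

Lemma lshiftL0 k f : lshiftL k f emptyword = 0.
Proof. by []. Qed.

Lemma bshift_l2 k f : (fun w => f (wcons k w)) \in @square_summable R d.
Proof.
rewrite unfold_in; apply: (@le_lt_trans _ _ (fine (sqnorm f))%:E);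
  last by rewrite ltry.
apply/sqnorm_leP => F.
have := psum_le f [fset wcons k w | w in F]%fset; rewrite /psum big_imfset//=.
by move=> s t _ _; apply: wcons_inj.
Qed.

Definition bshiftL k f : H := Hardy (bshift_l2 k f).

Lemma bshiftLK j k f : bshiftL j (lshiftL k f) = (j == k)%:R *: f.
Proof.
apply: hardyP => w; rewrite hcoefZ /= [LHS]lshiftLE.
by case: (j == k); rewrite ?mul1r ?mul0r.
Qed.

Definition linear_op A := forall (a : R[i]) f g, A (a *: f + g) = a *: A f + A g.

Definition bounded_op A (c : R) := forall f, nrm (A f) <= c * nrm f.

Lemma linear_opB A : linear_op A -> {morph A : f g / f - g}.
Proof.
by move=> lA f g; rewrite (addrC f) -scaleN1r lA scaleN1r (addrC (A f)).
Qed.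

Lemma linear_op0 A : linear_op A -> A 0 = 0.
Proof. by move=> lA; rewrite -[X in A X](subrr (0 : H)) (linear_opB lA) subrr. Qed.

Lemma linear_op_sum A (I : Type) (r : seq I) (a : I -> R[i]) (x : I -> H) :
  linear_op A -> A (\sum_(i <- r) a i *: x i) = \sum_(i <- r) a i *: A (x i).
Proof.
move=> lA; elim: r => [|i r IH]; first by rewrite !big_nil linear_op0.
by rewrite !big_cons lA IH.
Qed.

Lemma le_small (x y : R) : 0 <= y -> (forall e : R, 0 < e -> x <= e * y) -> x <= 0.
Proof.
move=> y0 h; apply/ler_addgt0Pr => e e0; rewrite add0r.
have y1 : 0 < y + 1 by lra.
have e1 : 0 < e / (y + 1) by rewrite divr_gt0.
apply: le_trans (h _ e1) _.
rewrite mulrAC ler_pdivrMr// ler_wpM2l ?ltW//; lra.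
Qed.

(** Finite combinations of basis vectors are dense, so an adjoint relation need
    only be tested on the basis when both sides are continuous. *)
Lemma adjoint_bvec A B (c : R) : linear_op A -> bounded_op A c -> 0 <= c ->
  (forall w g, hdot (A (bvec R w)) g = (B g w)^*) -> is_adjoint A B.
Proof.
move=> lA bA c0 AB f g.
apply/eqP; rewrite -subr_eq0; apply/eqP/Normc.eq0_normc/eqP.
rewrite eq_le modc_ge0 andbT.
apply: (@le_small _ (c * nrm g + nrm (B g))).
  by rewrite addr_ge0 ?mulr_ge0 ?nrm_ge0.
move=> e e0; have [F hF] := trunc_approx f e0.
have T : hdot (A (trunc F f)) g = hdot (trunc F f) (B g).
  rewrite /trunc linear_op_sum// !(sesq_suml hS); apply: eq_bigr => w _.
  by rewrite !(sesqZl hS) AB (sesqC hS (B g)) hdot_bvec.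
have -> : hdot (A f) g - hdot f (B g) =
    hdot (A (f - trunc F f)) g - hdot (f - trunc F f) (B g).
  by rewrite (linear_opB lA) !(sesqBl hS) T opprB addrA subrK.
apply: le_trans (le_normcD _ _) _; rewrite modcN mulrDr lerD//.
  apply: le_trans (hdot_CS _ _) _; rewrite mulrA ler_wpM2r ?nrm_ge0//.
  apply: le_trans (bA _) _; rewrite mulrC ler_wpM2r//; exact: ltW.
apply: le_trans (hdot_CS _ _) _; rewrite ler_wpM2r ?nrm_ge0//; exact: ltW.
Qed.

Lemma lshiftL_linear k : linear_op (@lshiftL R d k).
Proof.
move=> a f g; apply: hardyP; elim/wordP => [|l w _].
  by rewrite hcoefD hcoefZ !lshiftL0 mulr0 addr0.
rewrite hcoefD hcoefZ !lshiftLE; case: eqP => // _.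
by rewrite mulr0 addr0.
Qed.

Lemma lshiftL_adj k : is_adjoint (@lshiftL R d k) (bshiftL k).
Proof.
apply: (@adjoint_bvec _ _ 1) => // [||w g].
- exact: lshiftL_linear.
- by move=> f; rewrite nrm_lshiftL mul1r.
- rewrite -[lshiftL k _]/(bvec R (wcons k w)) (sesqC hS g) hdot_bvec.
  by [].
Qed.

Lemma adjoint_unique A B B' : is_adjoint A B -> is_adjoint A B' -> B = B'.
Proof.
move=> h h'; apply/funext => g; apply: hdot_inj => f.
by rewrite (sesqC hS f) [RHS](sesqC hS f) -h -h'.
Qed.

(** The adjoint is a chosen one, so that uniqueness lets any concrete adjoint be
    substituted for it. *)
Lemma adjE A B : is_adjoint A B -> adj A = B.
Proof.
move=> h; apply: (@adjoint_unique A) => //.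
by rewrite /adj; case: xgetP => [C _ //|/(_ B)].
Qed.

Definition adjointable A := is_adjoint A (adj A).

Lemma is_adjointable A B : is_adjoint A B -> adjointable A.
Proof. by move=> h; rewrite /adjointable (adjE h). Qed.

Lemma is_adjointC A B : is_adjoint A B -> is_adjoint B A.
Proof. by move=> h f g; rewrite (sesqC hS g) -h -(sesqC hS). Qed.

Lemma adjointable_adj A : adjointable A -> adjointable (adj A).
Proof. by move=> h; apply: (is_adjointable (is_adjointC h)). Qed.

Lemma is_adjoint_comp A A' B B' : is_adjoint A A' -> is_adjoint B B' ->
  is_adjoint (A \o B) (B' \o A').
Proof. by move=> h h' f g; rewrite /= h h'. Qed.

Lemma adjointable_comp A B : adjointable A -> adjointable B ->
  adjointable (A \o B).
Proof. by move=> h h'; apply: (is_adjointable (is_adjoint_comp h h')). Qed.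

Lemma adj_comp A B : adjointable A -> adjointable B ->
  adj (A \o B) = adj B \o adj A.
Proof. by move=> h h'; exact: adjE (is_adjoint_comp h h'). Qed.

Lemma is_adjoint_lin (a : R[i]) A A' B B' : is_adjoint A A' -> is_adjoint B B' ->
  is_adjoint (a *: A + B) (a^* *: A' + B').
Proof.
move=> h h' f g; rewrite -[(_ + B) f]/(a *: A f + B f).
rewrite -[(_ + B') g]/(a^* *: A' g + B' g).
by rewrite (sesqDl hS) (sesqDr hS) (sesqZl hS) (sesqZr hS) h h' conjK.
Qed.

Lemma adjointable_lin (a : R[i]) A B : adjointable A -> adjointable B ->
  adjointable (a *: A + B).
Proof. by move=> h h'; apply: (is_adjointable (is_adjoint_lin a h h')). Qed.

Lemma adj_lin (a : R[i]) A B : adjointable A -> adjointable B ->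
  adj (a *: A + B) = a^* *: adj A + adj B.
Proof. by move=> h h'; exact: adjE (is_adjoint_lin a h h'). Qed.

Lemma is_adjoint0 : is_adjoint (0 : hop R d) (0 : hop R d).
Proof. by move=> f g; rewrite (sesq0l hS) (sesq0r hS). Qed.

Lemma is_adjoint_id : is_adjoint (idfun : hop R d) (idfun : hop R d).
Proof. by []. Qed.

Lemma adjointable_linear A : adjointable A -> linear_op A.
Proof.
move=> h a f g; apply: hdot_inj => x.
by rewrite h (sesqDl hS) (sesqZl hS) -!h (sesqDl hS) (sesqZl hS).
Qed.

Lemma lshiftw_adjointable s : adjointable (lshiftw s : hop R d).
Proof.
elim/wordP: s => [|k s IH]; first exact: is_adjointable is_adjoint_id.
rewrite lshiftw_cons; apply: adjointable_comp IH.
exact: is_adjointable (lshiftL_adj k).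
Qed.

(** The relations [L_j^* L_k = delta_{jk}] on words. *)
Lemma adj_lshiftw_cons j k s t :
  adj (lshiftw (wcons k t)) \o lshiftw (wcons j s) =
  (j == k)%:R *: (adj (lshiftw t) \o lshiftw s) :> hop R d.
Proof.
have ak := lshiftL_adj k.
rewrite !lshiftw_cons adj_comp ?(adjE ak); last first.
- exact: lshiftw_adjointable.
- exact: is_adjointable ak.
apply/funext => f; rewrite /= [bshiftL _ _]bshiftLK eq_sym.
have l := adjointable_linear (adjointable_adj (lshiftw_adjointable t)).
by rewrite -[X in adj _ X]addr0 l (linear_op0 l) addr0.
Qed.

Lemma adj_bounded A B (c : R) : 0 <= c -> is_adjoint A B -> bounded_op A c ->
  bounded_op B c.
Proof.
move=> c0 h bA g; have [->|n0] := eqVneq (nrm (B g)) 0.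
  by rewrite mulr_ge0 ?nrm_ge0.
have n1 : 0 < nrm (B g) by rewrite lt_def n0 nrm_ge0.
rewrite -(ler_pM2l n1) -expr2.
have -> : nrm (B g) ^+ 2 = modc (hdot (A (B g)) g).
  by rewrite h hdotff modcR ger0_norm// sqr_ge0.
apply: le_trans (hdot_CS _ _) _.
by rewrite mulrA ler_wpM2r ?nrm_ge0// mulrC.
Qed.

(** ** Operator-norm limits *)

Definition op_close (e : R) A B := forall f, nrm (A f - B f) <= e * nrm f.

Lemma opnorm_closureP (S : set (hop R d)) A :
  opnorm_closure S A <-> forall e : R, 0 < e -> exists2 B, S B & op_close e A B.
Proof.
split=> h e /h [B SB hB]; exists B => // f.
  by have := hB f; rewrite !normE -rmorphM lecR.
by rewrite !normE -rmorphM lecR; exact: hB.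
Qed.

Lemma op_close_refl e A : 0 <= e -> op_close e A A.
Proof. by move=> e0 f; rewrite subrr nrm0 mulr_ge0 ?nrm_ge0. Qed.

Lemma op_closeC e A B : op_close e A B -> op_close e B A.
Proof. by move=> h f; rewrite nrmB. Qed.

Lemma op_close_trans e e' B A C :
  op_close e A B -> op_close e' B C -> op_close (e + e') A C.
Proof.
move=> h h' f; rewrite mulrDl -[A f](subrK (B f)) -addrA.
by apply: le_trans (nrmD _ _) _; rewrite lerD.
Qed.

Lemma op_close_lin (a : R[i]) e e' A A' B B' :
  op_close e A A' -> op_close e' B B' ->
  op_close (modc a * e + e') (a *: A + B) (a *: A' + B').
Proof.
move=> h h' f; rewrite -[(_ + B) f]/(a *: A f + B f).
rewrite -[(_ + B') f]/(a *: A' f + B' f) opprD addrACA -scalerBr mulrDl.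
apply: le_trans (nrmD _ _) _; rewrite nrmZ -mulrA lerD//.
by rewrite ler_wpM2l ?modc_ge0.
Qed.

Lemma op_close_adj e A B : 0 <= e -> adjointable A -> adjointable B ->
  op_close e A B -> op_close e (adj A) (adj B).
Proof.
move=> e0 hA hB h f.
have E (x : H) C D : C x - D x = ((-1) *: D + C) x :> H.
  by rewrite -[RHS]/((-1) *: D x + C x) scaleN1r addrC.
have -> : adj A f - adj B f = adj ((-1) *: B + A) f.
  by rewrite E adj_lin// rmorphN1.
apply: (adj_bounded e0 (adjointable_lin _ hB hA)) => g.
by rewrite -E; exact: h.
Qed.

Lemma opnorm_closure_mono (S S' : set (hop R d)) A :
  (forall B, S B -> S' B) -> opnorm_closure S A -> opnorm_closure S' A.
Proof. by move=> SS h e /h [B /SS SB hB]; exists B. Qed.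

Lemma opnorm_closure_sub (S : set (hop R d)) A : S A -> opnorm_closure S A.
Proof.
by move=> SA; apply/opnorm_closureP => e e0; exists A => //; apply/op_close_refl/ltW.
Qed.

Lemma opnorm_closure_idem (S : set (hop R d)) A :
  opnorm_closure (opnorm_closure S) A -> opnorm_closure S A.
Proof.
move=> /opnorm_closureP h; apply/opnorm_closureP => e e0.
have e2 : 0 < e / 2 by rewrite divr_gt0.
have [B /opnorm_closureP/(_ _ e2) [C SC BC] AB] := h _ e2.
exists C => //; have -> : e = e / 2 + e / 2 by lra.
exact: op_close_trans AB BC.
Qed.

Lemma opnorm_closure_lin (S : set (hop R d)) (a : R[i]) A B :
  (forall A B, S A -> S B -> S (a *: A + B)) ->
  opnorm_closure S A -> opnorm_closure S B -> opnorm_closure S (a *: A + B).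
Proof.
move=> lS /opnorm_closureP hA /opnorm_closureP hB.
apply/opnorm_closureP => e e0.
have m0 : 0 < modc a + 1 by have := modc_ge0 a; lra.
have e1 : 0 < e / (modc a + 1) by rewrite divr_gt0.
have [A' SA AA] := hA _ e1; have [B' SB BB] := hB _ e1.
exists (a *: A' + B'); first exact: lS.
have -> : e = modc a * (e / (modc a + 1)) + e / (modc a + 1).
  by field; rewrite gt_eqF.
exact: op_close_lin.
Qed.

Lemma eq_small (z : R[i]) (y : R) : 0 <= y ->
  (forall e : R, 0 < e -> modc z <= e * y) -> z = 0.
Proof.
move=> y0 h; apply/Normc.eq0_normc/eqP; rewrite eq_le modc_ge0 andbT.
exact: le_small h.
Qed.

Lemma near_invS (e : R) : 0 < e -> \forall n \near \oo, n.+1%:R^-1 < e.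
Proof.
move=> e0; have /cvgrPdist_lt/(_ _ e0) := @cvg_harmonic R.
by apply: filterS => n; rewrite sub0r normrN ger0_norm ?harmonic_ge0.
Qed.

(** Adjoints pass to operator-norm limits: those of the approximants form a
    Cauchy sequence at each vector, and its coefficientwise limit, which stays
    in the space by Fatou's lemma, is the adjoint of the limit. *)
Lemma closure_adjointable (S : set (hop R d)) A :
  (forall B, S B -> adjointable B) -> opnorm_closure S A -> adjointable A.
Proof.
move=> aS /opnorm_closureP hA.
have ge n : 0 < n.+1%:R^-1 :> R by rewrite invr_gt0.
have /choice [D hD] : forall n : nat, exists B, S B /\ op_close n.+1%:R^-1 A B.
  by move=> n; have [B SB hB] := hA _ (ge n); exists B.
have aD n : adjointable (D n) by apply: aS; have [] := hD n.
have DD n m : (n <= m)%N -> op_close (2 * n.+1%:R^-1) (D n) (D m).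
  move=> nm f.
  have := op_close_trans (op_closeC (hD n).2) (hD m).2 f => /le_trans; apply.
  rewrite ler_wpM2r ?nrm_ge0// mulr2n mulrDl mul1r lerD2l.
  by rewrite lef_pV2 ?posrE// ler_nat.
pose v g w := hdot g (A (bvec R w)).
have vl g w : (fun n => adj (D n) g w : R[i]^o) @ \oo --> (v g w : R[i]^o).
  have E n : adj (D n) g w = hdot g (D n (bvec R w)).
    by rewrite -hdot_bvec (sesqC hS (bvec R w)) -aD -(sesqC hS).
  apply/cvgCP => e e0.
  pose M := nrm g * nrm (bvec R w) + 1.
  have M0 : 0 < M by have := mulr_ge0 (nrm_ge0 g) (nrm_ge0 (bvec R w)); rewrite /M; lra.
  have e1 : 0 < e / M by rewrite divr_gt0.
  have : \forall n \near \oo, n.+1%:R^-1 < e / M :> R.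
    exact: near_invS.
  apply: filterS => n hn.
  rewrite E /v -(sesqBr hS); apply: le_lt_trans (hdot_CS _ _) _.
  have := ler_wpM2l (nrm_ge0 g) ((hD n).2 (bvec R w)) => /le_lt_trans; apply.
  rewrite mulrCA; apply: (@le_lt_trans _ _ (n.+1%:R^-1 * (M))).
    by apply: ler_wpM2l; [exact: ltW | rewrite /M lerDl].
  by rewrite -ltr_pdivlMr.
have key n g : exists2 h : H, h = v g :> (W -> R[i]) &
    nrm (h - adj (D n) g) <= 2 * n.+1%:R^-1 * nrm g.
  have c0 : 0 <= 2 * n.+1%:R^-1 * nrm g.
    by rewrite !mulr_ge0 ?nrm_ge0// ltW.
  have H1 w : (fun m => (adj (D m) g - adj (D n) g) w : R[i]^o) @ \oo
      --> (v g w - adj (D n) g w : R[i]^o).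
    by apply: cvgC_B; [exact: vl | exact: cvg_cst].
  have H2 : \forall m \near \oo,
      forall F, psum (adj (D m) g - adj (D n) g) F <= (2 * n.+1%:R^-1 * nrm g) ^+ 2.
    exists n => // m /= nm; apply/(@nrm_leP _ _ (adj (D m) g - adj (D n) g : H)) => //.
    rewrite nrmB.
    have e0 : 0 <= 2 * n.+1%:R^-1 :> R by rewrite mulr_ge0// ltW.
    exact: op_close_adj e0 (aD n) (aD m) (DD _ _ nm) g.
  have [h hE hh] := hardy_Fatou _ c0 H1 H2.
  exists (h + adj (D n) g); last by rewrite addrK.
  by apply/funext => w; rewrite hcoefD hE subrK.
pose B g := xget 0 [set h : H | h = v g :> (W -> R[i])].
have BE g : B g = v g :> (W -> R[i]).
  by rewrite /B; case: xgetP => // /= no; have [h /no] := key 0%N g.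
apply: (@is_adjointable _ B) => f g.
apply/eqP; rewrite -subr_eq0; apply/eqP.
apply: (@eq_small _ (3 * (nrm f * nrm g))).
  by rewrite !mulr_ge0 ?nrm_ge0.
move=> e e0.
have [n hn] : exists n : nat, n.+1%:R^-1 < e :> R.
  by have [n _ /(_ n (leqnn n))] := near_invS e0; exists n.
have -> : hdot (A f) g - hdot f (B g) =
    hdot (A f - D n f) g + hdot f (adj (D n) g - B g).
  by rewrite (sesqBl hS) (sesqBr hS) aD addrA subrK.
have [h hE hh] := key n g.
have -> : B g = h by apply: hardyP => w; rewrite hE BE.
apply: le_trans (le_normcD _ _) _.
have h1 := le_trans (hdot_CS (A f - D n f) g)
  (ler_wpM2r (nrm_ge0 g) ((hD n).2 f)).
have h2 := hdot_CS f (adj (D n) g - h); rewrite [nrm (_ - h)]nrmB in h2.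
have h3 := le_trans h2 (ler_wpM2l (nrm_ge0 f) hh).
have h4 : n.+1%:R^-1 * (nrm f * nrm g) <= e * (nrm f * nrm g).
  by rewrite ler_wpM2r ?mulr_ge0 ?nrm_ge0// ltW.
rewrite (_ : e * _ = e * (nrm f * nrm g) + 2 * (e * (nrm f * nrm g))); last ring.
apply: lerD; first by apply: le_trans h1 _; rewrite -mulrA.
apply: le_trans h3 _.
rewrite (_ : nrm f * (2 * n.+1%:R^-1 * nrm g) = 2 * (n.+1%:R^-1 * (nrm f * nrm g))); last ring.
by rewrite ler_pM2l.
Qed.

End Adjoints.

(** * Noncommutative polynomials *)

Section Polynomials.
Variables (R : realType) (d : nat).
Notation W := (word d).
Notation P_ := (ncpoly R d).
Implicit Types (P Q U : ncpoly R d) (s t w : W).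

Lemma ncoefD s P Q : mcoeff s (P + Q) = mcoeff s P + mcoeff s Q.
Proof. exact: mcoeffD. Qed.

Lemma ncoefB s P Q : mcoeff s (P - Q) = mcoeff s P - mcoeff s Q.
Proof. exact: mcoeffB. Qed.

Lemma ncoefZ s (a : R[i]) P : mcoeff s (a *: P) = a * mcoeff s P.
Proof. exact: mcoeffZ. Qed.

Lemma ncoef0 s : mcoeff s (0 : ncpoly R d) = 0.
Proof. exact: mcoeff0. Qed.

Lemma ncoef_sum (I : Type) (r : seq I) (F : I -> ncpoly R d) s :
  mcoeff s (\sum_(i <- r) F i) = \sum_(i <- r) mcoeff s (F i).
Proof. exact: (raddf_sum (mcoeff s)). Qed.

Lemma mcoeff_Zpow s t : mcoeff t (Zpow R s) = (s == t)%:R.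
Proof. exact: mcoeffU. Qed.

Lemma msupp_Zpow s : (msupp (Zpow R s) `<=` [fset s])%fset.
Proof. exact: msuppU_le. Qed.

Lemma Zpow_mul s t : Zpow R s * Zpow R t = Zpow R (FMonom (s ++ t)).
Proof.
rewrite /Zpow malgM_def fgmulUU mulr1; congr mkmalgU.
exact: (fmmulE s t).
Qed.

Lemma Zpow_empty : Zpow R (@emptyword d) = 1.
Proof.
apply/malgP => s; rewrite mcoeff_Zpow mcoeff1 eq_sym.
by congr ((_ == _)%:R); rewrite [RHS]fmoneE.
Qed.

#[local] Opaque Zpow mcoeff msupp.

Definition mext (V : lmodType R[i]) (g : W -> V) P : V :=
  \sum_(s <- msupp P) mcoeff s P *: g s.

Lemma mextEw (V : lmodType R[i]) (g : W -> V) (D : {fset W}) P :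
  (msupp P `<=` D)%fset -> mext g P = \sum_(s <- D) mcoeff s P *: g s.
Proof.
move=> PD; rewrite /mext; apply: (big_fset_incl _ PD) => s _ sP.
by rewrite mcoeff_outdom ?scale0r.
Qed.

Lemma mext_lin (V : lmodType R[i]) (g : W -> V) (a : R[i]) P Q :
  mext g (a *: P + Q) = a *: mext g P + mext g Q.
Proof.
pose D := (msupp P `|` msupp Q `|` msupp (a *: P + Q))%fset.
rewrite !(@mextEw _ _ D).
- rewrite scaler_sumr -big_split; apply: eq_bigr => s _ /=.
  by rewrite ncoefD ncoefZ scalerDl scalerA.
- exact: fsubset_trans (fsubsetUr _ _) (fsubsetUl _ _).
- exact: fsubset_trans (fsubsetUl _ _) (fsubsetUl _ _).
- exact: fsubsetUr.
Qed.

Lemma mext_Zpow (V : lmodType R[i]) (g : W -> V) s : mext g (Zpow R s) = g s.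
Proof.
rewrite (@mextEw _ _ [fset s]%fset); last exact: msupp_Zpow.
by rewrite big_seq_fset1 mcoeff_Zpow eqxx scale1r.
Qed.

Lemma mext_id P : mext (@Zpow R d) P = P.
Proof.
apply/malgP => s; rewrite /mext ncoef_sum.
have E t : mcoeff s (mcoeff t P *: Zpow R t) = mcoeff t P * (t == s)%:R.
  by rewrite ncoefZ mcoeff_Zpow.
rewrite (eq_bigr _ (fun t _ => E t)).
have [sP|sP] := boolP (s \in msupp P).
  rewrite (big_fsetD1 s sP) /= eqxx mulr1 big1_fset ?addr0// => t.
  by rewrite !inE => /andP[/negbTE ts _] _; rewrite ts mulr0.
rewrite mcoeff_outdom// big1_fset// => t tP _.
by rewrite eq_sym (negbTE (memPnC sP t tP)) mulr0.
Qed.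

Lemma ncpoly_ind (K : P_ -> Prop) : K 0 ->
  (forall (a : R[i]) s P, K P -> K (a *: Zpow R s + P)) -> forall P, K P.
Proof.
move=> K0 KS P; rewrite -(mext_id P) /mext.
elim: (enum_fset (msupp P)) => [|s r IH]; first by rewrite big_nil.
by rewrite big_cons; exact: KS.
Qed.

Fact lmul_key : unit. Proof. by []. Qed.

(** Left multiplication by a variable, kept opaque because the product of
    polynomials unfolds to double sums over supports. *)
Definition lmul : 'I_d -> P_ -> P_ :=
  locked_with lmul_key (fun k P => Zpow R (FMonom [:: k]) * P).

Lemma lmulE k P : Zpow R (FMonom [:: k]) * P = lmul k P.
Proof. by rewrite /lmul unlock. Qed.

Lemma lmul_lin k (a : R[i]) P Q : lmul k (a *: P + Q) = a *: lmul k P + lmul k Q.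
Proof.
rewrite -!lmulE mulrDr; congr +%R; apply/malgP => w; rewrite ncoefZ.
rewrite [LHS](mcoeffMlw w (fsubset_refl _) (msuppZ_le a P)).
rewrite [X in _ = a * X](mcoeffMlw w (fsubset_refl _) (fsubset_refl _)) mulr_sumr.
apply: eq_bigr => s _; rewrite mulr_sumr; apply: eq_bigr => t _.
by rewrite ncoefZ mulrCA mulrnAr.
Qed.

Lemma lmul0 k : lmul k 0 = 0.
Proof. by rewrite -lmulE mulr0. Qed.

Lemma lmul_Zpow k s : lmul k (Zpow R s) = Zpow R (wcons k s).
Proof.
by rewrite -lmulE; exact: Zpow_mul. Qed.

Lemma polyL_lin (a : R[i]) P Q : polyL (a *: P + Q) = a *: polyL P + polyL Q.
Proof. exact: (@mext_lin (hop R d)). Qed.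

Lemma polyL_Zpow s : polyL (Zpow R s) = lshiftw s.
Proof. exact: (@mext_Zpow (hop R d)). Qed.

Lemma polyL0 : polyL (0 : P_) = 0.
Proof. by rewrite /polyL msupp0 big_seq_fset0. Qed.

Lemma polyL1 : polyL (1 : P_) = idfun.
Proof. by rewrite -Zpow_empty polyL_Zpow. Qed.

Lemma polyL_adjointable P : adjointable (polyL P).
Proof.
elim/ncpoly_ind: P => [|a s P IH].
  by rewrite polyL0; apply: is_adjointable (@is_adjoint0 R d).
rewrite (polyL_lin a (Zpow R s)) polyL_Zpow.
exact: adjointable_lin (lshiftw_adjointable s) IH.
Qed.

Lemma adj_polyL_lin (a : R[i]) P Q :
  adj (polyL (a *: P + Q)) = a^* *: adj (polyL P) + adj (polyL Q).
Proof. by rewrite polyL_lin adj_lin//; exact: polyL_adjointable. Qed.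

Lemma adj_polyL0 : adj (polyL (0 : P_)) = 0.
Proof. by rewrite polyL0; apply: adjE; exact: is_adjoint0. Qed.

Lemma adj_polyL1 : adj (polyL (1 : P_)) = idfun.
Proof. by rewrite polyL1; apply: adjE; exact: is_adjoint_id. Qed.

(** * The disc system *)

Lemma polyL_disc P : disc_algebra (polyL P).
Proof. by apply: opnorm_closure_sub; exists P. Qed.

Lemma disc_adjointable A : @disc_algebra R d A -> adjointable A.
Proof.
by apply: closure_adjointable => _ [P _ <-]; exact: polyL_adjointable.
Qed.

(** The trigonometric polynomials [P(L) + Q(L)^*] are dense in the disc system. *)
Definition trig : set (hop R d) :=
  [set A | exists P Q, A = polyL P + adj (polyL Q)].

Lemma trig_lin (a : R[i]) A B : trig A -> trig B -> trig (a *: A + B).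
Proof.
move=> [P [Q ->]] [P' [Q' ->]]; exists (a *: P + P'), (a^* *: Q + Q').
by rewrite polyL_lin adj_polyL_lin conjK scalerDr addrACA.
Qed.

Lemma trig0 : trig 0.
Proof. by exists 0, 0; rewrite polyL0 -polyL0 adj_polyL0 addr0. Qed.

Lemma trig_poly P : trig (polyL P).
Proof. by exists P, 0; rewrite adj_polyL0 addr0. Qed.

Lemma trig_adj P : trig (adj (polyL P)).
Proof. by exists 0, P; rewrite polyL0 add0r. Qed.

Lemma trigZ (a : R[i]) A : trig A -> trig (a *: A).
Proof. by move=> h; rewrite -[_ *: _]addr0; apply: trig_lin => //; exact: trig0. Qed.

Lemma trig_words s t : trig (adj (lshiftw t) \o lshiftw s).
Proof.
elim/wordP: t s => [|k t IH] s.
  rewrite lshiftw_empty (adjE (@is_adjoint_id R d)) -polyL_Zpow.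
  exact: trig_poly.
elim/wordP: s => [|j s _].
  by rewrite lshiftw_empty -polyL_Zpow; exact: trig_adj.
by rewrite adj_lshiftw_cons; exact: trigZ.
Qed.

(** The adjoint shifts of [Q(L)^*] cancel against the shifts of [P(L)], and the
    shorter of two words is used up first; this is why a functional on the disc
    system defines a form on polynomials. *)
Lemma trig_prod P Q : trig (adj (polyL Q) \o polyL P).
Proof.
elim/ncpoly_ind: P => [|a s P IH].
  rewrite polyL0; have l := adjointable_linear (adjointable_adj (polyL_adjointable Q)).
  have -> : adj (polyL Q) \o (0 : hop R d) = 0 :> hop R d.
    by apply/funext => f /=; rewrite (linear_op0 l).
  exact: trig0.
have l := adjointable_linear (adjointable_adj (polyL_adjointable Q)).
have -> : adj (polyL Q) \o polyL (a *: Zpow R s + P) =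
    a *: (adj (polyL Q) \o lshiftw s) + (adj (polyL Q) \o polyL P).
  by rewrite polyL_lin polyL_Zpow; apply/funext => f; exact: l.
apply: trig_lin => // {P IH l}.
elim/ncpoly_ind: Q => [|b t Q IH]; first by rewrite adj_polyL0; exact: trig0.
have -> : adj (polyL (b *: Zpow R t + Q)) \o lshiftw s =
    b^* *: (adj (lshiftw t) \o lshiftw s) + (adj (polyL Q) \o lshiftw s).
  by rewrite adj_polyL_lin polyL_Zpow.
by apply: trig_lin => //; exact: trig_words.
Qed.

(** Taking adjoints is continuous in operator norm, so the two closures in the
    definition of the disc system collapse to one. *)
Lemma disc_systemP (A : hop R d) : disc_system A <-> opnorm_closure trig A.
Proof.
split=> h.
  apply: opnorm_closure_idem; apply: opnorm_closure_mono h => _ [A1 h1] [B1 h2] <-.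
  apply/opnorm_closureP => e e0.
  have e2 : 0 < e / 2 by rewrite divr_gt0.
  move/opnorm_closureP: (h1) => /(_ _ e2) [_ [P _ <-] hP].
  move/opnorm_closureP: (h2) => /(_ _ e2) [_ [Q _ <-] hQ].
  exists (polyL P + adj (polyL Q)); first by exists P, Q.
  have -> : e = modc (1 : R[i]) * (e / 2) + e / 2.
    by rewrite Normc.normc1; lra.
  rewrite -[A1]scale1r -[polyL P]scale1r; apply: op_close_lin => //.
  apply: op_close_adj => //; [exact: ltW|exact: disc_adjointable|].
  exact: polyL_adjointable.
apply: opnorm_closure_mono h => _ [P [Q ->]].
by exists (polyL P); [exact: polyL_disc|exists (polyL Q); [exact: polyL_disc|]].
Qed.

Lemma trig_disc A : trig A -> disc_system A.
Proof. by move=> h; apply/disc_systemP/opnorm_closure_sub. Qed.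

Lemma disc_system_lin (a : R[i]) (A B : hop R d) :
  disc_system A -> disc_system B -> disc_system (a *: A + B).
Proof.
move=> /disc_systemP hA /disc_systemP hB; apply/disc_systemP.
by apply: opnorm_closure_lin => // *; exact: trig_lin.
Qed.

End Polynomials.

(** * Words in shortlex order *)

Section WordLists.
Variable d : nat.
Notation W := (word d).
Implicit Types (s t r : W).

Lemma before_uniq s : uniq (before s).
Proof.
exact: sorted_uniq (@shortlex_trans d) (@shortlex_irr d) _ (before_sorted s).
Qed.

Lemma upto_uniq s : uniq (upto s).
Proof.
exact: sorted_uniq (@shortlex_trans d) (@shortlex_irr d) _ (upto_sorted s).
Qed.

Lemma words_upto_uniq n : uniq (words_upto d n).
Proof.
exact: sorted_uniq (@shortlex_trans d) (@shortlex_irr d) _ (words_upto_sorted d n).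
Qed.

Lemma upto_sub s t : t \in upto s -> {subset upto t <= upto s}.
Proof.
rewrite mem_upto => ts w; rewrite !mem_upto.
case/orP: ts => [/eqP -> //|ts]; case/orP => [/eqP ->|wt]; first by rewrite ts orbT.
by rewrite (shortlex_trans wt ts) orbT.
Qed.

Lemma shortlex_wcons k s t : shortlex (wcons k s) (wcons k t) = shortlex s t.
Proof.
rewrite /shortlex /= ltnS eqSS; congr (_ || (_ && _)).
by rewrite [LHS]ltxi_cons lexx.
Qed.

Lemma shortlex_empty s : shortlex s emptyword = false.
Proof. by case: s => [[|k s]]; rewrite /shortlex /= ?ltxx. Qed.

Lemma before_empty : before (@emptyword d) = [::].
Proof.
case E: (before _) => [//|s l].
by have := mem_before emptyword s; rewrite E inE eqxx shortlex_empty.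
Qed.

Lemma shortlex_asym s t : shortlex s t -> shortlex t s = false.
Proof.
move=> st; apply/negP => ts.
by have := shortlex_trans st ts; rewrite shortlex_irr.
Qed.

Lemma upto_empty : upto (@emptyword d) = [:: emptyword].
Proof. by rewrite /upto before_empty. Qed.

Lemma size_before_lt s t : shortlex s t -> (size (before s) < size (before t))%N.
Proof.
move=> st; rewrite -(size_rcons _ s); apply: uniq_leq_size; first exact: upto_uniq.
move=> r; rewrite mem_rcons inE !mem_before => /orP[/eqP -> //|rs].
exact: shortlex_trans rs st.
Qed.

(** A word has finitely many predecessors, and their number decreases along the
    order. *)
Lemma shortlex_ind (K : W -> Prop) :
  (forall s, (forall t, shortlex t s -> K t) -> K s) -> forall s, K s.
Proof.
move=> h s; have [n] := ubnP (size (before s)); elim: n s => // n IH s sn.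
apply: h => t /size_before_lt ts; apply: IH; exact: leq_trans ts _.
Qed.

Hypothesis d0 : (0 < d)%N.

Lemma d_pred : (d.-1 < d)%N.
Proof. by rewrite prednK. Qed.

Definition lastletter : 'I_d := Ordinal d_pred.

Lemma lastwordE0 n : lastword d n = FMonom (nseq n lastletter).
Proof. exact: lastwordE. Qed.

Lemma lastwordS n : lastword d n.+1 = wcons lastletter (lastword d n).
Proof. by rewrite !lastwordE0. Qed.

Lemma lastword0 : lastword d 0 = emptyword.
Proof. by rewrite lastwordE0. Qed.

Lemma size_lastword n : size (lastword d n) = n.
Proof. by rewrite lastwordE0 size_nseq. Qed.

Lemma lastword_max n s : size s = n ->
  ((s : seqlexi 'I_d) <= (lastword d n : seqlexi 'I_d))%O.
Proof.
elim/wordP: s n => [|k s IH] [|n] //.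
move=> [sn]; rewrite lastwordS.
rewrite -[(_ <= _)%O]/((k :: s : seqlexi 'I_d) <=
  (lastletter :: lastword d n : seqlexi 'I_d))%O lexi_cons.
have kl : (k <= lastletter)%O.
  by rewrite leEord /= -ltnS prednK.
by rewrite kl /=; apply/implyP => _; exact: IH.
Qed.

Lemma upto_lastword n : upto (lastword d n) = words_upto d n.
Proof.
apply: (irr_sorted_eq (@shortlex_trans d) (@shortlex_irr d)).
- exact: upto_sorted.
- exact: words_upto_sorted.
move=> s; rewrite mem_upto mem_words_upto.
apply/orP/idP => [[/eqP ->|]|].
- by rewrite size_lastword.
- by rewrite /shortlex size_lastword => /orP[/ltnW //|/andP[/eqP -> _]].
rewrite leq_eqVlt => /orP[/eqP sn|sn]; last first.
  by right; rewrite /shortlex size_lastword sn.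
have := lastword_max sn; rewrite le_eqVlt => /orP[/eqP e|lt]; [left|right].
  by apply/eqP; rewrite -[LHS]fmK -[RHS]fmK; congr FMonom.
by rewrite /shortlex size_lastword sn eqxx lt orbT.
Qed.

End WordLists.

(** * Supports of polynomials *)

Section Supports.
Variables (R : realType) (d : nat).
Notation W := (word d).
Implicit Types (P Q U : ncpoly R d) (s t w : W) (l : seq (word d)).

Definition supported l P := forall s, s \notin l -> mcoeff s P = 0.

Lemma supported_lin l (a : R[i]) P Q :
  supported l P -> supported l Q -> supported l (a *: P + Q).
Proof. by move=> h h' s sl; rewrite ncoefD ncoefZ h// h'// mulr0 addr0. Qed.

Lemma supported0 l : supported l 0.
Proof. by move=> s _; rewrite ncoef0. Qed.

Lemma supportedZ l (a : R[i]) P : supported l P -> supported l (a *: P).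
Proof. by move=> h s sl; rewrite ncoefZ h// mulr0. Qed.

Lemma supportedD l P Q : supported l P -> supported l Q -> supported l (P + Q).
Proof. by move=> h h' s sl; rewrite ncoefD h// h'// addr0. Qed.

Lemma supportedB l P Q : supported l P -> supported l Q -> supported l (P - Q).
Proof. by move=> h h' s sl; rewrite ncoefB h// h'// subr0. Qed.

Lemma supported_sum l (I : eqType) (r : seq I) (a : I -> R[i]) (F : I -> ncpoly R d) :
  (forall i, i \in r -> supported l (F i)) ->
  supported l (\sum_(i <- r) a i *: F i).
Proof.
move=> h; rewrite big_seq; elim/big_rec: _ => [|i P ir]; first exact: supported0.
by apply: supported_lin; exact: h.
Qed.

Lemma supported_sub l l' P : {subset l <= l'} -> supported l P -> supported l' P.
Proof. by move=> ll h s sl; apply: h; apply: contraNN sl => /ll. Qed.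

Lemma supported_Zpow l s : s \in l -> supported l (Zpow R s).
Proof.
by move=> sl t tl; rewrite mcoeff_Zpow; case: eqP => // st; rewrite -st sl in tl.
Qed.

Lemma supportedE l P : uniq l -> supported l P ->
  P = \sum_(t <- l) mcoeff t P *: Zpow R t.
Proof.
move=> ul h; apply/malgP => s.
have E t : mcoeff s (mcoeff t P *: Zpow R t) = mcoeff t P * (t == s)%:R.
  by rewrite ncoefZ mcoeff_Zpow.
rewrite ncoef_sum (eq_bigr _ (fun t _ => E t)).
have [sl|sl] := boolP (s \in l).
  rewrite (bigD1_seq s sl ul) /= eqxx mulr1 big1 ?addr0// => t.
  by move=> /negbTE ->; rewrite mulr0.
rewrite h// big_seq big1// => t tl.
by rewrite (negbTE (memPn sl t tl)) mulr0.
Qed.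

Lemma in_spanP l P : uniq l -> supported l P -> in_span l P.
Proof. by move=> ul h; exists (mcoeff^~ P); exact: supportedE. Qed.

Lemma in_span_supported l P : in_span l P -> supported l P.
Proof.
move=> [c ->]; apply: supported_sum => t tl; exact: supported_Zpow.
Qed.

Lemma supported_words P : exists n, supported (words_upto d n) P.
Proof.
exists (\max_(s <- msupp P) size s)%N => s; rewrite mem_words_upto => h.
apply: mcoeff_outdom; apply: contraNN h => sP.
by rewrite (big_fsetD1 s)//= leq_maxl.
Qed.

Lemma mcoeff_lmul k P j t :
  mcoeff (wcons j t) (lmul k P) = (j == k)%:R * mcoeff t P.
Proof.
elim/ncpoly_ind: P => [|a s P IH]; first by rewrite lmul0 !ncoef0 mulr0.
rewrite lmul_lin !ncoefD !ncoefZ lmul_Zpow IH mulrDr; congr (_ + _).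
rewrite !mcoeff_Zpow mulrCA; congr (_ * _).
have -> : (wcons k s == wcons j t) = (k == j) && (s == t) by exact: eqseq_cons.
by rewrite (eq_sym j); case: (k == j); rewrite ?mul1r ?mul0r.
Qed.

Lemma mcoeff0_lmul k P : mcoeff emptyword (lmul k P) = 0.
Proof.
elim/ncpoly_ind: P => [|a s P IH]; first by rewrite lmul0 ncoef0.
by rewrite lmul_lin ncoefD ncoefZ lmul_Zpow IH mcoeff_Zpow mulr0 addr0.
Qed.

Lemma lmulZ k (a : R[i]) P : lmul k (a *: P) = a *: lmul k P.
Proof.
by rewrite -[a *: P]addr0 lmul_lin lmul0 addr0.
Qed.

End Supports.

(** * Inner products defined by nc measures *)

Section Functional.
Variables (R : realType) (d : nat) (nu : hop R d -> R[i]).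
Hypothesis Hnu : nc_measure nu.
Notation W := (word d).
Notation B := (pdot nu).
Implicit Types (P Q U : ncpoly R d) (s t w : W) (l : seq (word d)).

Lemma nu_lin (a : R[i]) A A' : disc_system A -> disc_system A' ->
  nu (a *: A + A') = a * nu A + nu A'.
Proof. by have [h _] := Hnu; exact: h. Qed.

Lemma disc_system0 : disc_system (0 : hop R d).
Proof. exact/trig_disc/trig0. Qed.

Lemma nu0 : nu 0 = 0.
Proof.
have := nu_lin 1 disc_system0 disc_system0.
by rewrite scale1r addr0 mul1r => /esym/eqP; rewrite -subr_eq0 addrK => /eqP.
Qed.

Lemma nuZ (a : R[i]) A : disc_system A -> nu (a *: A) = a * nu A.
Proof. by move=> h; rewrite -[a *: A]addr0 nu_lin ?nu0 ?addr0//; exact: disc_system0. Qed.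

Lemma nuD A A' : disc_system A -> disc_system A' -> nu (A + A') = nu A + nu A'.
Proof. by move=> h h'; have := nu_lin 1 h h'; rewrite scale1r mul1r. Qed.

Lemma prod_disc P Q : disc_system (adj (polyL Q) \o polyL P).
Proof. exact/trig_disc/trig_prod. Qed.

Lemma positive_prod P : positive_op (adj (polyL P) \o polyL P).
Proof.
move=> f; rewrite /= (sesqC (@hdot_sesqui R d) f) -polyL_adjointable.
by rewrite -(sesqC (@hdot_sesqui R d)) hdotff ler0c sqr_ge0.
Qed.

Lemma pdot_sesqui : pos_sesqui B.
Proof.
split=> [a P Q U|a P Q U|P].
- rewrite /pdot -nu_lin; try exact: prod_disc; congr nu.
  have l := adjointable_linear (adjointable_adj (polyL_adjointable U)).
  by rewrite polyL_lin; apply/funext => f; exact: l.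
- rewrite /pdot -nu_lin; try exact: prod_disc; congr nu.
  by rewrite adj_polyL_lin.
- by have [_ h] := Hnu; apply: h; [exact: prod_disc|exact: positive_prod].
Qed.
Let hB := pdot_sesqui.

Lemma pdotZl (a : R[i]) P Q : B (a *: P) Q = a * B P Q.
Proof. exact: (sesqZl hB). Qed.

Lemma pdotZr (a : R[i]) P Q : B P (a *: Q) = a^* * B P Q.
Proof. exact: (sesqZr hB). Qed.

Lemma pdotDl P Q U : B (P + Q) U = B P U + B Q U.
Proof. exact: (sesqDl hB). Qed.

Lemma pdotDr P Q U : B U (P + Q) = B U P + B U Q.
Proof. exact: (sesqDr hB). Qed.

Lemma pdotBl P Q U : B (P - Q) U = B P U - B Q U.
Proof. exact: (sesqBl hB). Qed.

Lemma pdotBr P Q U : B U (P - Q) = B U P - B U Q.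
Proof. exact: (sesqBr hB). Qed.

Lemma pdot_suml (I : Type) (r : seq I) (F : I -> ncpoly R d) U :
  B (\sum_(i <- r) F i) U = \sum_(i <- r) B (F i) U.
Proof. exact: (sesq_suml hB). Qed.

Lemma pdot_sumr (I : Type) (r : seq I) (F : I -> ncpoly R d) U :
  B U (\sum_(i <- r) F i) = \sum_(i <- r) B U (F i).
Proof. exact: (sesq_sumr hB). Qed.

Lemma pdot0l P : B 0 P = 0.
Proof. exact: (sesq0l hB). Qed.

Lemma pdot0r P : B P 0 = 0.
Proof. exact: (sesq0r hB). Qed.

Lemma pdotC P Q : B Q P = (B P Q)^*.
Proof. exact: (sesqC hB). Qed.

Lemma snorm2_pdotZ (a : R[i]) P : snorm2 B (a *: P) = modc a ^+ 2 * snorm2 B P.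
Proof. exact: (snorm2Z hB). Qed.

Lemma snorm2_pdotD P Q :
  snorm2 B (P + Q) = snorm2 B P + snorm2 B Q + 2 * complex.Re (B P Q).
Proof. exact: (snorm2D hB). Qed.

Lemma pdotPP P : B P P = (snorm2 B P)%:C.
Proof. exact: (snorm2E hB). Qed.

Lemma pdot_Zpow s t : B (Zpow R s) (Zpow R t) = toeplitz_kernel nu s t.
Proof. by rewrite /pdot !polyL_Zpow. Qed.

(** Multiplication by the variables is a row isometry for every nc measure,
    because [L_j^* L_k = delta_{jk}]; the recurrences for the orthogonal
    polynomials rest on this. *)
Lemma pdot_lmul j k P Q : B (lmul j P) (lmul k Q) = (j == k)%:R * B P Q.
Proof.
elim/ncpoly_ind: P => [|a s P IH].
  by rewrite lmul0 !pdot0l mulr0.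
rewrite lmul_lin pdotDl pdotZl IH lmul_Zpow.
rewrite (pdotDl (a *: Zpow R s)) (pdotZl a) mulrDr; congr (_ + _).
rewrite mulrCA; congr (_ * _) => {P IH}.
elim/ncpoly_ind: Q => [|b t Q IH].
  by rewrite lmul0 !pdot0r mulr0.
rewrite lmul_lin pdotDr pdotZr IH lmul_Zpow.
rewrite (pdotDr (b *: Zpow R t)) (pdotZr b) mulrDr; congr (_ + _).
rewrite mulrCA; congr (_ * _); rewrite !pdot_Zpow /toeplitz_kernel.
by rewrite adj_lshiftw_cons nuZ//; exact/trig_disc/trig_words.
Qed.

Lemma pnorm2 P : pnorm nu P ^+ 2 = snorm2 B P.
Proof. by rewrite sqr_sqrtr//; exact: (snorm2_ge0 hB). Qed.

Lemma nu_polyL P : nu (polyL P) = B P 1.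
Proof. by rewrite /pdot adj_polyL1. Qed.

Lemma nu_adj_polyL P : nu (adj (polyL P)) = B 1 P.
Proof. by rewrite /pdot polyL1. Qed.

Definition orth l P := forall t, t \in l -> B P (Zpow R t) = 0.

Lemma orth_supported l P Q : uniq l -> orth l P -> supported l Q -> B P Q = 0.
Proof.
move=> ul oP QE; rewrite [X in B P X](supportedE ul QE) pdot_sumr big_seq big1// => t tl.
by rewrite pdotZr oP// mulr0.
Qed.

Lemma orth_lin l (a : R[i]) P Q : orth l P -> orth l Q -> orth l (a *: P + Q).
Proof.
by move=> h h' t tl; rewrite pdotDl pdotZl h// h'// mulr0 addr0.
Qed.

Lemma orthZ l (a : R[i]) P : orth l P -> orth l (a *: P).
Proof. by move=> h t tl; rewrite pdotZl h// mulr0. Qed.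

End Functional.

(** * Orthogonal polynomials *)

Section OrthogonalPolynomials.
Variables (R : realType) (d : nat) (mu : hop R d -> R[i]).
Hypotheses (Hmu : nc_measure mu) (Hprob : probability_nc mu).
Hypotheses (Hnt : nontrivial_nc mu) (d0 : (0 < d)%N).
Notation W := (word d).
Notation B := (pdot mu).
Implicit Types (P Q U : ncpoly R d) (s t w : W) (l : seq (word d)).
Let hB := pdot_sesqui Hmu.

Lemma pdot11 : B 1 1 = 1.
Proof. by rewrite /pdot adj_polyL1 polyL1; exact: Hprob. Qed.

(** The coefficients of a null vector of degree [n] would be a kernel vector of
    the Toeplitz matrix at the last word of length [n], which is invertible. *)
Lemma pdot_definite P : B P P = 0 -> P = 0.
Proof.
move=> P0.
have PQ Q : B P Q = 0.
  by apply: (snorm2_eq0 hB); rewrite /snorm2 P0.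
have [n hn] := supported_words P.
rewrite -(upto_lastword d0) in hn.
set l := upto _ in hn; pose u := \row_(i < size l) mcoeff (nth emptyword l i) P.
have uK : u *m toeplitz_matrix mu (lastword d n) = 0.
  apply/rowP => j; rewrite !mxE.
  rewrite (eq_bigr (fun i : 'I_(size l) => mcoeff (nth emptyword l i) P *
    B (Zpow R (nth emptyword l i)) (Zpow R (nth emptyword l j)))); last first.
    by move=> i _; rewrite !mxE pdot_Zpow.
  apply: etrans (PQ (Zpow R (nth emptyword l j))); apply: esym.
  rewrite [X in B X _](supportedE (upto_uniq _) hn) (pdot_suml Hmu).
  rewrite (big_nth emptyword) big_mkord; apply: eq_bigr => i _.
  by rewrite (pdotZl Hmu).
have u0 : u = 0 by rewrite -[u]mulmx1 -(mulmxV (Hnt _)) mulmxA uK mul0mx.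
rewrite (supportedE (upto_uniq _) hn) big_seq big1// => t tl.
have := congr1 (fun v : 'rV_(size l) => v 0 (Ordinal (etrans (index_mem t l) tl))) u0.
by rewrite !mxE /= nth_index// => ->; rewrite scale0r.
Qed.

Lemma snorm2_gt0 P : P != 0 -> 0 < snorm2 B P.
Proof.
move=> P0; rewrite lt_def (snorm2_ge0 hB) andbT; apply: contraNneq P0 => h.
by apply/eqP/pdot_definite; rewrite (pdotPP Hmu) h.
Qed.

(** ** Gram-Schmidt *)

(** Invariant of the Gram-Schmidt fold once the words of [l] are treated. The last
    clause says that the polynomials found so far span the monomials of [l],
    in terms of orthogonal complements. *)
Definition gs_inv l (acc : seq (ncpoly R d)) :=
  [/\ uniq acc, forall U, U \in acc -> U != 0 /\ supported l U,
      forall U V, U \in acc -> V \in acc -> U != V -> B U V = 0 &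
      forall Q, (forall U, U \in acc -> B Q U = 0) -> orth mu l Q].

Definition gs_next (acc : seq (ncpoly R d)) P : ncpoly R d :=
  P - \sum_(U <- acc) (B P U / B U U) *: U.

Lemma gs_rcons (r : seq (ncpoly R d)) P : gram_schmidt mu (rcons r P) =
  rcons (gram_schmidt mu r) (gs_next (gram_schmidt mu r) P).
Proof. by rewrite /gram_schmidt foldl_rcons. Qed.

Lemma gs_next_orth l acc P V : gs_inv l acc -> V \in acc -> B (gs_next acc P) V = 0.
Proof.
move=> [ua nz oa _] Va; rewrite (pdotBl Hmu) (pdot_suml Hmu).
have VV : B V V != 0.
  by apply: contraNneq (nz _ Va).1 => h; apply/eqP/pdot_definite.
have E : B ((B P V / B V V) *: V) V = B P V by rewrite (pdotZl Hmu) divfK.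
suff -> : \sum_(U <- acc) B ((B P U / B U U) *: U) V = B P V by rewrite subrr.
rewrite (bigD1_seq V Va ua) /= -[RHS]addr0; congr (_ + _) => //.
rewrite big_seq_cond big1//.
by move=> U /andP[Ua UV]; rewrite (pdotZl Hmu) (oa U V Ua Va UV) mulr0.
Qed.

Lemma gs_step l s acc : s \notin l -> gs_inv l acc ->
  let U := gs_next acc (Zpow R s) in
  [/\ supported l (U - Zpow R s), orth mu l U & gs_inv (rcons l s) (rcons acc U)].
Proof.
move=> sl inv U; have [ua nz oa ol] := inv.
have su : supported l (U - Zpow R s).
  rewrite /U /gs_next addrAC subrr sub0r -scaleN1r; apply: supportedZ.
  by apply: supported_sum => V Va; have [] := nz V Va.
have Uo V : V \in acc -> B U V = 0 by move=> Va; exact: gs_next_orth inv Va.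
have sU : mcoeff s U = 1.
  by rewrite -[U](subrK (Zpow R s)) ncoefD su// mcoeff_Zpow eqxx add0r.
have U0 : U != 0.
  by apply: contra_eq_neq sU => ->; rewrite ncoef0 eq_sym oner_neq0.
have UU : B U U != 0 by apply: contraNneq U0 => /pdot_definite ->.
have Ua : U \notin acc by apply: contraNN UU => /Uo ->.
have lr : {subset l <= rcons l s} by move=> t tl; rewrite mem_rcons inE tl orbT.
have suU : supported (rcons l s) U.
  rewrite -[U](subrK (Zpow R s)); apply: supportedD.
    exact: supported_sub su.
  by apply: supported_Zpow; rewrite mem_rcons mem_head.
split=> //; first exact: ol.
split.
- by rewrite rcons_uniq Ua.
- move=> V; rewrite mem_rcons inE => /orP[/eqP ->//|Va].
  by have [V0 sV] := nz V Va; split=> //; exact: supported_sub sV.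
- move=> V V'; rewrite !mem_rcons !inE => /orP[/eqP ->|Va] /orP[/eqP ->|Va'].
  + by rewrite eqxx.
  + by move=> _; exact: Uo.
  + by move=> _; rewrite (pdotC Hmu U) Uo// conjC0.
  + exact: oa.
- move=> Q hQ; have oQ : orth mu l Q.
    by apply: ol => V Va; apply: hQ; rewrite mem_rcons inE Va orbT.
  move=> t; rewrite mem_rcons inE => /orP[/eqP ->|]; last exact: oQ.
  have -> : Zpow R s = U - (U - Zpow R s) by rewrite subKr.
  rewrite (pdotBr Hmu) hQ ?mem_rcons ?mem_head// sub0r.
  (* What is left pairs [Q] with the polynomials found before [U]. *)
  rewrite /U /gs_next addrAC subrr sub0r (sesqNr hB _ Q) opprK (pdot_sumr Hmu).
  rewrite big_seq big1// => V Va; rewrite (pdotZr Hmu) hQ ?mulr0//.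
  by rewrite mem_rcons inE Va orbT.
Qed.

Lemma gs_words l : uniq l -> gs_inv l (gram_schmidt mu [seq Zpow R t | t <- l]).
Proof.
elim/last_ind: l => [|l s IH]; first by move=> _; split.
rewrite rcons_uniq => /andP[sl ul]; rewrite map_rcons gs_rcons.
by have [] := gs_step sl (IH ul).
Qed.

Lemma Phi_spec s :
  supported (before s) (Phi mu s - Zpow R s) /\ orth mu (before s) (Phi mu s).
Proof.
rewrite /Phi /upto map_rcons gs_rcons last_rcons.
have sb : s \notin before s by rewrite mem_before shortlex_irr.
by have [] := gs_step sb (gs_words (before_uniq s)).
Qed.

(** By definiteness, monicity and orthogonality determine [Phi]; later
    computations of [Phi] exhibit a polynomial with these two properties. *)
Lemma Phi_unique s P :
  supported (before s) (P - Zpow R s) -> orth mu (before s) P -> Phi mu s = P.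
Proof.
move=> sP oP; have [sF oF] := Phi_spec s.
have sD : supported (before s) (Phi mu s - P).
  by rewrite -(subrKA (Zpow R s)) -[Zpow R s - P]opprB; apply: supportedB.
apply/eqP; rewrite -subr_eq0; apply/eqP/pdot_definite.
apply: (orth_supported Hmu (before_uniq s)) sD.
by rewrite addrC -scaleN1r; apply: orth_lin.
Qed.

Lemma Phi_monic s : mcoeff s (Phi mu s) = 1.
Proof.
rewrite -[Phi mu s](subrK (Zpow R s)) ncoefD (Phi_spec s).1.
  by rewrite mcoeff_Zpow eqxx add0r.
by rewrite mem_before shortlex_irr.
Qed.

Lemma Phi_neq0 s : Phi mu s != 0.
Proof.
by apply: contra_eq_neq (Phi_monic s) => ->; rewrite ncoef0 eq_sym oner_neq0.
Qed.

Lemma pnormPhi_gt0 s : 0 < pnorm mu (Phi mu s).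
Proof.
rewrite -(@ltr_pXn2r _ 2) ?nnegrE ?sqrtr_ge0//.
by rewrite expr0n pnorm2//; exact/snorm2_gt0/Phi_neq0.
Qed.

Lemma before_upto s : {subset before s <= upto s}.
Proof. by move=> t ts; rewrite mem_rcons inE ts orbT. Qed.

Lemma s_in_upto s : s \in upto s.
Proof. by rewrite mem_rcons mem_head. Qed.

Lemma Phi_supported s : supported (upto s) (Phi mu s).
Proof.
rewrite -[Phi mu s](subrK (Zpow R s)); apply: supportedD.
  exact: supported_sub (@before_upto s) (Phi_spec s).1.
exact/supported_Zpow/s_in_upto.
Qed.

Lemma phi_supported s : supported (upto s) (phi mu s).
Proof. exact/supportedZ/Phi_supported. Qed.

Lemma phi_orth s : orth mu (before s) (phi mu s).
Proof. exact/orthZ/(Phi_spec s).2. Qed.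

Lemma Phi_phi s : Phi mu s = (pnorm mu (Phi mu s))%:C *: phi mu s.
Proof.
by rewrite /phi scalerA -rmorphM divff ?scale1r// gt_eqF// pnormPhi_gt0.
Qed.

Lemma phi_norm s : B (phi mu s) (phi mu s) = 1.
Proof.
rewrite (pdotPP Hmu) (snorm2_pdotZ Hmu) modcR ger0_norm ?invr_ge0 ?sqrtr_ge0//.
by rewrite -pnorm2// exprVn mulVf// gt_eqF// exprn_gt0// pnormPhi_gt0.
Qed.

Lemma leading_coefE s : leading_coef mu s = (pnorm mu (Phi mu s))^-1%:C.
Proof. by rewrite /leading_coef ncoefZ Phi_monic mulr1. Qed.

Lemma phi_orthonormal s t : B (phi mu s) (phi mu t) = (s == t)%:R.
Proof.
have lt u v : shortlex u v -> B (phi mu v) (phi mu u) = 0.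
  move=> uv; suff o : orth mu (upto u) (phi mu v).
    have h := @phi_supported u; exact: (orth_supported Hmu (upto_uniq u) o h).
  move=> w; rewrite mem_upto => wu; apply: phi_orth; rewrite mem_before.
  by case/orP: wu => [/eqP -> //|wu]; exact: shortlex_trans wu uv.
have := shortlex_total s t; case: eqVneq => [->|_] /=; first by rewrite phi_norm.
by case/orP => [/lt h|/lt //]; rewrite (pdotC Hmu (phi mu t)) h conjC0.
Qed.

(** The difference is orthogonal to each [phi mu t], hence, by induction along
    the order, to each monomial, hence to itself. *)
Lemma phi_expansion s P : supported (upto s) P ->
  P = \sum_(t <- upto s) B P (phi mu t) *: phi mu t.
Proof.
move=> sP; set S := \sum_(_ <- _) _.
have sS : supported (upto s) S.
  apply: supported_sum => t ts.
  by apply: supported_sub (@phi_supported t); exact: upto_sub.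
have oD t : t \in upto s -> B (P - S) (phi mu t) = 0.
  move=> ts; rewrite (pdotBl Hmu) (pdot_suml Hmu).
  have E w : B (B P (phi mu w) *: phi mu w) (phi mu t)
      = if w == t then B P (phi mu t) else 0.
    rewrite (pdotZl Hmu) phi_orthonormal.
    by case: eqP => [->|_]; [exact: mulr1|exact: mulr0].
  rewrite (eq_bigr _ (fun w _ => E w)) (bigD1_seq t ts (upto_uniq s)) /= eqxx.
  rewrite big1; last by move=> w /negbTE ->.
  by rewrite addr0 subrr.
have oZ t : t \in upto s -> B (P - S) (Zpow R t) = 0.
  elim/shortlex_ind: t => t IH ts.
  have -> : Zpow R t = Phi mu t - (Phi mu t - Zpow R t) by rewrite subKr.
  rewrite (pdotBr Hmu).
  have -> : B (P - S) (Phi mu t) = 0.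
    by rewrite Phi_phi (pdotZr Hmu) oD// mulr0.
  rewrite sub0r; apply/eqP; rewrite oppr_eq0; apply/eqP.
  suff o : orth mu (before t) (P - S).
    exact: (orth_supported Hmu (before_uniq t) o (Phi_spec t).1).
  move=> w; rewrite mem_before => wt; apply: IH => //; move: ts; rewrite !mem_upto.
  by case/orP => [/eqP <-|ts]; rewrite ?wt ?orbT// (shortlex_trans wt ts) orbT.
apply/eqP; rewrite -subr_eq0; apply/eqP/pdot_definite.
have sD := supportedB sP sS.
exact: (orth_supported Hmu (upto_uniq s) oZ sD).
Qed.

End OrthogonalPolynomials.

(** * Reverse polynomials and Verblunsky coefficients *)

Section ReversePolynomials.
Variables (R : realType) (d : nat) (mu : hop R d -> R[i]).
Hypotheses (Hmu : nc_measure mu) (Hprob : probability_nc mu).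
Hypotheses (Hnt : nontrivial_nc mu) (d0 : (0 < d)%N).
Notation W := (word d).
Notation B := (pdot mu).
Implicit Types (P Q U : ncpoly R d) (s t w : W) (l : seq (word d)).

Lemma orth_projE l P Z : uniq l -> supported l Z -> orth mu l (P - Z) ->
  orth_proj mu l P = Z.
Proof.
move=> ul sZ oZ; rewrite /orth_proj; set S := [set U | _].
have SZ : S Z.
  split; first exact: in_spanP.
  move=> V /in_span_supported sV; exact: (orth_supported Hmu ul oZ sV).
case: xgetP => [U _ [/in_span_supported sU oU]|/(_ Z)] //.
apply/eqP; rewrite -subr_eq0; apply/eqP/(pdot_definite Hmu Hnt d0).
have sD := supportedB sU sZ.
have -> : B (U - Z) (U - Z) = B (P - Z) (U - Z) - B (P - U) (U - Z).
  by rewrite -(pdotBl Hmu) opprB [P - Z + _]addrC addrA subrK.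
rewrite (orth_supported Hmu ul oZ sD) oU ?subrr//; exact: in_spanP.
Qed.

Lemma pnormZ (a : R) P : 0 <= a -> pnorm mu (a%:C *: P) = a * pnorm mu P.
Proof.
move=> a0; rewrite /pnorm -[complex.Re _]/(snorm2 B _) (snorm2_pdotZ Hmu).
by rewrite modcR sqrtrM ?sqr_ge0// sqrtr_sqr normr_id ger0_norm.
Qed.

Lemma pnorm_unit P : B P P = 1 -> pnorm mu P = 1.
Proof. by move=> h; rewrite /pnorm h sqrtr1. Qed.

Definition nonnil (l : seq W) := [seq t <- l | t != emptyword].

(** The unit vector [e] in the span of the words up to [s] that is orthogonal to
    the nonempty ones, so that it is proportional to the residual of 1 modulo
    them; the positive number [c = e(0)] fixes its phase. *)
Definition sharp_ok s (c : R) e :=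
  [/\ supported (upto s) e, orth mu (nonnil (upto s)) e, B e e = 1,
      const_coef e = c%:C & 0 < c].

Section Step.
Variables (k : 'I_d) (s : W) (c : R) (e : ncpoly R d).
Let ks := wcons k s.
Hypothesis He : sharp_ok (wpred ks) c e.

Let N := nonnil (before ks).
Let X := lmul k (phi mu s).
Let a := pnorm mu (Phi mu s).
Let g := B X e.

Let ks0 : ks != emptyword. Proof. by []. Qed.

Let uN : uniq N. Proof. exact/filter_uniq/before_uniq. Qed.

Let a0 : 0 < a. Proof. exact: pnormPhi_gt0. Qed.

Let aX : a%:C *: X = lmul k (Phi mu s).
Proof. by rewrite -lmulZ -(Phi_phi Hmu Hnt d0). Qed.

Let se : supported (before ks) e.
Proof. by have [h _ _ _ _] := He; rewrite -(upto_wpred ks0). Qed.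

Let oe : orth mu N e.
Proof. by have [_ h _ _ _] := He; rewrite /N -(upto_wpred ks0). Qed.

Let ee : B e e = 1. Proof. by have [] := He. Qed.

Let e0 : const_coef e = c%:C. Proof. by have [] := He. Qed.

Let c0 : 0 < c. Proof. by have [] := He. Qed.

Let mem_N j t : (wcons j t \in N) = shortlex (wcons j t) ks.
Proof. by rewrite mem_filter mem_before. Qed.

Let N_nil : emptyword \notin N.
Proof. by rewrite mem_filter eqxx. Qed.

Let N_before : {subset N <= before ks}.
Proof. by move=> t; rewrite mem_filter => /andP[]. Qed.

Let sX : supported N (Zpow R ks - lmul k (Phi mu s)).
Proof.
elim/wordP => [_|j t _]; rewrite ncoefB mcoeff_Zpow.
  by rewrite mcoeff0_lmul subr0.
rewrite mem_N mcoeff_lmul.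
have -> : (ks == wcons j t) = (k == j) && (s == t) by exact: eqseq_cons.
rewrite (eq_sym k); have [->|_] := eqVneq j k; last by rewrite mul0r subr0.
rewrite shortlex_wcons mul1r => ts.
have := (Phi_spec Hmu Hnt d0 s).1 t; rewrite mem_before => /(_ ts).
by rewrite ncoefB mcoeff_Zpow => /eqP; rewrite subr_eq0 => /eqP ->; rewrite subrr.
Qed.

Let oX : orth mu N X.
Proof.
elim/wordP => [|j t _]; first by rewrite (negbTE N_nil).
rewrite mem_N -lmul_Zpow pdot_lmul// => ts.
have [kj|_] := eqVneq k j; last by rewrite mul0r.
rewrite phi_orth ?mulr0// mem_before; by move: ts; rewrite -kj shortlex_wcons.
Qed.

Let XX : B X X = 1.
Proof. by rewrite /X pdot_lmul// eqxx mul1r phi_norm. Qed.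

Let eX : B e X = g^*.
Proof. exact: pdotC. Qed.

(** The row isometry makes [X = Z_k phi_s] orthogonal to the nonempty words before
    [k s], like [e]. Hence the residuals of [Z^(k s)] and of 1 modulo these words
    are positive multiples of the unit vectors [X] and [e]. *)
Lemma verblunskyE : verblunsky mu ks = g.
Proof.
pose f U V := B U V / (pnorm mu U * pnorm mu V)%:C.
have -> : verblunsky mu ks = f (Zpow R ks - orth_proj mu N (Zpow R ks))
    (Zpow R emptyword - orth_proj mu N (Zpow R emptyword)).
  by rewrite /verblunsky (negbTE ks0).
have oXa : orth mu N (a%:C *: X) by exact: orthZ.
have p1 : orth_proj mu N (Zpow R ks) = Zpow R ks - lmul k (Phi mu s).
  by apply: (orth_projE uN sX); rewrite subKr -aX; exact: oXa.
have n1 : pnorm mu (a%:C *: X) = a.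
  by rewrite (pnormZ _ (ltW a0)) (pnorm_unit XX) mulr1.
have ci0 : 0 <= c^-1 by rewrite invr_ge0 ltW.
have n2 : pnorm mu (c^-1%:C *: e) = c^-1.
  by rewrite (pnormZ _ ci0) (pnorm_unit ee) mulr1.
have oec : orth mu N (c^-1%:C *: e) by exact: orthZ.
have p2 : orth_proj mu N (Zpow R emptyword) =
    Zpow R emptyword - c^-1%:C *: e.
  apply: (orth_projE uN); last by rewrite subKr; exact: oec.
  elim/wordP => [_|j t _]; rewrite ncoefB mcoeff_Zpow ncoefZ.
    by rewrite [mcoeff _ e]e0 -rmorphM mulVf ?gt_eqF// subrr.
  by rewrite mem_N => ts; rewrite se ?mulr0 ?subrr// mem_before.
have -> : f (Zpow R ks - orth_proj mu N (Zpow R ks))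
    (Zpow R emptyword - orth_proj mu N (Zpow R emptyword)) =
    f (a%:C *: X) (c^-1%:C *: e).
  by congr (f _ _); [rewrite p1 subKr aX|rewrite p2 subKr].
have fE U V u v : pnorm mu U = u -> pnorm mu V = v ->
    f U V = B U V / (u * v)%:C by move=> <- <-.
rewrite (fE _ _ _ _ n1 n2) (pdotZl Hmu) (pdotZr Hmu) conjR -/g.
rewrite mulrA -rmorphM mulrAC divff ?mul1r//.
by rewrite fmorph_eq0 mulf_neq0// ?invr_eq0 gt_eqF.
Qed.

Let Y := X - g *: e.

Let Ye : B Y e = 0.
Proof. by rewrite (pdotBl Hmu) (pdotZl Hmu) ee mulr1 subrr. Qed.

Let oY : orth mu (before ks) Y.
Proof.
(* Orthogonality to the empty word follows from orthogonality to [e], which is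
   [c] plus a combination of nonempty words. *)
elim/wordP => [_|j t _].
  have sr : supported N (e - c%:C *: Zpow R emptyword).
    elim/wordP => [_|j t _]; rewrite ncoefB ncoefZ mcoeff_Zpow.
      by rewrite mulr1 [mcoeff _ e]e0 subrr.
    by rewrite mem_N => ts; rewrite se ?mulr0 ?subrr// mem_before.
  have oYN : orth mu N Y.
    by rewrite /Y addrC -scaleNr; apply: (orth_lin Hmu _ oe oX).
  have := orth_supported Hmu uN oYN sr.
  rewrite (pdotBr Hmu) Ye (pdotZr Hmu) conjR sub0r => /eqP.
  rewrite oppr_eq0 mulf_eq0 => /orP[/eqP/complexI cz|/eqP //].
  by case/negP: (lt0r_neq0 c0); apply/eqP; exact: cz.
rewrite mem_before -mem_N => tN.
by rewrite (pdotBl Hmu) (pdotZl Hmu) oX// oe// mulr0 subr0.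
Qed.

Let PhiE : Phi mu ks = a%:C *: Y.
Proof.
apply: (Phi_unique Hmu Hnt d0); last exact: (orthZ Hmu _ oY).
have -> : a%:C *: Y - Zpow R ks =
    (-1) *: (Zpow R ks - lmul k (Phi mu s)) + (- (a%:C * g)) *: e.
  by rewrite scalerBr aX scalerA scaleN1r opprB scaleNr addrAC.
apply: supported_lin; last exact: supportedZ.
exact: supported_sub N_before sX.
Qed.

Let YY : snorm2 B Y = 1 - modc g ^+ 2.
Proof.
rewrite /snorm2 {2}/Y (pdotBr Hmu) (pdotZr Hmu) Ye mulr0 subr0.
rewrite (pdotBl Hmu) (pdotZl Hmu) XX eX mulcJ.
by rewrite cReD cReN.
Qed.

(** Removing from [X] its component along [e] gives the next monic orthogonal
    polynomial up to scaling; the squared norm drops by the factor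
    [1 - |g|^2]. *)
Lemma pnormPhi_step :
  pnorm mu (Phi mu ks) ^+ 2 = pnorm mu (Phi mu s) ^+ 2 * defect mu ks.
Proof.
rewrite PhiE pnormZ ?ltW// exprMn; congr (_ * _).
by rewrite pnorm2// YY /defect verblunskyE.
Qed.

Lemma defect_step_gt0 : 0 < defect mu ks.
Proof.
have := pnormPhi_gt0 Hmu Hnt d0 ks.
rewrite -(@ltr_pXn2r _ 2) ?nnegrE ?sqrtr_ge0// expr0n pnormPhi_step.
by rewrite pmulr_rgt0// exprn_gt0.
Qed.

Let E := e - g^* *: X.

(** Symmetrically, removing from [e] its component along [X] gives the next
    reverse polynomial; as [X] has no constant term, [e(0)] only changes through
    the normalisation. *)
Lemma sharp_step : sharp_ok ks (c / Num.sqrt (defect mu ks))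
  ((Num.sqrt (defect mu ks))^-1%:C *: E).
Proof.
set r := Num.sqrt _; have r0 : 0 < r by rewrite sqrtr_gt0 defect_step_gt0.
have EX : B E X = 0.
  by rewrite (pdotBl Hmu) (pdotZl Hmu) XX eX mulr1 subrr.
have sXu : supported (upto ks) X.
  have -> : X = a^-1%:C *: lmul k (Phi mu s).
    by rewrite -aX scalerA -rmorphM mulVf ?scale1r// gt_eqF.
  apply: supportedZ; rewrite -[lmul k _](subKr (Zpow R ks)).
  apply: supportedB; first exact/supported_Zpow/s_in_upto.
  apply: supported_sub sX => t /N_before; exact: before_upto.
split.
- apply/supportedZ/supportedB; last exact: supportedZ.
  exact: supported_sub (@before_upto _ ks) se.
- suff oE : orth mu (nonnil (upto ks)) E by exact: orthZ.
  move=> t; rewrite mem_filter mem_rcons inE => /andP[t0].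
  case/orP => [/eqP ->|tb].
    have -> : Zpow R ks = (Zpow R ks - lmul k (Phi mu s)) + a%:C *: X.
      by rewrite aX subrK.
    rewrite (pdotDr Hmu) (pdotZr Hmu) EX mulr0 addr0.
    have oEN : orth mu N E.
      by rewrite /E addrC -scaleNr; apply: (orth_lin Hmu _ oX oe).
    exact: (orth_supported Hmu uN oEN sX).
  have tN : t \in N by rewrite mem_filter t0.
  by rewrite (pdotBl Hmu) (pdotZl Hmu) oe// oX// mulr0 subr0.
- rewrite (pdotPP Hmu) (snorm2_pdotZ Hmu) modcR ger0_norm ?invr_ge0 ?ltW//.
  have -> : snorm2 B E = defect mu ks.
    rewrite /snorm2 {2}/E (pdotBr Hmu) (pdotZr Hmu) EX mulr0 subr0.
    rewrite (pdotBl Hmu) (pdotZl Hmu) ee mulrC mulcJ.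
    by rewrite cReD cReN /defect verblunskyE.
  rewrite exprVn sqr_sqrtr ?mulVf// ?gt_eqF// ?ltW//; exact: defect_step_gt0.
- rewrite /const_coef ncoefZ ncoefB ncoefZ mcoeff0_lmul mulr0 subr0.
  by rewrite [mcoeff _ e]e0 -rmorphM mulrC.
- by rewrite divr_gt0.
Qed.

End Step.

Lemma defect_empty : defect mu emptyword = 1.
Proof. by rewrite /defect /verblunsky eqxx Normc.normc0 expr0n subr0. Qed.

Lemma phi_sharp_ok s : 0 < \prod_(t <- upto s) defect mu t /\
  sharp_ok s (Num.sqrt (\prod_(t <- upto s) defect mu t))^-1 (phi_sharp mu s).
Proof.
elim/shortlex_ind: s; elim/wordP => [_|k s _ IH].
  rewrite upto_empty big_seq1 defect_empty sqrtr1 invr1; split=> //.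
  split; rewrite ?phi_sharp_empty ?upto_empty //.
  - by rewrite -Zpow_empty; apply: supported_Zpow; rewrite mem_head.
  - exact: pdot11 Hprob.
  - by rewrite /const_coef -Zpow_empty mcoeff_Zpow eqxx.
set ks := wcons k s; have ks0 : ks != emptyword by [].
have lt : shortlex (wpred ks) ks.
  by rewrite -mem_before -(upto_wpred ks0) s_in_upto.
have [p0 ok] := IH _ lt.
rewrite /upto big_rcons -(upto_wpred ks0) /=.
have dk := defect_step_gt0 ok; split; first by rewrite mulr_gt0.
rewrite -[phi_sharp mu ks]/(phi_sharp mu (FMonom (k :: (s : seq _)))).
rewrite phi_sharpE lmulE.
have h := sharp_step ok; rewrite -/ks (verblunskyE ok).
have -> : (Num.sqrt (\prod_(j <- upto (wpred ks)) defect mu j * defect mu ks))^-1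
  = (Num.sqrt (\prod_(j <- upto (wpred ks)) defect mu j))^-1
    / Num.sqrt (defect mu ks) by rewrite sqrtrM ?ltW// invfM.
by rewrite scaleNr [- _ + phi_sharp _ _]addrC; exact: h.
Qed.

Lemma defect_gt0 s : 0 < defect mu s.
Proof.
elim/wordP: s => [|k s _]; first by rewrite defect_empty ltr01.
by have [_ ok] := phi_sharp_ok (wpred (wcons k s)); exact: defect_step_gt0 ok.
Qed.

Lemma defect_le1 s : defect mu s <= 1.
Proof. by rewrite /defect lerBlDr lerDl sqr_ge0. Qed.

Lemma pnormPhiS k s : pnorm mu (Phi mu (wcons k s)) ^+ 2 =
  pnorm mu (Phi mu s) ^+ 2 * defect mu (wcons k s).
Proof.
by have [_ ok] := phi_sharp_ok (wpred (wcons k s)); exact: pnormPhi_step ok.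
Qed.

Section Kernel.
Variables (s : W) (c : R) (e : ncpoly R d).
Hypothesis He : sharp_ok s c e.

Lemma supported_nonnil P : supported (upto s) P -> const_coef P = 0 ->
  supported (nonnil (upto s)) P.
Proof.
move=> sP P0 t; rewrite mem_filter negb_and negbK => /orP[/eqP ->//|].
exact: sP.
Qed.

Lemma orth_nonnil P Q : orth mu (nonnil (upto s)) P ->
  supported (upto s) Q -> const_coef Q = 0 -> B P Q = 0.
Proof.
move=> oP sQ Q0; have sN := supported_nonnil sQ Q0.
exact: (orth_supported Hmu (filter_uniq _ (upto_uniq s)) oP sN).
Qed.

(** Subtracting from [P] the multiple of [e] with the same constant coefficient
    leaves a combination of nonempty words, to which [e] is orthogonal. *)
Lemma sharp_eval P : supported (upto s) P -> B P e = const_coef P / c%:C.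
Proof.
have [se oe ee e0 c0] := He; move=> sP.
have cn0 : c%:C != 0 by rewrite fmorph_eq0 gt_eqF.
set x := _ / _; have sD : supported (upto s) (P - x *: e).
  by apply: supportedB => //; exact: supportedZ.
have D0 : const_coef (P - x *: e) = 0.
  by rewrite /const_coef ncoefB ncoefZ -/(const_coef e) e0 divfK// subrr.
have := orth_nonnil oe sD D0.
rewrite (pdotBr Hmu) (pdotZr Hmu) ee mulr1 => /eqP; rewrite subr_eq0 => /eqP h.
by rewrite (pdotC Hmu e) h conjK.
Qed.

Let sphi t : t \in upto s -> supported (upto s) (phi mu t).
Proof.
by move=> ts; apply: supported_sub (@phi_supported _ _ _ Hmu Hnt d0 t); exact: upto_sub.
Qed.

(** As [e] represents evaluation at the origin, its coordinates in the orthonormal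
    basis are the conjugated values of that basis at the origin, divided by [c]. *)
Lemma sharp_sum : \sum_(t <- upto s) (const_coef (phi mu t))^* *: phi mu t = c%:C *: e.
Proof.
have [se oe ee e0 c0] := He.
have cn0 : c%:C != 0 :> R[i] by rewrite fmorph_eq0 gt_eqF.
have sce : supported (upto s) (c%:C *: e) by exact: (supportedZ _ se).
rewrite [RHS](phi_expansion Hmu Hnt d0 sce) [LHS]big_seq [RHS]big_seq.
apply: eq_bigr => t ts; apply: (congr1 (fun x => x *: phi mu t)).
rewrite (pdotZl Hmu) (pdotC Hmu (phi mu t)) (sharp_eval (sphi ts)).
by rewrite conjM -fmorphV conjR mulrCA fmorphV divff// mulr1.
Qed.

(** Parseval identity for [e], whose coordinates are the values of the
    orthonormal polynomials at the origin divided by [c]. *)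
Lemma sharp_sum2 : \sum_(t <- upto s) modc (const_coef (phi mu t)) ^+ 2 = c ^+ 2.
Proof.
have [se oe ee e0 c0] := He.
have c2 : c ^+ 2 != 0 by rewrite expf_neq0// gt_eqF.
suff : \sum_(t <- upto s) modc (const_coef (phi mu t)) ^+ 2 / c ^+ 2 = 1.
  by rewrite -mulr_suml => /(canRL (divfK c2)); rewrite mul1r.
apply: complexI; rewrite -[RHS]ee [X in _ = B X e](phi_expansion Hmu Hnt d0 se).
rewrite (pdot_suml Hmu) (rmorph_sum (real_complex R)).
rewrite big_seq [RHS]big_seq; apply: eq_bigr => t ts.
rewrite (pdotZl Hmu) (pdotC Hmu (phi mu t)) (sharp_eval (sphi ts)).
rewrite [RHS]mulrC mulcJ modcM -fmorphV modcR normfV (gtr0_norm c0).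
by rewrite exprMn exprVn.
Qed.

(** Cauchy-Schwarz against the representing vector [e]. *)
Lemma sharp_extremal Q : supported (upto s) Q -> const_coef Q = 1 ->
  c ^- 2 <= snorm2 B Q.
Proof.
have [se oe ee e0 c0] := He; move=> sQ Q1.
have := sesq_CS (pdot_sesqui Hmu) Q e.
have -> : snorm2 B e = 1 by rewrite /snorm2 ee.
by rewrite sharp_eval// Q1 mul1r -fmorphV modcR mulr1 real_normK ?num_real// exprVn.
Qed.

End Kernel.

Lemma ChristoffelE n :
  Christoffel mu n = \prod_(t <- upto (lastword d n)) defect mu t.
Proof.
have [p0 ok] := phi_sharp_ok (lastword d n).
by rewrite /Christoffel (sharp_sum2 ok) exprVn invrK sqr_sqrtr// ltW.
Qed.

Lemma Christoffel_gt0 n : 0 < Christoffel mu n.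
Proof. by rewrite ChristoffelE; have [] := phi_sharp_ok (lastword d n). Qed.

Lemma phi_sharp_const n :
  modc (const_coef (phi_sharp mu (lastword d n))) ^- 2 = Christoffel mu n.
Proof.
have [p0 [_ _ _ -> c0]] := phi_sharp_ok (lastword d n).
by rewrite ChristoffelE modcR (ger0_norm (ltW c0)) exprVn invrK sqr_sqrtr// ltW.
Qed.

Lemma Christoffel_min n Q : supported (words_upto d n) Q -> const_coef Q = 1 ->
  Christoffel mu n <= snorm2 B Q.
Proof.
rewrite -(upto_lastword d0) => sQ Q1; have [p0 ok] := phi_sharp_ok (lastword d n).
apply: le_trans (sharp_extremal ok sQ Q1).
by rewrite ChristoffelE exprVn invrK sqr_sqrtr// ltW.
Qed.

(** The minimiser is [e] rescaled to have value 1 at the origin. *)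
Lemma minimiser_spec n : let q := minimiser mu n in
  [/\ supported (words_upto d n) q, orth mu (nonnil (words_upto d n)) q,
      const_coef q = 1 & snorm2 B q = Christoffel mu n].
Proof.
have [p0 ok] := phi_sharp_ok (lastword d n); move=> q.
set c := _^-1 in ok; set e := phi_sharp _ _ in ok.
have [se oe ee e0 c0] := ok.
have CE : Christoffel mu n = c^-1 ^+ 2.
  by rewrite ChristoffelE /c invrK sqr_sqrtr// ltW.
have qE : q = c^-1%:C *: e.
  have E : (Christoffel mu n)%:C * c%:C = c^-1%:C.
    by rewrite -rmorphM CE expr2 mulfVK// gt_eqF.
  rewrite /q /minimiser (sharp_sum ok) scalerA.
  exact: (congr1 (fun x => x *: e) E).
rewrite -(upto_lastword d0) qE; split.
- exact: supportedZ.
- exact: orthZ.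
- have cc : c^-1 * c = 1 by apply: mulVf; rewrite gt_eqF.
  have E : c^-1%:C * c%:C = 1 by rewrite -rmorphM cc rmorph1.
  exact: etrans (ncoefZ emptyword _ e) (etrans (congr1 _ e0) E).
- by rewrite (snorm2_pdotZ Hmu) /snorm2 ee mulr1 modcR real_normK ?num_real// CE.
Qed.

(** ** Gram determinants *)

Lemma Phi_orthogonal s t : B (Phi mu s) (Phi mu t) =
  if s == t then (pnorm mu (Phi mu s) ^+ 2)%:C else 0.
Proof.
case: eqVneq => [->|/negbTE st]; first by rewrite (pdotPP Hmu) pnorm2.
have h := phi_orthonormal Hmu Hnt d0 s t; rewrite st in h.
rewrite [X in B X _](Phi_phi Hmu Hnt d0) [X in B _ X](Phi_phi Hmu Hnt d0).
by rewrite (pdotZl Hmu) (pdotZr Hmu) h !mulr0.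
Qed.

(** The Gram matrix of the monomials is congruent, through the unitriangular
    matrix of the coefficients of the [Phi]'s, to a diagonal matrix. *)
Lemma toeplitz_detE s :
  toeplitz_det mu s = (\prod_(t <- upto s) pnorm mu (Phi mu t) ^+ 2)%:C.
Proof.
rewrite /toeplitz_det; set l := upto s; set K := toeplitz_matrix mu s.
pose w (i : 'I_(size l)) := nth emptyword l i.
have wl i : w i \in l by exact: mem_nth.
have lt (i j : 'I_(size l)) : (i < j)%N -> shortlex (w i) (w j).
  move=> ij; have := upto_sorted s; rewrite sorted_pairwise; last exact: shortlex_trans.
  by move=> /(pairwiseP emptyword); apply; rewrite ?inE.
pose M : 'M[R[i]]_(size l) := \matrix_(i, j) mcoeff (w j) (Phi mu (w i)).
pose M' : 'M[R[i]]_(size l) := (map_mx Num.conj M)^T.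
have sPhi i : supported l (Phi mu (w i)).
  by apply: supported_sub (@Phi_supported _ _ _ Hmu Hnt d0 (w i)); exact: upto_sub.
have PhiE i : Phi mu (w i) = \sum_(j < size l) M i j *: Zpow R (w j).
  rewrite [LHS](supportedE (upto_uniq s) (sPhi i)) (big_nth emptyword) big_mkord.
  by apply: eq_bigr => j _; rewrite mxE.
have Mtrig : is_trig_mx M.
  apply/is_trig_mxP => i j ij; rewrite mxE.
  rewrite (@Phi_supported _ _ _ Hmu Hnt d0 (w i))// mem_upto.
  rewrite (shortlex_asym (lt i j ij)) orbF; apply/eqP => e.
  by have := lt i j ij; rewrite e shortlex_irr.
have dM : \det M = 1.
  rewrite det_trig// big1// => i _; rewrite mxE; exact: (Phi_monic Hmu Hnt d0).
have dM' : \det M' = 1 by rewrite det_tr det_map_mx dM rmorph1.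
have D : M *m K *m M' = diag_mx (\row_i (pnorm mu (Phi mu (w i)) ^+ 2)%:C).
  apply/matrixP => i j; rewrite !mxE.
  transitivity (B (Phi mu (w i)) (Phi mu (w j))).
    rewrite [X in B _ X]PhiE (pdot_sumr Hmu); apply: eq_bigr => m _.
    rewrite (pdotZr Hmu) mulrC !mxE; congr (_ * _).
    rewrite [X in B X _]PhiE (pdot_suml Hmu); apply: eq_bigr => n _.
    by rewrite (pdotZl Hmu) !mxE pdot_Zpow.
  rewrite Phi_orthogonal.
  have -> : (w i == w j) = (i == j) by rewrite nth_uniq// upto_uniq.
  by case: eqP => [->|_]; rewrite ?mulr1n ?mulr0n.
have := congr1 determinant D.
rewrite !det_mulmx dM dM' mul1r mulr1 det_diag => ->.
rewrite (big_nth emptyword) big_mkord (rmorph_prod (real_complex R)).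
by apply: eq_bigr => i _; rewrite mxE.
Qed.

Lemma toeplitz_det_ratio s : s != emptyword ->
  toeplitz_det mu s / toeplitz_det mu (wpred s) = (pnorm mu (Phi mu s) ^+ 2)%:C.
Proof.
move=> s0; rewrite !toeplitz_detE {1}/upto big_rcons -(upto_wpred s0) /=.
rewrite -fmorphV -rmorphM /= mulrAC divff ?mul1r//.
rewrite gt_eqF//; apply: prodr_gt0 => t _; apply: exprn_gt0.
exact: (pnormPhi_gt0 Hmu Hnt d0).
Qed.

End ReversePolynomials.

(** * Bernstein-Szego approximation *)

Section BackwardShift.
Variables (R : realType) (d : nat).
Notation W := (word d).
Implicit Types (P Q : ncpoly R d) (s t w : W).

Definition bshift_word (j : 'I_d) s : ncpoly R d :=
  if (s : seq _) is k :: t then if k == j then Zpow R (FMonom t) else 0 else 0.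

Definition bshift j P : ncpoly R d := mext (bshift_word j) P.

Lemma mcoeff_bshift j P t : mcoeff t (bshift j P) = mcoeff (wcons j t) P.
Proof.
rewrite /bshift /mext ncoef_sum.
have E s : mcoeff t (mcoeff s P *: bshift_word j s) =
    mcoeff s P * (s == wcons j t)%:R.
  rewrite ncoefZ; congr (_ * _).
  elim/wordP: s => [|k s _]; first by rewrite [LHS]ncoef0.
  have -> : (wcons k s == wcons j t) = (k == j) && (s == t) by exact: eqseq_cons.
  rewrite /bshift_word /=; case: (k == j); last exact: ncoef0.
  by rewrite mcoeff_Zpow; case: s.
rewrite (eq_bigr _ (fun s _ => E s)).
have [sP|sP] := boolP (wcons j t \in msupp P).
  rewrite (big_fsetD1 _ sP) /= eqxx mulr1 big1_fset ?addr0// => s.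
  by rewrite !inE => /andP[/negbTE ts _] _; rewrite ts mulr0.
rewrite [RHS]mcoeff_outdom// big1_fset// => s tP _.
by rewrite eq_sym (negbTE (memPnC sP s tP)) mulr0.
Qed.

Lemma bshift_decomp P : const_coef P = 0 -> P = \sum_j lmul j (bshift j P).
Proof.
move=> P0; apply/malgP => w; rewrite ncoef_sum.
elim/wordP: w => [|k t _].
  by rewrite big1 => [|j _]; [exact: P0 | exact: mcoeff0_lmul].
have E j : mcoeff (wcons k t) (lmul j (bshift j P)) =
    if j == k then mcoeff (wcons k t) P else 0.
  rewrite mcoeff_lmul mcoeff_bshift eq_sym.
  by case: eqP => [->|_]; rewrite ?mul1r ?mul0r.
by rewrite (eq_bigr _ (fun j _ => E j)) -big_mkcond big_pred1_eq.
Qed.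

End BackwardShift.

Section BernsteinSzego.
Variables (R : realType) (d : nat) (mu : hop R d -> R[i]).
Hypothesis Hmu : nc_measure mu.
Notation W := (word d).
Notation H := (hardy R d).
Notation B := (pdot mu).
Implicit Types (P Q : ncpoly R d) (s t w : W).
Variables (n : nat) (q : ncpoly R d).
Notation deg_le := (supported (words_upto d n)).
Hypothesis sq : deg_le q.
Hypothesis oq : orth mu (nonnil (words_upto d n)) q.
Hypothesis q0 : const_coef q = 1.
Let Lam := snorm2 B q.
Hypothesis Lam0 : 0 < Lam.

Let hB := pdot_sesqui Hmu.

Definition remd P := P - const_coef P *: q.

(** The polynomials [wsh j P] are the components of [P - P(0) q] along the
    variables, so that [P = P(0) q + \sum_j Z_j wsh_j P]. For [q = 1] they are
    the backward shifts of [P]. *)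
Definition wsh j P := bshift j (remd P).

Lemma const_remd P : const_coef (remd P) = 0.
Proof.
by rewrite /const_coef /remd ncoefB ncoefZ -/(const_coef q) q0 mulr1 subrr.
Qed.

Lemma mcoeff_wsh j P t : mcoeff t (wsh j P) =
  mcoeff (wcons j t) P - const_coef P * mcoeff (wcons j t) q.
Proof. by rewrite mcoeff_bshift ncoefB ncoefZ. Qed.

Lemma wsh_lin j (a : R[i]) P Q : wsh j (a *: P + Q) = a *: wsh j P + wsh j Q.
Proof.
apply/malgP => t.
have lin w U V : mcoeff w (a *: U + V) = a * mcoeff w U + mcoeff w V.
  by rewrite ncoefD ncoefZ.
apply: etrans (mcoeff_wsh j (a *: P + Q) t) _.
apply: etrans _ (esym (lin t (wsh j P) (wsh j Q))).
apply: etrans _ (esym (congr2 (fun x y => a * x + y)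
  (mcoeff_wsh j P t) (mcoeff_wsh j Q t))).
apply: etrans (congr2 (fun x y => x - y * mcoeff (wcons j t) q)
  (lin (wcons j t) P Q) (lin emptyword P Q)) _.
rewrite /const_coef /=; ring.
Qed.

Lemma wsh_lmul j k P : wsh j (lmul k P) = (j == k)%:R *: P.
Proof.
apply/malgP => t; rewrite [RHS]ncoefZ mcoeff_wsh mcoeff_lmul.
by rewrite /const_coef mcoeff0_lmul mul0r subr0.
Qed.

Lemma deg_le_wsh j P : deg_le P -> deg_le (wsh j P).
Proof.
move=> sP t; rewrite mem_words_upto mcoeff_wsh -ltnNge => tn.
have h : wcons j t \notin words_upto d n.
  by rewrite mem_words_upto -ltnNge /= ltnW.
by rewrite (sP _ h) (sq h) mulr0 subr0.
Qed.

Lemma snorm2_row (F : 'I_d -> ncpoly R d) :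
  snorm2 B (\sum_j lmul j (F j)) = \sum_j snorm2 B (F j).
Proof.
rewrite /snorm2 (pdot_suml Hmu) cRe_sum; apply: eq_bigr => j _.
rewrite (pdot_sumr Hmu) (bigD1 j)//= pdot_lmul// eqxx mul1r big1 ?addr0// => k kj.
by rewrite pdot_lmul// eq_sym (negbTE kj) mul0r.
Qed.

(** In degree at most [n] the decomposition [P = P(0) q + \sum_j Z_j wsh_j P] is
    orthogonal: [q] is orthogonal to nonempty words and the variables act as a
    row isometry. *)
Lemma wsh_norm P : deg_le P ->
  snorm2 B P = modc (const_coef P) ^+ 2 * Lam + \sum_j snorm2 B (wsh j P).
Proof.
move=> sP; have sr : deg_le (remd P).
  by apply: supportedB => //; exact: supportedZ.
have srN : supported (nonnil (words_upto d n)) (remd P).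
  move=> t; rewrite mem_filter negb_and negbK => /orP[/eqP ->|]; last exact: sr.
  exact: const_remd.
have un := words_upto_uniq d n.
have o := orth_supported Hmu (filter_uniq _ un) oq srN.
have PE : P = const_coef P *: q + remd P by rewrite addrC subrK.
rewrite [in LHS]PE (snorm2_pdotD Hmu) (pdotZl Hmu) o mulr0 mulr0 addr0.
rewrite (snorm2_pdotZ Hmu); congr (_ + _).
by rewrite [in LHS](bshift_decomp (const_remd P)) snorm2_row.
Qed.

(** Iterating the decomposition expands [P] formally as
    [\sum_w cf w P *: Z^w q]. *)
Fixpoint cfs (a : seq 'I_d) P : R[i] :=
  if a is j :: b then cfs b (wsh j P) else const_coef P.

Definition cf w P := cfs (w : seq _) P.

Lemma cf_lin w (a : R[i]) P Q : cf w (a *: P + Q) = a * cf w P + cf w Q.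
Proof.
elim/wordP: w P Q => [|j w IH] P Q.
  by rewrite /cf /= /const_coef ncoefD ncoefZ.
by rewrite /cf /= wsh_lin; exact: IH.
Qed.

Lemma cf0 w : cf w 0 = 0.
Proof.
have := cf_lin w 1 0 0; rewrite scale1r addr0 mul1r => /esym/eqP.
by rewrite -subr_eq0 addrK => /eqP.
Qed.

Lemma cfZ w (a : R[i]) P : cf w (a *: P) = a * cf w P.
Proof. by rewrite -[a *: P]addr0 cf_lin cf0 addr0. Qed.

(** After [N] iterations, [tail N P] is the squared norm of the part of [P] not yet
    expanded, and [mass N P] is the sum of the [|cf w P|^2] over the words of
    length less than [N]. *)
Fixpoint tail N P : R :=
  if N is M.+1 then \sum_j tail M (wsh j P) else snorm2 B P.

Fixpoint mass N P : R :=
  if N is M.+1 then modc (const_coef P) ^+ 2 + \sum_j mass M (wsh j P) else 0.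

Lemma massS N P :
  mass N.+1 P = modc (const_coef P) ^+ 2 + \sum_j mass N (wsh j P).
Proof. by []. Qed.

Lemma mass_tail N P : deg_le P -> snorm2 B P = Lam * mass N P + tail N P.
Proof.
elim: N P => [|N IH] P sP /=; first by rewrite mulr0 add0r.
rewrite wsh_norm// mulrDr mulr_sumr -addrA -big_split /= mulrC; congr (_ + _).
by apply: eq_bigr => j _; rewrite -IH//; exact: deg_le_wsh.
Qed.

Lemma tail_ge0 N P : 0 <= tail N P.
Proof.
elim: N P => [|N IH] P /=; first exact: (snorm2_ge0 hB).
by apply: sumr_ge0 => j _.
Qed.

Lemma mass_ge0 N P : 0 <= mass N P.
Proof.
elim: N P => [|N IH] P //=.
by rewrite addr_ge0 ?sqr_ge0//; apply: sumr_ge0 => j _.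
Qed.

Lemma le_mass N M P : (N <= M)%N -> mass N P <= mass M P.
Proof.
elim: N M P => [|N IH] M P; first by move=> _; exact: mass_ge0.
by case: M => // M; rewrite ltnS => NM /=; rewrite lerD2l ler_sum// => j _; exact: IH.
Qed.

Lemma le_mass_wsh N j P : mass N (wsh j P) <= mass N.+1 P.
Proof.
rewrite [X in _ <= X]massS (bigD1 j (erefl true)).
apply: (ler_wpDl (sqr_ge0 _)); rewrite /= lerDl.
by apply: sumr_ge0 => i _; exact: mass_ge0.
Qed.

Lemma const_le_mass N P : modc (const_coef P) ^+ 2 <= mass N.+1 P.
Proof.
by rewrite massS lerDl; apply: sumr_ge0 => i _; exact: mass_ge0.
Qed.

Lemma mass_words N P :
  mass N.+1 P = \sum_(w <- words_upto d N) modc (cf w P) ^+ 2.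
Proof.
pose t m Q := \sum_(w <- words_of_length d m) modc (cf w Q) ^+ 2.
have tS m Q : t m.+1 Q = \sum_j t m (wsh j Q).
  rewrite /t /words_of_length iterS -/(words_of_length d m).
  rewrite big_flatten big_map big_enum; apply: eq_bigr => j _.
  by rewrite big_map.
have massE m Q : mass m Q = \sum_(i < m) t i Q.
  elim: m Q => [|m IH] Q /=; first by rewrite big_ord0.
  rewrite big_ord_recl; congr (_ + _).
    by rewrite /t /words_of_length /= big_seq1.
  rewrite (eq_bigr _ (fun j _ => IH _)) exchange_big; apply: eq_bigr => i _.
  by rewrite tS.
rewrite massE /words_upto big_flatten big_map -[iota _ _]/(index_iota 0 N.+1).
by rewrite big_mkord.
Qed.

Let aux (K y a m A b : R) : 0 <= K -> 0 <= y -> a <= K * m -> m <= A -> b <= A ->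
  2 * a + 2 * (b * y) <= (2 * K + 2 * y) * A.
Proof.
move=> K0 y0 aK mA bA; rewrite [X in _ <= X]mulrDl -!mulrA; apply: lerD; rewrite ler_pM2l//.
  by apply: le_trans aK _; rewrite ler_wpM2l.
by rewrite mulrC ler_wpM2l.
Qed.

(** Induction on the word: deleting its first letter [j] replaces [P] by [wsh j P],
    up to a multiple of [P(0)]. *)
Lemma mcoeff_le w : exists2 K : R, 0 <= K &
  forall P, modc (mcoeff w P) ^+ 2 <= K * mass (size w).+1 P.
Proof.
elim/wordP: w => [|j t [K K0 IH]].
  exists 1 => // P; rewrite mul1r -[mcoeff _ P]/(const_coef P) /=.
  by rewrite big1// addr0.
exists (2 * K + 2 * modc (mcoeff (wcons j t) q) ^+ 2).
  by apply: addr_ge0; apply: mulr_ge0 => //; exact: sqr_ge0.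
move=> P; set x := mcoeff (wcons j t) q.
have -> : mcoeff (wcons j t) P = mcoeff t (wsh j P) + const_coef P * x.
  by rewrite mcoeff_wsh subrK.
apply: le_trans (modc_sqD _ _ ltr01) _; rewrite invr1.
have -> : 1 + 1 = 2 :> R by [].
rewrite modcM exprMn.
have h1 := le_mass_wsh (size t).+1 j P.
have h2 := const_le_mass (size t).+1 P.
exact: (aux K0 (sqr_ge0 _) (IH (wsh j P)) h1 h2).
Qed.

Lemma snorm2_comb (l : seq W) : exists2 K : R, 0 <= K & forall c : W -> R[i],
  snorm2 B (\sum_(w <- l) c w *: Zpow R w) <= K * \sum_(w <- l) modc (c w) ^+ 2.
Proof.
elim: l => [|w l [K K0 IH]].
  by exists 0 => // c; rewrite !big_nil mulr0 /snorm2 (pdot0l Hmu).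
exists (2 * snorm2 B (Zpow R w) + 2 * K).
  by rewrite addr_ge0 ?mulr_ge0// (snorm2_ge0 hB).
move=> c; rewrite !big_cons; set y := \sum_(_ <- l) _ *: _.
have -> : c w *: Zpow R w + y = y + c w *: Zpow R w by rewrite addrC.
have sD2 P Q : snorm2 B (P + Q) <= 2 * snorm2 B P + 2 * snorm2 B Q.
  have := snorm2_ge0 hB (P + (-1) *: Q).
  rewrite !(snorm2_pdotD Hmu) (snorm2_pdotZ Hmu) (pdotZr Hmu) rmorphN1 mulN1r cReN.
  rewrite modcN Normc.normc1 expr1n mul1r.
  move: (snorm2 B P) (snorm2 B Q) (complex.Re _) => u v z; lra.
apply: le_trans (sD2 _ _) _; rewrite (snorm2_pdotZ Hmu).
have := IH c; rewrite -/y.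
have := sqr_ge0 (modc (c w)); set m := modc (c w) ^+ 2.
have : 0 <= \sum_(v <- l) modc (c v) ^+ 2 by apply: sumr_ge0 => v _; exact: sqr_ge0.
set S := \sum_(_ <- l) _; have := snorm2_ge0 hB (Zpow R w).
set z := snorm2 B (Zpow R w) => z0 S0 m0 hy.
have : 0 <= z * S by exact: mulr_ge0.
have : 0 <= K * m by exact: mulr_ge0.
rewrite !mulrDl !mulrDr; lra.
Qed.

(** On polynomials of degree at most [n] the form [mass n.+1] determines all
    coefficients, so it dominates the norm. *)
Lemma mass_coercive : exists2 K : R, Lam <= K &
  forall P, deg_le P -> snorm2 B P <= K * mass n.+1 P.
Proof.
have un := words_upto_uniq d n.
have [K K0 hK] := snorm2_comb (words_upto d n).
have /choice [c hc] : forall w, exists k : R, 0 <= k /\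
    forall P, modc (mcoeff w P) ^+ 2 <= k * mass (size w).+1 P.
  by move=> w; have [k k0 hk] := mcoeff_le w; exists k.
pose C := \sum_(w <- words_upto d n) c w.
have C0 : 0 <= C by apply: sumr_ge0 => w _; have [] := hc w.
exists (K * C + Lam); first by rewrite lerDr mulr_ge0.
move=> P sP; rewrite [X in snorm2 B X](supportedE un sP).
apply: le_trans (hK _) _; rewrite mulrDl -[X in X <= _]addr0 lerD//; last first.
  by rewrite mulr_ge0 ?mass_ge0// ltW.
rewrite -mulrA ler_wpM2l// /C mulr_suml !big_seq; apply: ler_sum => w.
rewrite mem_words_upto => wn; have [c0 h] := hc w.
by apply: le_trans (h P) _; rewrite ler_wpM2l// le_mass.
Qed.

(** By coercivity, each block of [n.+1] iterations accounts for a fixed share of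
    the remaining squared norm. *)
Lemma tail_decay : exists2 r : R, 0 <= r < 1 &
  forall k P, deg_le P -> tail (k * n.+1) P <= r ^+ k * snorm2 B P.
Proof.
have [K LK hK] := mass_coercive.
have K0 : 0 < K by exact: lt_le_trans LK.
exists (1 - Lam / K).
  by rewrite subr_ge0 ler_pdivrMr// mul1r LK /= ltrBlDr ltrDl divr_gt0.
set r := 1 - _.
have one P : deg_le P -> tail n.+1 P <= r * snorm2 B P.
  move=> sP; have := mass_tail n.+1 sP; have := hK P sP => h1 h2.
  have -> : tail n.+1 P = snorm2 B P - Lam * mass n.+1 P by rewrite h2 addrAC subrr add0r.
  rewrite /r mulrBl mul1r lerD2l lerN2 -mulrA ler_pM2l// mulrC ler_pdivrMr//.
  by rewrite mulrC.
have step N P : deg_le P -> tail (N + n.+1) P <= r * tail N P.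
  elim: N P => [|N IH] P sP; first exact: one.
  rewrite addSn /= mulr_sumr; apply: ler_sum => j _; apply: IH.
  exact: deg_le_wsh.
have r0 : 0 <= r by rewrite subr_ge0 ler_pdivrMr// mul1r.
elim=> [|k IH] P sP; first by rewrite mul0n expr0 mul1r.
rewrite mulSn addnC; apply: le_trans (step _ _ sP) _.
by rewrite exprS -mulrA ler_wpM2l// IH.
Qed.

(** The tail tends to zero, so nothing is lost in the expansion. *)
Lemma cf_hardy P : deg_le P -> exists2 h : H,
  h = (fun w => (Num.sqrt Lam)%:C * cf w P) :> (W -> R[i]) &
  nrm h ^+ 2 = snorm2 B P.
Proof.
move=> sP; set u := fun w => _.
have uE w : modc (u w) ^+ 2 = Lam * modc (cf w P) ^+ 2.
  by rewrite /u modcM modcR exprMn real_normK ?num_real// sqr_sqrtr// ltW.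
have su N : \sum_(w <- words_upto d N) modc (u w) ^+ 2 = snorm2 B P - tail N.+1 P.
  rewrite (mass_tail N.+1 sP) addrK mass_words mulr_sumr.
  by apply: eq_bigr => w _; exact: uE.
have psu N : psum u [fset w in words_upto d N]%fset =
    \sum_(w <- words_upto d N) modc (u w) ^+ 2.
  rewrite /psum; apply: perm_big; apply: uniq_perm; [exact: fset_uniq|exact: words_upto_uniq|].
  by move=> w; rewrite !inE.
have le1 F : psum u F <= snorm2 B P.
  pose N := (\max_(w <- F) size w)%N.
  apply: (@le_trans _ _ (psum u [fset w in words_upto d N]%fset)).
    apply: le_psum; apply/fsubsetP => w wF.
    have : w \in words_upto d N.
      by rewrite mem_words_upto /N (big_fsetD1 w)//= leq_maxl.
    by move: (words_upto d N) => l wl; rewrite !inE.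
  by rewrite psu su lerBlDr lerDl tail_ge0.
have ul : u \in @square_summable R d.
  rewrite unfold_in; apply: (@le_lt_trans _ _ (snorm2 B P)%:E); rewrite ?ltry//.
  exact/sqnorm_leP.
exists (Hardy ul) => //; apply/eqP; rewrite eq_le; apply/andP; split.
  by rewrite nrm2E -lee_fin fineK ?sqnorm_fin//; apply/sqnorm_leP.
have [r /andP[r0 r1] hr] := tail_decay.
apply/ler_addgt0Pr => e e0.
have h0 : (fun k => r ^+ k * snorm2 B P) @ \oo --> (0 * snorm2 B P : R).
  by apply: cvgMr_tmp; apply: cvg_expr; rewrite ger0_norm.
rewrite mul0r in h0.
have /cvgrPdist_lt/(_ _ e0) [k0 _ hk] := h0.
have := hk k0.+1 (leqnSn _); rewrite sub0r normrN => hk1.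
have tl : tail (k0.+1 * n.+1) P < e.
  apply: le_lt_trans (hr _ _ sP) _; apply: le_lt_trans hk1; exact: ler_norm.
rewrite mulSn addSn in tl.
have := psum_le (Hardy ul) [fset w in words_upto d (n + k0 * n.+1)]%fset.
rewrite -nrm2E [psum _ _]psu su; lra.
Qed.

(** The vector [f] is built from the expansion of the polynomial 1. As [wsh j] is
    a left inverse of the multiplication by the variable [j] and kills the
    others, the coefficients of [P(L) f] are those of the expansion of [P]. Thus
    the vector functional of [f] agrees with [mu] in low degree, as the
    Bernstein-Szego measures do on the circle. *)
Lemma Bernstein_Szego : exists2 f : H, f emptyword = (Num.sqrt Lam)%:C &
  forall P, deg_le P -> nrm (polyL P f) ^+ 2 = snorm2 B P.
Proof.
have s1 : deg_le (1 : ncpoly R d).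
  rewrite -Zpow_empty; apply: supported_Zpow; by rewrite mem_words_upto.
have [f fE _] := cf_hardy s1.
exists f.
  have c1 : cf emptyword 1 = 1.
    by rewrite /cf /= -Zpow_empty [const_coef _]mcoeff_Zpow eqxx.
  by rewrite fE c1 mulr1.
have E P w : polyL P f w = (Num.sqrt Lam)%:C * cf w P.
  elim/ncpoly_ind: P w => [|a s P IH] w.
    by rewrite polyL0 cf0 mulr0.
  rewrite polyL_lin -[LHS]/(a * polyL (Zpow R s) f w + polyL P f w) IH cf_lin.
  rewrite mulrDr mulrCA; congr (_ * _ + _) => {IH P}; rewrite polyL_Zpow.
  elim/wordP: s w => [|k s IH] w; first by rewrite lshiftw_empty /= fE Zpow_empty.
  rewrite -[X in _ = _ * cf _ X]lmul_Zpow lshiftw_cons.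
  rewrite -[LHS]/(lshiftL k (lshiftw s f) w).
  elim/wordP: w => [|j w _].
    have -> : cf emptyword (lmul k (Zpow R s)) = 0 by exact: mcoeff0_lmul.
    by rewrite mulr0.
  rewrite lshiftLE.
  have -> : cf (wcons j w) (lmul k (Zpow R s)) = (j == k)%:R * cf w (Zpow R s).
    by rewrite -cfZ -wsh_lmul.
  by case: (j == k); rewrite ?mul1r ?mul0r ?mulr0// IH.
move=> P sP; have [h hE <-] := cf_hardy sP.
by congr (nrm _ ^+ 2); apply: hardyP => w; rewrite E hE.
Qed.

End BernsteinSzego.

(** * Vector functionals *)

Section Convolution.
Variables (R : realType) (d : nat).
Notation H := (hardy R d).
Notation W := (word d).
Notation F_ := (W -> R[i]).
Implicit Types (x y : F_) (f g : H) (w s t : W).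

(** The coefficients of the product of two formal power series, as sums over the
    factorisations of a word. *)
Fixpoint convs x (f : F_) (w : seq 'I_d) : R[i] :=
  x emptyword * f (FMonom w) +
  (if w is k :: v then convs (fun t => x (wcons k t)) f v else 0).

Definition conv x (f : F_) w : R[i] := convs x f (w : seq _).

Lemma conv_nil x (f : F_) : conv x f emptyword = x emptyword * f emptyword.
Proof. by rewrite /conv /= addr0. Qed.

Lemma conv_cons x (f : F_) k w : conv x f (wcons k w) =
  x emptyword * f (wcons k w) + conv (fun t => x (wcons k t)) f w.
Proof. by []. Qed.

Lemma conv_lin (f : F_) (a : R[i]) x y w :
  conv (fun t => a * x t + y t) f w = a * conv x f w + conv y f w.
Proof.
elim/wordP: w x y => [|k w IH] x y; first by rewrite !conv_nil mulrDl mulrA.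
by rewrite !conv_cons IH; ring.
Qed.

Lemma conv_cvg (T : Type) (U : set_system T) {FU : Filter U} (f : F_)
    (u : T -> F_) x :
  (forall w, (fun i => u i w : R[i]^o) @ U --> (x w : R[i]^o)) ->
  forall w, (fun i => conv (u i) f w : R[i]^o) @ U --> (conv x f w : R[i]^o).
Proof.
move=> + w; elim/wordP: w u x => [|k w IH] u x ux.
  rewrite conv_nil mulrC; under eq_fun do rewrite conv_nil mulrC.
  exact/cvgC_Z/ux.
rewrite conv_cons; under eq_fun do rewrite conv_cons.
apply: cvgC_D; last by apply: IH => v; exact: ux.
by rewrite mulrC; under eq_fun do rewrite mulrC; exact/cvgC_Z/ux.
Qed.

Lemma conv0 (f : F_) w : conv (fun=> 0) f w = 0.
Proof.
elim/wordP: w => [|k w IH]; first by rewrite conv_nil mul0r.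
by rewrite conv_cons mul0r add0r; exact: IH.
Qed.

Lemma conv_one (f : F_) w : conv (@hone R d) f w = f w.
Proof.
have h0 : (hone : H) emptyword = 1 by rewrite /= /onefun eqxx.
elim/wordP: w => [|k w _]; first by rewrite conv_nil h0 mul1r.
rewrite conv_cons h0 mul1r.
have -> : (fun t => (hone : H) (wcons k t)) = fun=> 0 by apply/funext => t.
by rewrite conv0 addr0.
Qed.

Lemma conv_lshiftL k (x : H) (f : F_) w :
  conv (lshiftL k x) f w = lshift_fun k (conv x f) w.
Proof.
elim/wordP: w => [|l w _]; first by rewrite conv_nil lshiftL0 mul0r.
rewrite conv_cons lshiftL0 mul0r add0r /lshift_fun /=.
have E t : lshiftL k x (wcons l t) = if l == k then x t else 0 by exact: lshiftLE.
rewrite (_ : (fun t => _) = (fun t => if l == k then x t else 0)); last first.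
  by apply/funext => t; exact: E.
case: (l == k); last exact: conv0.
by case: w.
Qed.

(** The shifts act on the left, so that the operator [P(L)] is the left
    convolution by the vector [P(L) 1]. *)
Lemma polyL_conv P f w : polyL P f w = conv (polyL P hone) f w.
Proof.
elim/ncpoly_ind: P w => [|a s P IH] w; first by rewrite polyL0 [RHS]conv0.
rewrite polyL_lin -[LHS]/(a * polyL (Zpow R s) f w + polyL P f w) IH.
rewrite [RHS](conv_lin f a (polyL (Zpow R s) hone) (polyL P hone)).
congr (_ * _ + _) => {IH P}; rewrite polyL_Zpow.
elim/wordP: s w => [|k s IH] w; first by rewrite lshiftw_empty /= conv_one.
rewrite lshiftw_cons /= conv_lshiftL /lshift_fun.
by case: w => [[|l w]]//=; case: eqP => // _; exact: IH.
Qed.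

(** A coefficient of a convolution involves finitely many coefficients of its
    factors, so the identity passes to operator-norm limits. *)
Lemma disc_conv A f w : disc_algebra A -> A f w = conv (A hone) f w.
Proof.
move=> /opnorm_closureP hA.
have ge n : 0 < n.+1%:R^-1 :> R by rewrite invr_gt0.
have /choice [P hP] : forall n : nat, exists P, op_close n.+1%:R^-1 A (polyL P).
  by move=> n; have [_ [P _ <-] hB] := hA _ (ge n); exists P.
have c g v : (fun n => polyL (P n) g v : R[i]^o) @ \oo --> (A g v : R[i]^o).
  apply/cvgCP => e e0.
  have M0 : 0 < nrm g + 1 by have := nrm_ge0 g; lra.
  have e1 : 0 < e / (nrm g + 1) by rewrite divr_gt0.
  apply: filterS (near_invS e1) => n hn.
  have := modc_coef (A g - polyL (P n) g) v; rewrite hcoefB => /le_lt_trans; apply.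
  apply: le_lt_trans (hP n g) _.
  apply: (@le_lt_trans _ _ (n.+1%:R^-1 * (nrm g + 1))).
    by apply: ler_wpM2l; [exact: ltW (ge n) | rewrite lerDl].
  by rewrite -ltr_pdivlMr.
have h1 := c f w.
have h2 := @conv_cvg nat \oo _ f (fun n => polyL (P n) hone) (A hone) (c hone) w.
have E : (fun n => polyL (P n) f w : R[i]^o) = fun n => conv (polyL (P n) hone) f w.
  by apply/funext => n; exact: polyL_conv.
rewrite E in h1; by rewrite -(cvg_lim _ h1)// (cvg_lim _ (h2 _)).
Qed.

End Convolution.

Section VectorFunctional.
Variables (R : realType) (d : nat) (f : hardy R d).
Notation H := (hardy R d).
Notation W := (word d).
Let hS := @hdot_sesqui R d.

Definition vstate (A : hop R d) : R[i] := hdot (A f) f.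

Lemma vstate_measure : nc_measure vstate.
Proof.
split=> [a A B _ _|A _ pA]; last exact: pA.
rewrite /vstate -[(_ + B) f]/(a *: A f + B f).
by rewrite (sesqDl hS) (sesqZl hS).
Qed.

(** The vectors whose product with [f] is again a vector: the maximal domain of
    right multiplication by [f]. *)
Definition conv_dom : set H := [set x | conv x f \in @square_summable R d].

Definition hconv (x : H) : H := insubd 0 (conv x f).

Lemma hconvE (x : H) : conv_dom x -> hconv x = conv x f :> (W -> R[i]).
Proof. by move=> h; rewrite /hconv; exact: insubdK. Qed.

Lemma conv_domP (x : H) (g : H) : g = conv x f :> (W -> R[i]) ->
  conv_dom x /\ hconv x = g.
Proof.
move=> gx; have dx : conv_dom x by rewrite /conv_dom /= -gx; exact: (valP g).
by split=> //; apply: hardyP => w; rewrite hconvE// gx.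
Qed.

Lemma hconv_lin (a : R[i]) (x y : H) : conv_dom x -> conv_dom y ->
  conv_dom (a *: x + y) /\ hconv (a *: x + y) = a *: hconv x + hconv y.
Proof.
move=> dx dy; apply: conv_domP; apply/funext => w.
by rewrite [RHS](conv_lin f a x y) hcoefD hcoefZ !hconvE.
Qed.

Lemma conv_dom0 : conv_dom 0.
Proof.
have [h _] : conv_dom 0 /\ hconv 0 = 0; last by [].
by apply: conv_domP; apply/funext => w; rewrite [RHS]conv0.
Qed.

Lemma hconv_disc A : disc_algebra A -> conv_dom (A hone) /\ hconv (A hone) = A f.
Proof.
by move=> dA; apply: conv_domP; apply/funext => w; exact: disc_conv.
Qed.

Lemma trunc_disc (F : {fset W}) (x : H) :
  trunc F x = polyL (\sum_(w <- F) x w *: Zpow R w) hone.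
Proof.
rewrite /trunc; elim: (enum_fset F) => [|w r IH].
  by rewrite !big_nil polyL0.
by rewrite !big_cons polyL_lin polyL_Zpow IH.
Qed.

Lemma conv_dom_dense : dense conv_dom.
Proof.
move=> O [x Ox] oO.
have /nbhs_normP [e e0 he] : nbhs x O by rewrite nbhsE; exists O.
have eE : e = (complex.Re e)%:C by apply/ge0_complexE/ltW.
have e1 : 0 < complex.Re e by rewrite -ltcR -eE.
have [F hF] := trunc_approx x e1.
exists (trunc F x); split.
  by apply: he; rewrite /= /ball_ /= normE eE ltcR.
rewrite trunc_disc; apply: (hconv_disc _).1; exact: polyL_disc.
Qed.

(** On the vectors [a 1] of the disc algebra this is the form of [vstate f], since
    [(a 1) * f = a f]; on its maximal domain it is closed. *)
Definition conv_form : qform R d :=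
  QForm conv_dom (fun x y => hdot (hconv y) (hconv x)).

Lemma conv_form_positive : positive_form conv_form.
Proof.
split.
- split=> [|a x y dx dy]; first exact: conv_dom0.
  by have [] := hconv_lin a dx dy.
- exact: conv_dom_dense.
- move=> a x y z dx dy dz /=; have [_ ->] := hconv_lin a dy dz.
  by rewrite (sesqDl hS) (sesqZl hS).
- by move=> x y _ _ /=; rewrite conjcE -(sesqC hS).
- by move=> x _ /=; rewrite hdotff ler0c sqr_ge0.
Qed.

(** The images of a form-Cauchy sequence converge coefficientwise to the
    convolution of the limit, which stays in the space by Fatou's lemma. *)
Lemma conv_form_closed : closed_form conv_form.
Proof.
move=> u x du ux cu.
have subD y z : conv_dom y -> conv_dom z ->
    conv_dom (y - z) /\ hconv (y - z) = hconv y - hconv z.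
  move=> dy dz; have := hconv_lin (-1) dz dy.
  by rewrite !scaleN1r ![- _ + _]addrC.
have cw w : (fun n => u n w : R[i]^o) @ \oo --> (x w : R[i]^o).
  apply/cvgCP => e e0; have e1 : 0 < e%:C by rewrite ltcR.
  move/cvgrPdist_lt: ux => /(_ _ e1); apply: filterS => n.
  rewrite normE ltcR; apply: le_lt_trans.
  by rewrite -hcoefB; exact: modc_coef.
have cc n w : (fun m => (hconv (u m) - hconv (u n)) w : R[i]^o) @ \oo -->
    (conv x f w - conv (u n) f w : R[i]^o).
  have E m : (hconv (u m) - hconv (u n)) w = conv (u m) f w - conv (u n) f w.
    by rewrite hcoefB (hconvE (du m)) (hconvE (du n)).
  under eq_fun do rewrite E.
  by apply: cvgC_B; [exact: conv_cvg | exact: cvg_cst].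
have key (e : R) : 0 < e -> exists N, forall n, (N <= n)%N ->
    conv_dom x /\ nrm (hconv x - hconv (u n)) <= e.
  move=> e0; have e2 : 0 < e ^+ 2 by rewrite exprn_gt0.
  have [N hN] := cu _ e2; exists N => n Nn.
  have H2 : \forall m \near \oo, forall F,
      psum (hconv (u m) - hconv (u n)) F <= e ^+ 2.
    exists N => // m /= Nm.
    apply/(@nrm_leP _ _ (hconv (u m) - hconv (u n) : H) _ (ltW e0)).
    rewrite -(@ler_pXn2r _ 2) ?nnegrE ?nrm_ge0 ?(ltW e0)//.
    have := hN m n Nm Nn; rewrite /= (subD _ _ (du m) (du n)).2 hdotff.
    by rewrite lecR.
  have [h hE hh] := hardy_Fatou _ (ltW e0) (cc n) H2.
  have [dx hx] : conv_dom x /\ hconv x = h + hconv (u n).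
    by apply: conv_domP; apply/funext => w; rewrite hcoefD hE (hconvE (du n)) subrK.
  by split=> //; rewrite hx addrK.
have dx : conv_dom x by have [N /(_ N (leqnn N)) []] := key 1 ltr01.
split=> //; apply/cvgCP => e e0.
have e2 : 0 < Num.min (e / 2) 1 by rewrite lt_min divr_gt0/=.
have [N hN] := key _ e2; exists N => // n /= Nn.
have [_ hn] := hN n Nn.
rewrite (subD _ _ (du n) dx).2 hdotff sub0r modcN modcR ger0_norm ?sqr_ge0//.
rewrite nrmB; set y := nrm _ in hn *.
have y0 : 0 <= y := nrm_ge0 _.
have [y1 y2] : y <= e / 2 /\ y <= 1.
  by split; apply: le_trans hn _; rewrite ge_min lexx ?orbT.
have : y ^+ 2 <= y by rewrite expr2 ler_piMl.
lra.
Qed.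

Lemma vstate_abs_continuous : nc_abs_continuous vstate.
Proof.
exists conv_form; split; [exact: conv_form_positive|exact: conv_form_closed|].
split=> [x [A dA <-]|x y]; first by have [] := hconv_disc dA.
have op z : disc_vectors z -> disc_algebra (disc_op z) /\ disc_op z hone = z.
  move=> [A dA Az]; rewrite /disc_op; case: xgetP => [B _ []//|].
  by move=> /(_ A) [].
move=> /op [dA Ax] /op [dB By]; rewrite /= /vstate.
rewrite -{1}Ax -{1}By (hconv_disc dA).2 (hconv_disc dB).2.
have aA := disc_adjointable dA.
by rewrite /= (sesqC hS f) -aA -(sesqC hS).
Qed.

End VectorFunctional.

(** * Weak limits of representing vectors *)

Lemma ultra_real_cvg (R : realType) (U : set_system nat) (u : nat -> R) (c : R) :
  UltraFilter U -> (forall n, `|u n| <= c) -> exists l : R, u @ U --> l.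
Proof.
move=> UU uc; have PU : ProperFilter U := @ultra_proper _ _ UU.
have cpt := @segment_compact R (- c) c.
have h : U (u @^-1` `[(- c), c]).
  by apply: (@filterE _ U) => n; rewrite /= in_itv /= -ler_norml; exact: uc.
have [p [_ cp]] := cpt (u @ U) _ h.
exists p => A pA /=.
have [//|nA] := in_ultra_setVsetC (u @^-1` A) UU.
by have [y [ny Ay]] := cp (~` A) A nA pA.
Qed.

Lemma ultra_complex_cvg (R : realType) (U : set_system nat) (u : nat -> R[i])
    (c : R) : UltraFilter U -> (forall n, modc (u n) <= c) ->
  exists l : R[i], (u : nat -> R[i]^o) @ U --> (l : R[i]^o).
Proof.
move=> UU uc; have PU : ProperFilter U := @ultra_proper _ _ UU.
have [a ha] := @ultra_real_cvg R U (fun n => complex.Re (u n)) c UU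
  (fun n => le_trans (modc_Re _) (uc n)).
have [b hb] := @ultra_real_cvg R U (fun n => complex.Im (u n)) c UU
  (fun n => le_trans (modc_Im _) (uc n)).
by exists (Complex a b); apply: cvgC_ReIm.
Qed.

Lemma polyLD (R : realType) (d : nat) (P Q : ncpoly R d) :
  polyL (P + Q) = polyL P + polyL Q.
Proof. by have := polyL_lin 1 P Q; rewrite !scale1r. Qed.

Lemma polyLZ (R : realType) (d : nat) (a : R[i]) (P : ncpoly R d) :
  polyL (a *: P) = a *: polyL P.
Proof. by have := polyL_lin a P 0; rewrite addr0 polyL0 addr0. Qed.

Lemma cReR (R : realType) (a : R) : complex.Re a%:C = a.
Proof. by []. Qed.

Section Domination.
Variables (R : realType) (d : nat) (mu : hop R d -> R[i]).
Hypotheses (Hmu : nc_measure mu) (Hprob : probability_nc mu).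
Notation H := (hardy R d).
Notation W := (word d).
Notation B := (pdot mu).
Implicit Types (P Q h : ncpoly R d) (A : hop R d).
Let hS := @hdot_sesqui R d.
Let hB := pdot_sesqui Hmu.

Variable fs : nat -> H.
Hypothesis fsP : forall n P, supported (words_upto d n) P ->
  nrm (polyL P (fs n)) ^+ 2 = snorm2 B P.

Let one_supported n : supported (words_upto d n) (1 : ncpoly R d).
Proof.
by rewrite -Zpow_empty; apply: supported_Zpow; rewrite mem_words_upto.
Qed.

Lemma nrm_fs n : nrm (fs n) = 1.
Proof.
have := fsP (@one_supported n); rewrite polyL1 /= => h.
have h1 : nrm (fs n) ^+ 2 = 1.
  by rewrite h /snorm2 /pdot adj_polyL1 polyL1 [mu _]Hprob.
apply/eqP; rewrite -(@eqrXn2 _ 2) ?nrm_ge0// h1 expr1n//.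
Qed.

(** Along an ultrafilter finer than the tails, all the bounded sequences of
    coefficients converge at once, which replaces the extraction of a weakly
    convergent subsequence. *)
Lemma weak_limit_exists : exists U : set_system nat, exists f : H,
  [/\ UltraFilter U, \oo `<=` U &
      forall w, (fun n => fs n w : R[i]^o) @ U --> (f w : R[i]^o)].
Proof.
have [U [UU oU]] := @ultraFilterLemma nat \oo _.
have PU : ProperFilter U := @ultra_proper _ _ UU.
have /choice [l hl] : forall w : W, exists l : R[i],
    (fun n => fs n w : R[i]^o) @ U --> (l : R[i]^o).
  move=> w; apply: (@ultra_complex_cvg R U (fun n => fs n w) 1) => // n.
  by rewrite -(nrm_fs n); exact: modc_coef.
have [|f fE _] := @hardy_Fatou R d nat U PU (fun n => fs n) l 1 ler01 hl.
  by apply: filterE => n; apply/nrm_leP; rewrite ?nrm_fs.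
exists U, f; split; [exact: UU|exact: oU|move=> w; rewrite fE; exact: hl].
Qed.

Definition real_part h : hop R d := polyL h + adj (polyL h).

Lemma real_part_trig h : trig (real_part h).
Proof. by exists h, h. Qed.

Lemma real_part_dot h (g g' : H) :
  hdot (real_part h g) g' = hdot (polyL h g) g' + hdot g (polyL h g').
Proof.
rewrite -[real_part h g]/(polyL h g + adj (polyL h) g) (sesqDl hS).
congr (_ + _); rewrite (sesqC hS g') -polyL_adjointable.
exact/esym/(sesqC hS).
Qed.

Lemma real_part_sym h (g g' : H) :
  hdot (real_part h g) g' = hdot g (real_part h g').
Proof.
by rewrite [RHS](sesqC hS (real_part h g')) !real_part_dot conjD -!(sesqC hS) addrC.
Qed.

Lemma real_part_quad h (g : H) :
  complex.Re (hdot (real_part h g) g) = 2 * complex.Re (hdot (polyL h g) g).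
Proof.
by rewrite real_part_dot cReD (sesqC hS (polyL h g)) cReJ mulr2n mulrDl mul1r.
Qed.

Lemma mu_real_part h : complex.Re (mu (real_part h)) = 2 * complex.Re (B h 1).
Proof.
rewrite (nuD Hmu); last 2 first.
- exact/trig_disc/trig_poly.
- exact/trig_disc/trig_adj.
by rewrite nu_polyL nu_adj_polyL cReD (pdotC Hmu h) cReJ mulr2n mulrDl mul1r.
Qed.

(** The vectors [fs n] represent squared norms in low degree, hence the real parts
    of inner products with 1, by polarisation. *)
Lemma mu_fs h n : supported (words_upto d n) h ->
  complex.Re (mu (real_part h)) = complex.Re (hdot (real_part h (fs n)) (fs n)).
Proof.
move=> sh; rewrite mu_real_part real_part_quad; congr (2 * _).
have s1 := @one_supported n; have shD := supportedD sh s1.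
have := fsP shD; have := fsP sh; have := fsP s1.
rewrite (snorm2_pdotD Hmu) polyL1 /=.
have -> : polyL (h + 1) (fs n) = polyL h (fs n) + fs n.
  by rewrite -[h in h + 1]scale1r polyL_lin scale1r polyL1.
rewrite !nrm_snorm2 (snorm2D hS) => -> -> /addrI/mulfI -> //.
Qed.

Section Limit.
Variables (U : set_system nat) (f : H).
Hypotheses (UU : UltraFilter U) (oU : \oo `<=` U).
Hypothesis fsf : forall w, (fun n => fs n w : R[i]^o) @ U --> (f w : R[i]^o).

Let PU : ProperFilter U. Proof. exact: (@ultra_proper _ _ UU). Qed.

(** The quadratic form of a positive [A] is weakly lower semicontinuous: it
    dominates its linear part at [f], namely
    [2 Re <fs n, A f> - <A f, f>], which converges to [<A f, f>]. *)
Lemma real_part_le h : positive_op (real_part h) ->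
  complex.Re (vstate f (real_part h)) <= complex.Re (mu (real_part h)).
Proof.
move=> ph; rewrite /vstate; set A := real_part h in ph *.
have [N sN] := supported_words h.
have c1 : (fun n => hdot (fs n) (A f) : R[i]^o) @ U --> (hdot f (A f) : R[i]^o).
  by apply: (weak_cvg fsf (c := 1)) => n; rewrite nrm_fs.
have c2 := cvg_Re c1.
have c3 : (fun n => 2 * complex.Re (hdot (fs n) (A f)) - complex.Re (hdot (A f) f))
    @ U --> 2 * complex.Re (hdot f (A f)) - complex.Re (hdot (A f) f).
  apply: cvgB; last exact: cvg_cst.
  by apply: cvgMl_tmp; exact: c2.
have e : 2 * complex.Re (hdot f (A f)) - complex.Re (hdot (A f) f) =
    complex.Re (hdot (A f) f) by rewrite -[hdot f (A f)]real_part_sym -/A; lra.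
rewrite -[X in X <= _]e; apply: (cvg_le_bound c3); apply: oU.
exists N => // n /= Nn.
have sn : supported (words_upto d n) h.
  apply: (supported_sub _ sN) => w; rewrite !mem_words_upto => wN.
  exact: leq_trans wN Nn.
rewrite (mu_fs sn) -/A.
have := ge0_Re (ph (fs n - f)).
have lA : A (fs n - f) = A (fs n) - A f.
  have l : linear_op A.
    by apply: adjointable_linear; apply: (@is_adjointable _ _ _ A); exact: real_part_sym.
  exact: linear_opB.
rewrite lA (sesqBl hS) !(sesqBr hS) !cReD !cReN !cReD !cReN.
have -> : hdot (A (fs n)) f = hdot (fs n) (A f) by exact: real_part_sym.
rewrite (sesqC hS (fs n) (A f)) cReJ; lra.
Qed.

Lemma id_disc : disc_system (idfun : hop R d).
Proof. by rewrite -polyL1; exact/trig_disc/trig_poly. Qed.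

(** A positive [A] lies within [e] of some [p(L) + q(L)^*], whose quadratic form
    has the same real part as that of a real part [h(L) + h(L)^*] with [h] the
    mean of [p] and [q]. Adding [e / 2] to [h] makes this real part [D] positive,
    and [A - D] then lies between [-2 e] and [0] as a form. *)
Lemma vstate_le : nc_le (vstate f) mu.
Proof.
move=> A dA pA.
have rA : vstate f A = (complex.Re (vstate f A))%:C by exact/ge0_complexE/pA.
have rmu : mu A = (complex.Re (mu A))%:C.
  by apply: ge0_complexE; have [_ h] := Hmu; exact: h.
rewrite rA rmu lecR -subr_le0.
apply: (@le_small _ _ 2) => // e e0.
move/disc_systemP/opnorm_closureP: (dA) => /(_ _ e0) [_ [p [q ->]] Ae].
pose h := (2^-1)%:C *: (p + q) + (e / 2)%:C *: 1 : ncpoly R d.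
have hE : polyL h = (2^-1)%:C *: (polyL p + polyL q) + (e / 2)%:C *: idfun.
  rewrite /h polyLD; congr (_ + _); first by rewrite polyLZ polyLD.
  by rewrite polyLZ polyL1.
pose D := real_part h.
have quad (g : H) : complex.Re (hdot (D g) g) =
    complex.Re (hdot ((polyL p + adj (polyL q)) g) g) + e * nrm g ^+ 2.
  apply: etrans (real_part_quad h g) _.
  have -> : polyL h g = (2^-1)%:C *: (polyL p g + polyL q g) + (e / 2)%:C *: g.
    by rewrite hE.
  rewrite (sesqDl hS) !(sesqZl hS) cReD !cReMr hdotff (sesqDl hS) cReD.
  rewrite -[(_ + adj _) g]/(polyL p g + adj (polyL q) g) (sesqDl hS) cReD.
  have -> : complex.Re (hdot (adj (polyL q) g) g) = complex.Re (hdot (polyL q g) g).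
    by rewrite (sesqC hS g) -polyL_adjointable cReJ.
  have n2 : 2 != 0 :> R by rewrite pnatr_eq0.
  rewrite cReR mulrDr mulrA divff// mul1r; congr (_ + _).
  by rewrite mulrA [2 * _]mulrC divfK.
have close (g : H) : `|complex.Re (hdot (A g) g) -
    complex.Re (hdot ((polyL p + adj (polyL q)) g) g)| <= e * nrm g ^+ 2.
  rewrite -cReN -cReD -(sesqBl hS); apply: le_trans (modc_Re _) _.
  apply: le_trans (hdot_CS _ _) _.
  by rewrite expr2 mulrA ler_wpM2r ?nrm_ge0//; exact: Ae.
have real_ge0 (z : R[i]) : complex.Im z = 0 -> 0 <= complex.Re z -> 0 <= z.
  by move=> i0 r0; rewrite lecE i0 eqxx.
have imD (g : H) : complex.Im (hdot (D g) g) = 0.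
  have := real_part_sym h g g; rewrite -/D [RHS](sesqC hS) => /(congr1 (@complex.Im R)).
  rewrite -conjcE; case: (hdot (D g) g) => x y /= yy; lra.
have pD : positive_op D.
  move=> g; apply: real_ge0; first exact: imD.
  rewrite quad; have := close g; have := ge0_Re (pA g).
  rewrite ler_norml => a0 /andP[h1 h2]; lra.
have muD := real_part_le pD; rewrite -/D in muD.
have dD : disc_system D by exact/trig_disc/real_part_trig.
have dAD : disc_system ((-1) *: D + A) by exact: disc_system_lin.
pose E : hop R d := (2 * e)%:C *: idfun + ((-1) *: D + A).
have dE : disc_system E by apply: disc_system_lin; [exact: id_disc|].
have Eg g : hdot (E g) g = (2 * e)%:C * hdot g g + (hdot (A g) g - hdot (D g) g).
  rewrite -[E g]/((2 * e)%:C *: g + ((-1) *: D g + A g)).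
  rewrite (sesqDl hS) (sesqZl hS) (sesqDl hS) scaleN1r (sesqNl hS); congr (_ + _).
  by rewrite addrC.
have imA (g : H) : complex.Im (hdot (A g) g) = 0 by exact/ger0_Im/pA.
have pE : positive_op E.
  move=> g; rewrite Eg hdotff; apply: real_ge0.
    rewrite !cImD imA.
    have -> : complex.Im (- hdot (D g) g) = - complex.Im (hdot (D g) g).
      by case: (hdot _ _).
    by rewrite imD subrr addr0 -rmorphM.
  rewrite cReD cReMr cReD cReN quad cReR.
  have := close g; rewrite ler_norml => /andP[h1 h2]; lra.
have muE : 0 <= complex.Re (mu E).
  by apply: ge0_Re; have [_ hm] := Hmu; exact: hm.
have muEE : complex.Re (mu E) = 2 * e + (complex.Re (mu A) - complex.Re (mu D)).
  rewrite /E (nu_lin Hmu (2 * e)%:C id_disc dAD) (nu_lin Hmu (-1) dD dA).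
  rewrite mulN1r [mu idfun]Hprob mulr1 !cReD cReN cReR.
  by rewrite [- _ + _]addrC.
have vD : complex.Re (vstate f A) <= complex.Re (vstate f D).
  have hq : complex.Re (vstate f D) = _ := quad f.
  have hc := close f; apply: le_trans (_ : _ <= _ + e * nrm f ^+ 2) _; last first.
    by rewrite hq.
  by rewrite -lerBlDl; apply: le_trans hc; exact: ler_norm.
apply: le_trans (lerB (le_trans vD muD) (lexx (complex.Re (mu A)))) _.
by rewrite -subr_ge0 opprB mulrC -muEE; exact: muE.
Qed.

End Limit.

End Domination.

(** * Infinite products over words *)

Section WordProducts.
Variables (R : realType) (d : nat) (D : word d -> R).
Hypothesis D01 : forall s, 0 < D s <= 1.
Implicit Types (F G : {fset word d}) (P : pred (word d)).

Lemma prod_gt0 (r : seq (word d)) P : 0 < \prod_(s <- r | P s) D s.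
Proof. by apply: prodr_gt0 => s _; have /andP[] := D01 s. Qed.

Lemma prod_fset_le F G P : (F `<=` G)%fset ->
  \prod_(s <- G | P s) D s <= \prod_(s <- F | P s) D s.
Proof.
move=> FG; rewrite big_mkcond [X in _ <= X]big_mkcond /=.
rewrite (big_fsetID _ (mem F) G) /=.
have -> : [fset x | x in G & x \in F]%fset = F.
  apply/fsetP => x; rewrite !inE /= andbC.
  by apply: andb_idr => /(fsubsetP FG).
have p0 : 0 <= \prod_(s <- F) (if P s then D s else 1).
  by rewrite -big_mkcond ltW// prod_gt0.
rewrite ler_piMr//; apply: prodr_ile1 => s _.
by case: (P s); rewrite ?ler01 ?lexx//; have /andP[/ltW -> ->] := D01 s.
Qed.

Definition fwords n : {fset word d} := [fset w in words_upto d n]%fset.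

Lemma prod_fwords n P :
  \prod_(s <- fwords n | P s) D s = \prod_(s <- words_upto d n | P s) D s.
Proof.
apply: perm_big; apply: uniq_perm; [exact: fset_uniq|exact: words_upto_uniq|].
by rewrite /fwords; move: (words_upto d n) => l w; rewrite !inE.
Qed.

Lemma mem_fwords n w : (w \in fwords n) = (size w <= n)%N.
Proof.
rewrite -mem_words_upto /fwords; move: (words_upto d n) => l; by rewrite !inE.
Qed.

Lemma fset_fwords F : exists n, (F `<=` fwords n)%fset.
Proof.
exists (\max_(w <- F) size w)%N; apply/fsubsetP => w wF.
by rewrite mem_fwords (big_fsetD1 w)//= leq_maxl.
Qed.

Lemma prod_words_le m n P : (m <= n)%N ->
  \prod_(s <- words_upto d n | P s) D s <= \prod_(s <- words_upto d m | P s) D s.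
Proof.
move=> mn; rewrite -!prod_fwords; apply: prod_fset_le; apply/fsubsetP => w.
by rewrite !mem_fwords => /leq_trans; apply.
Qed.

(** The factors lie in the interval from 0 to 1, so the products over balls
    decrease. *)
Lemma prod_words_cvg P : exists2 l : R,
  (fun n => \prod_(s <- words_upto d n | P s) D s) @ \oo --> l &
  forall n, l <= \prod_(s <- words_upto d n | P s) D s.
Proof.
pose u (n : nat) := \prod_(s <- words_upto d n | P s) D s.
have du : nonincreasing_seq u by move=> m n mn; exact: prod_words_le.
have bu : has_lbound (range u).
  by exists 0 => _ [n _ <-]; exact/ltW/prod_gt0.
have cu := nonincreasing_is_cvgn du bu.
by exists (lim (u @ \oo)) => // n; exact: nonincreasing_cvgn_ge.
Qed.

(** Finite products are antitone in the set of indices, so that the balls of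
    words suffice to compute the unconditional product. *)
Lemma prod_totally P (l : R) :
  (fun n => \prod_(s <- words_upto d n | P s) D s) @ \oo --> l ->
  (fun F : {fset word d} => \prod_(s <- F | P s) D s) @ totally --> l.
Proof.
move=> h; have [l' h' lel'] := prod_words_cvg P.
have El : l = l' by rewrite -(cvg_lim _ h)// (cvg_lim _ h').
apply/cvgrPdist_lt => e e0; move/cvgrPdist_lt: h => /(_ _ e0) [n _ /(_ n (leqnn n))].
rewrite /= => hn; exists (fwords n) => // F /= nF.
have [m Fm] := fset_fwords F.
have h1 := prod_fset_le P nF; have h2 := prod_fset_le P Fm.
rewrite !prod_fwords in h1 h2; have h3 := lel' m; rewrite -El in h3.
have h4 := le_trans h3 h2.
rewrite distrC ger0_norm ?subr_ge0//; apply: le_lt_trans hn.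
by rewrite distrC ger0_norm ?subr_ge0 ?lerD2r//; exact: le_trans h1.
Qed.

Lemma prod_lastwords (d0 : (0 < d)%N) n :
  \prod_(s <- words_upto d n | s \in range (lastword d)) D s =
  \prod_(0 <= k < n.+1) D (lastword d k).
Proof.
rewrite -big_filter -(big_map (lastword d) xpredT D); apply: perm_big.
apply: uniq_perm.
- exact/filter_uniq/words_upto_uniq.
- rewrite map_inj_uniq ?iota_uniq// => i j /(congr1 (fun w : word d => size w)).
  by rewrite !size_lastword.
move=> w; rewrite mem_filter mem_words_upto.
apply/andP/mapP => [[/set_mem [k _ <-]]|[k]].
  by rewrite size_lastword// => kn; exists k => //; rewrite mem_index_iota ltnS.
rewrite mem_index_iota ltnS => /andP[_ kn] ->; rewrite size_lastword//; split=> //.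
by apply/mem_set; exists k.
Qed.

End WordProducts.

Section ChristoffelInfimum.
Variables (R : realType) (d : nat).

(** Meant for an nc measure and for its absolutely continuous part, with the same
    minimisers [q] and the same bounds. *)
Lemma Christoffel_infE (nu : hop R d -> R[i]) (q : nat -> ncpoly R d) (L : nat -> R)
    (l : R) :
  L @ \oo --> l ->
  (forall Q, const_coef Q = 1 -> l <= complex.Re (pdot nu Q Q)) ->
  (forall n, const_coef (q n) = 1) ->
  (forall n, complex.Re (pdot nu (q n) (q n)) <= L n) ->
  Christoffel_inf nu = l.
Proof.
move=> Ll lo q1 up; apply/eqP; rewrite eq_le; apply/andP; split.
  apply: (cvg_ge_bound Ll); apply: filterE => n; apply: le_trans (up n).
  apply: ge_inf; last by exists (q n) => //; exact: q1.
  by exists l => _ [Q Q1 <-]; exact: lo.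
apply: lb_le_inf; last by move=> _ [Q Q1 <-]; exact: lo.
by exists (complex.Re (pdot nu (q 0%N) (q 0%N))); exists (q 0%N) => //; exact: q1.
Qed.

Lemma polyL_hone0 Q : polyL Q (hone : hardy R d) emptyword = const_coef Q.
Proof.
elim/ncpoly_ind: Q => [|a s P IH]; first by rewrite polyL0 /const_coef ncoef0.
rewrite polyL_lin -[LHS]/(a * polyL (Zpow R s) hone emptyword + polyL P hone emptyword).
rewrite IH polyL_Zpow -[lshiftw s hone]/(bvec R s) bvecE /const_coef ncoefD ncoefZ.
by rewrite mcoeff_Zpow eq_sym.
Qed.

(** The constant coefficient of [Q(L) f] is [Q(0) f(0)], and the norm of a vector
    dominates its coefficients. *)
Lemma vstate_const (f : hardy R d) Q :
  modc (const_coef Q) ^+ 2 * modc (f emptyword) ^+ 2 <=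
  complex.Re (pdot (vstate f) Q Q).
Proof.
have -> : pdot (vstate f) Q Q = (nrm (polyL Q f) ^+ 2)%:C.
  rewrite -hdotff /pdot /vstate /= (sesqC (@hdot_sesqui R d) f).
  by rewrite -polyL_adjointable -(sesqC (@hdot_sesqui R d)).
have E : polyL Q f emptyword = const_coef Q * f emptyword.
  by rewrite polyL_conv conv_nil; congr (_ * _); exact: polyL_hone0.
rewrite cReR -exprMn -modcM -E ler_pXn2r ?nnegrE ?modc_ge0 ?nrm_ge0//.
exact: modc_coef.
Qed.

End ChristoffelInfimum.

(** * Szego theorem *)

Section Main.
Variables (R : realType) (d : nat) (mu : hop R d -> R[i]).
Hypotheses (Hmu : nc_measure mu) (Hprob : probability_nc mu).
Hypotheses (Hnt : nontrivial_nc mu) (d0 : (0 < d)%N).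
Notation B := (pdot mu).

Lemma defect01 s : 0 < defect mu s <= 1.
Proof. by rewrite (defect_gt0 Hmu Hprob Hnt d0) defect_le1. Qed.

Lemma pnormPhi_prod n : pnorm mu (Phi mu (lastword d n)) ^+ 2 =
  \prod_(0 <= k < n.+1) defect mu (lastword d k).
Proof.
elim: n => [|n IH].
  rewrite big_nat1 lastword0// defect_empty.
  have -> : Phi mu emptyword = 1.
    apply: (Phi_unique Hmu Hnt d0) => [|t]; last by rewrite before_empty.
    by rewrite -Zpow_empty subrr; exact: supported0.
  by rewrite (pnorm_unit (pdot11 Hprob)) expr1n.
by rewrite big_nat_recr//= lastwordS (pnormPhiS Hmu Hprob Hnt d0) IH.
Qed.

Lemma Christoffel_words n :
  Christoffel mu n = \prod_(s <- words_upto d n) defect mu s.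
Proof. by rewrite (ChristoffelE Hmu Hprob Hnt d0) upto_lastword. Qed.

(** The vectors representing [mu] in degree at most [n] have value
    [Num.sqrt (Christoffel mu n)] at the origin, and coefficients pass to weak
    limits. *)
Lemma limit_vector (kt : R) : Christoffel mu @ \oo --> kt -> exists f : hardy R d,
  modc (f emptyword) ^+ 2 = kt /\ nc_le (vstate f) mu.
Proof.
move=> Ck.
have /choice [fs hfs] : forall n, exists g : hardy R d,
    g emptyword = (Num.sqrt (Christoffel mu n))%:C /\
    forall P, supported (words_upto d n) P -> nrm (polyL P g) ^+ 2 = snorm2 B P.
  move=> n; have [sq oq q1 qL] := minimiser_spec Hmu Hprob Hnt d0 n.
  have Lam0 : 0 < snorm2 B (minimiser mu n).
    by rewrite qL (Christoffel_gt0 Hmu Hprob Hnt d0).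
  by have [g g0 gP] := Bernstein_Szego Hmu sq oq q1 Lam0; exists g; rewrite -qL.
have fsP n P : supported (words_upto d n) P -> nrm (polyL P (fs n)) ^+ 2 = snorm2 B P.
  by have [_] := hfs n; exact.
have [U [f [UU oU fsf]]] := weak_limit_exists Hprob fsP.
have PU : ProperFilter U := @ultra_proper _ _ UU.
exists f; split; last exact: (vstate_le Hmu Hprob fsP UU oU fsf).
have c1 : (fun n => modc (fs n emptyword) ^+ 2) @ U --> modc (f emptyword) ^+ 2.
  rewrite expr2; under eq_fun do rewrite expr2.
  by apply: cvgM; apply: cvg_modc; exact: fsf.
have c2 : (fun n => modc (fs n emptyword) ^+ 2) @ U --> kt.
  have -> : (fun n => modc (fs n emptyword) ^+ 2) = Christoffel mu.
    apply/funext => n; have [-> _] := hfs n.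
    rewrite modcR real_normK ?num_real// sqr_sqrtr// ltW//.
    exact: (Christoffel_gt0 Hmu Hprob Hnt d0).
  by move=> A kA; apply: oU; exact: Ck.
by rewrite -(cvg_lim _ c1)// (cvg_lim _ c2).
Qed.

End Main.

Local Open Scope complex_scope.

Theorem theorem6p3 (R : realType) (d : nat) (hd : (2 <= d)%N)
    (mu mu_ac mu_s : hop R d -> R[i]) (T sqrtT : unbounded_op R d) :
  nc_measure mu -> probability_nc mu -> nontrivial_nc mu ->
  lebesgue_decomposition mu mu_ac mu_s ->
  nc_Radon_Nikodym mu_ac T sqrtT ->
  exists kappa kappat : R,
    [/\ (fun n => pnorm mu (Phi mu (lastword d n)) ^+ 2) @ \oo --> kappa,
        (fun n => (leading_coef mu (lastword d n)) ^- 2 : R[i]^o) @ \oo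
          --> (kappa%:C : R[i]^o),
        (fun n => \prod_(0 <= k < n) defect mu (lastword d k)) @ \oo
          --> kappa &
        (fun n => toeplitz_det mu (lastword d n) /
                  toeplitz_det mu (wpred (lastword d n)) : R[i]^o) @ \oo
          --> (kappa%:C : R[i]^o)] /\
    [/\ (fun F : {fset word d} => \prod_(s <- F) defect mu s) @ totally
          --> kappat,
        Christoffel_inf mu = kappat,
        Christoffel_inf mu_ac = kappat &
        (fun n => modc (const_coef (phi_sharp mu (lastword d n))) ^- 2) @ \oo
          --> kappat] /\
    [/\ Christoffel mu @ \oo --> kappat,
        forall n, in_span (upto (lastword d n)) (minimiser mu n),
        (fun n => hdot (sqrtT (polyL (minimiser mu n) hone))
                       (sqrtT (polyL (minimiser mu n) hone)) : R[i]^o) @ \oo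
          --> (kappat%:C : R[i]^o) &
        exists mut : {measure set (measurableTypeR R) -> \bar R},
          mut [set t : R | t < 0] = 0%E /\
          (\int[mut]_(t in `[0%R, +oo[) (t%:E))%E = (kappat%:E)%E] /\
    exists rest : R,
      (fun F : {fset word d} =>
         \prod_(s <- F | s \notin range (lastword d)) defect mu s) @ totally
        --> rest /\
      kappat = kappa * rest.
Proof.
move=> Hmu Hprob Hnt [Hac _ _ [_ ac_le ac_max] _] [_ _ RN].
have d0 : (0 < d)%N by exact: ltn_trans hd.
have D01 := defect01 Hmu Hprob Hnt d0.
have [kappa ck _] := prod_words_cvg D01 (fun s => s \in range (lastword d)).
have [kt ckt ktle] := prod_words_cvg D01 xpredT.
have [rest cr _] := prod_words_cvg D01 (fun s => s \notin range (lastword d)).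
have c1 : (fun n => pnorm mu (Phi mu (lastword d n)) ^+ 2) @ \oo --> kappa.
  under eq_fun do rewrite (pnormPhi_prod Hmu Hprob Hnt d0) -(prod_lastwords _ d0).
  exact: ck.
have cC : Christoffel mu @ \oo --> kt.
  have -> : Christoffel mu = fun n => \prod_(s <- words_upto d n) defect mu s.
    by apply/funext => n; exact: Christoffel_words.
  exact: ckt.
have leC n : kt <= Christoffel mu n.
  by rewrite (Christoffel_words Hmu Hprob Hnt d0); exact: ktle.
pose q n := minimiser mu n.
have qP n := minimiser_spec Hmu Hprob Hnt d0 n.
have q1 n : const_coef (q n) = 1 by have [] := qP n.
have [f [f0 fmu]] := limit_vector Hmu Hprob Hnt d0 cC.
have fac : nc_le (vstate f) mu_ac.
  by apply: ac_max fmu; [exact: vstate_measure|exact: vstate_abs_continuous].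
have pos (Q : ncpoly R d) : disc_system (adj (polyL Q) \o polyL Q) /\
    positive_op (adj (polyL Q) \o polyL Q).
  by split; [exact: prod_disc|exact: positive_prod].
have ac_lo (Q : ncpoly R d) : const_coef Q = 1 -> kt <= complex.Re (pdot mu_ac Q Q).
  move=> Q1; have [dQ pQ] := pos Q; have := Re_le (fac _ dQ pQ).
  apply: le_trans; have := vstate_const f Q; apply: le_trans.
  by rewrite Q1 Normc.normc1 expr1n mul1r f0.
have ac_up n : complex.Re (pdot mu_ac (q n) (q n)) <= Christoffel mu n.
  have [dQ pQ] := pos (q n); have [_ _ _ <-] := qP n.
  exact: Re_le (ac_le _ dQ pQ).
have up n : complex.Re (pdot mu (q n) (q n)) <= Christoffel mu n.
  by have [_ _ _ <-] := qP n.
have lo (Q : ncpoly R d) : const_coef Q = 1 -> kt <= complex.Re (pdot mu Q Q).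
  move=> Q1; have [n sn] := supported_words Q; apply: le_trans (leC n) _.
  exact: (Christoffel_min Hmu Hprob Hnt d0 sn Q1).
exists kappa, kt; split; last split; last split.
- split.
  + exact: c1.
  + have E : (fun n => (leading_coef mu (lastword d n)) ^- 2 : R[i]^o) =
        fun n => (pnorm mu (Phi mu (lastword d n)) ^+ 2)%:C.
      apply/funext => n; rewrite (leading_coefE Hmu Hnt d0).
      by rewrite -rmorphXn -fmorphV exprVn invrK.
    rewrite E; exact: cvg_realC c1.
  + rewrite -cvg_shiftS /=.
    under eq_fun do rewrite -(pnormPhi_prod Hmu Hprob Hnt d0).
    exact: c1.
  + have c2 := cvg_realC c1; rewrite -cvg_shiftS /= in c2.
    rewrite -cvg_shiftS /=.
    have E n : toeplitz_det mu (lastword d n.+1) /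
        toeplitz_det mu (wpred (lastword d n.+1)) =
        (pnorm mu (Phi mu (lastword d n.+1)) ^+ 2)%:C.
      by rewrite (toeplitz_det_ratio Hmu Hnt d0)// (lastwordS d0).
    under eq_fun do rewrite E.
    exact: c2.
- split.
  + exact: prod_totally D01 _ _ ckt.
  + exact: Christoffel_infE cC lo q1 up.
  + exact: Christoffel_infE cC ac_lo q1 ac_up.
  + by under eq_fun do rewrite (phi_sharp_const Hmu Hprob Hnt d0).
- split.
  + exact: cC.
  + move=> n; apply: in_spanP; first exact: upto_uniq.
    by rewrite upto_lastword//; have [] := qP n.
  + have E n : hdot (sqrtT (polyL (q n) hone)) (sqrtT (polyL (q n) hone)) =
        (complex.Re (pdot mu_ac (q n) (q n)))%:C.
      have dq : disc_algebra (polyL (q n)) by exact: polyL_disc.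
      rewrite -(RN _ _ dq dq); have [_ pm] := Hac; have [dQ pQ] := pos (q n).
      exact/ge0_complexE/pm.
    under eq_fun do rewrite E.
    apply: cvg_realC; apply: (squeeze_cvgr _ (cvg_cst kt) cC).
    by apply: filterE => n; rewrite ac_lo//= ac_up.
  + have k0 : 0 <= kt.
      by apply: (cvg_ge_bound cC); apply: filterE => n; exact/ltW/Christoffel_gt0.
    exists [the measure (measurableTypeR R) R of dirac (kt : measurableTypeR R)]; split.
      rewrite -[LHS]/(\d_kt [set t : R | t < 0]) diracE memNset//= => /lt_geF.
      by rewrite k0.
    apply: etrans (integral_dirac _ _ _) _.
    - exact: measurable_itv.
    - exact: measurable_realfun.EFin_measurable.
    - by rewrite diracE mem_set ?mul1e//= in_itv /= k0.
- exists rest; split; first exact: prod_totally D01 _ _ cr.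
  have E : (fun n => \prod_(s <- words_upto d n) defect mu s) =
      fun n => (\prod_(s <- words_upto d n | s \in range (lastword d)) defect mu s) *
        (\prod_(s <- words_upto d n | s \notin range (lastword d)) defect mu s).
    by apply/funext => n; rewrite (bigID (fun s => s \in range (lastword d))).
  have c := cvgM ck cr; have ckt' := ckt; rewrite E in ckt'.
  by rewrite -(cvg_lim _ ckt')// (cvg_lim _ (c _)).
Qed.
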